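(* Let $\gamma>0$, $\omega\in W^{-s,2}(\Omega)$ and $u\in W^{s,2}_{\mathrm{loc}}(\Omega)$. Consider the following two problems. Problem (D): 1. $u>0$ a.e. in $\Omega$ and $u^{-\gamma}\in L^1_{\mathrm{loc}}(\Omega)$; 2. for every $\varphi\in C^\infty_c(\Omega)$, $$\frac{c_{N,s}}{2}\iint_{\mathbb R^{2N}}\frac{(u(x)-u(y))(\varphi(x)-\varphi(y))}{|x-y|^{N+2s}}\,dx\,dy-\int_\Omega u^{-\gamma}\varphi\,dx=\langle\omega,\varphi\rangle;$$ 3. $u\le 0$ on $\partial\Omega$. Problem (V): 1. $u>0$ a.e. in $\Omega$ and $u^{-\gamma}\in L^1_{\mathrm{loc}}(\Omega)$; 2. for every $v\in u+\big(W^{s,2}_0(\Omega)\cap L^\infty_c(\Omega)\big)$ with $v\ge 0$ a.e. in $\Omega$, $$\frac{c_{N,s}}{2}\iint_{\mathbb R^{2N}}\frac{(u(x)-u(y))\big((v(x)-u(x))-(v(y)-u(y))\big)}{|x-y|^{N+2s}}\,dx\,dy-\int_\Omega u^{-\gamma}(v-u)\,dx\ge\langle\omega,v-u\rangle;$$ 3. $u\le 0$ on $\partial\Omega$. If $u$ satisfies problem (D), then $u$ is the solution to problem (V). Moreover, if $\omega\in W^{-s,2}(\Omega)\cap L^1_{\mathrm{loc}}(\Omega)$, then problems (D) and (V) are equivalent, i.e. $u$ satisfies (D) if and only if $u$ satisfies (V).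
   Context: Standing assumptions: $0<s<1$, $N>2s$, $\Omega\subset\mathbb R^N$ is a bounded smooth domain. The constant is $c_{N,s}=\Big(\int_{\mathbb R^N}\frac{1-\cos(\xi_1)}{|\xi|^{N+2s}}\,d\xi\Big)^{-1}>0$. Function spaces. For measurable $u:\mathbb R^N\to\mathbb R$, $[u]_{D^{s,2}(\mathbb R^N)}=\big(\iint_{\mathbb R^{2N}}\frac{|u(x)-u(y)|^2}{|x-y|^{N+2s}}\,dx\,dy\big)^{1/2}$; $W^{s,2}(\mathbb R^N)=\{u\in L^2(\mathbb R^N):[u]_{D^{s,2}(\mathbb R^N)}<\infty\}$; $W^{s,2}_0(\Omega)=\{u\in W^{s,2}(\mathbb R^N): u=0 \text{ a.e. in }\mathbb R^N\setminus\Omega\}$ with norm $[\cdot]_{D^{s,2}(\mathbb R^N)}$; $W^{-s,2}(\Omega)$ is the dual of $W^{s,2}_0(\Omega)$ and $\langle\cdot,\cdot\rangle$ is the duality pairing. $W^{s,2}_{\mathrm{loc}}(\Omega)$ is the set of $u:\Omega\to\mathbb R$ such that, for all $K\Subset\Omega$, $u\in L^2(K)$ and $\iint_{K\times K}\frac{|u(x)-u(y)|^2}{|x-y|^{N+2s}}\,dx\,dy<\infty$. Functions on $\Omega$ are understood to be extended by $0$ to $\mathbb R^N\setminus\Omega$. $L^\infty_c(\Omega)$ denotes the essentially bounded functions with compact support contained in $\Omega$, and $C_c^\infty(\Omega)$ the smooth functions with compact support contained in $\Omega$. The condition $\omega\in W^{-s,2}(\Omega)\cap L^1_{\mathrm{loc}}(\Omega)$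 means that $\omega\in W^{-s,2}(\Omega)$ is represented by an $L^1_{\mathrm{loc}}(\Omega)$ function, i.e. $\langle\omega,\varphi\rangle=\int_\Omega\omega\varphi\,dx$ for $\varphi\in C_c^\infty(\Omega)$. Boundary condition: $u\le 0$ on $\partial\Omega$ means that $(u-\varepsilon)^+\in W^{s,2}_0(\Omega)$ for every $\varepsilon>0$. *)

(* Defs.v *)
From HB Require Import structures.
From mathcomp Require Import all_boot all_order all_algebra.
From mathcomp Require Import all_classical all_reals all_analysis.
Set Implicit Arguments.
Unset Strict Implicit.
Unset Printing Implicit Defensive.
Import Order.TTheory GRing.Theory Num.Theory.
Import numFieldNormedType.Exports.
Local Open Scope classical_set_scope.
Local Open Scope ring_scope.

(* The coordinates generate the product sigma-algebra on R^n, i.e. the Borel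
   sigma-algebra; cf. the instance for n.-tuple in mathcomp.analysis. *)
Section measurable_rV.
Context {R : realType} (n : nat).

Definition rV_coord (i : 'I_n) (x : 'rV[R]_n) : R := x ord0 i.

Let rV_set0 : g_sigma_preimage rV_coord set0.
Proof. exact: sigma_algebra0. Qed.

Let rV_setC A : g_sigma_preimage rV_coord A -> g_sigma_preimage rV_coord (~` A).
Proof. exact: sigma_algebraC. Qed.

Let rV_bigcup (F : _^nat) : (forall i, g_sigma_preimage rV_coord (F i)) ->
  g_sigma_preimage rV_coord (\bigcup_i (F i)).
Proof. exact: sigma_algebra_bigcup. Qed.

HB.instance Definition _ := @isMeasurable.Build default_measure_display
  'rV[R]_n (g_sigma_preimage rV_coord) rV_set0 rV_setC rV_bigcup.

Lemma measurable_rV_coord i : measurable_fun [set: 'rV[R]_n] (rV_coord i).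
Proof.
move=> _ Y mY; rewrite setTI; apply: sub_sigma_algebra => /=.
rewrite -bigcup_seq/=; exists i => /=; first by rewrite mem_index_enum.
by exists Y => //; rewrite setTI.
Qed.

Lemma measurable_fun_rVP d (T : measurableType d) (f : T -> 'rV[R]_n) :
  measurable_fun setT f <-> forall i, measurable_fun setT (rV_coord i \o f).
Proof.
split=> [mf i|mf]; first exact: measurableT_comp (measurable_rV_coord i) mf.
move=> _; apply: smallest_sub.
  split=> [|A|F mF] /=.
  - by rewrite preimage_set0 setI0.
  - by rewrite !setTI setTD preimage_setC; exact: measurableC.
  - rewrite preimage_bigcup setI_bigcupr; exact: bigcupT_measurable.
rewrite -bigcup_seq/= => A [i _ [B mB <-]] /=.
by rewrite !setTI -comp_preimage -[X in measurable X]setTI; exact: mf.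
Qed.

End measurable_rV.

Section lebesgue_rV.
Context {R : realType}.
Local Open Scope ereal_scope.
Local Notation leb := (@lebesgue_measure R).

Definition rV_cons n (p : R * 'rV[R]_n) : 'rV[R]_n.+1 :=
  \row_i (if unlift ord0 i is Some j then p.2 ord0 j else p.1).

Definition rV_uncons n (x : 'rV[R]_n.+1) : R * 'rV[R]_n :=
  (x ord0 ord0, \row_j x ord0 (lift ord0 j)).

Lemma rV_consK n : cancel (@rV_cons n) (@rV_uncons n).
Proof.
case=> a x; rewrite /rV_uncons /rV_cons; congr pair; first by rewrite mxE unlift_none.
by apply/rowP => j; rewrite !mxE liftK.
Qed.

Lemma rV_unconsK n : cancel (@rV_uncons n) (@rV_cons n).
Proof.
by move=> x; apply/rowP => i; rewrite mxE /=; case: unliftP => [j|] ->; rewrite ?mxE.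
Qed.

Lemma measurable_rV_cons n : measurable_fun setT (@rV_cons n).
Proof.
apply/measurable_fun_rVP => i; have [j ->|->] := unliftP ord0 i.
  rewrite (_ : _ \o _ = rV_coord j \o snd).
    exact: measurableT_comp (measurable_rV_coord j) measurable_snd.
  by apply/funext => p; rewrite /rV_coord /= mxE liftK.
rewrite (_ : _ \o _ = fst); first exact: measurable_fst.
by apply/funext => p; rewrite /rV_coord /= mxE unlift_none.
Qed.

Lemma measurable_rV_uncons n : measurable_fun setT (@rV_uncons n).
Proof.
apply: measurable_fun_pair; first exact: (measurable_rV_coord ord0).
apply/measurable_fun_rVP => j.
rewrite (_ : _ \o _ = rV_coord (lift ord0 j)); first exact: measurable_rV_coord.
by apply/funext => x; rewrite /rV_coord /= mxE.
Qed.

Section step.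
Variables (n : nat) (mu : {sigma_finite_measure set 'rV[R]_n -> \bar R}).

Definition lebesgue_rV_step : set 'rV[R]_n.+1 -> \bar R :=
  pushforward (leb \x mu) (@rV_cons n).

Let step0 : lebesgue_rV_step set0 = 0.
Proof. by rewrite /lebesgue_rV_step /pushforward preimage_set0 measure0. Qed.

Let step_ge0 A : 0 <= lebesgue_rV_step A.
Proof. by rewrite /lebesgue_rV_step /pushforward measure_ge0. Qed.

Let step_sigma_additive : semi_sigma_additive lebesgue_rV_step.
Proof.
have mp A : measurable A -> measurable (@rV_cons n @^-1` A).
  by move=> mA; rewrite -[X in measurable X]setTI; exact: measurable_rV_cons.
move=> F mF tF mUF; rewrite /lebesgue_rV_step /pushforward preimage_bigcup.
apply: measure_semi_sigma_additive.
- by move=> k; exact: mp.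
- apply/trivIsetP => /= i j _ _ ij; rewrite -preimage_setI.
  by move/trivIsetP : tF => /(_ _ _ _ _ ij) ->//; rewrite preimage_set0.
- by rewrite -preimage_bigcup; exact: mp.
Qed.

HB.instance Definition _ := isMeasure.Build _ _ _
  lebesgue_rV_step step0 step_ge0 step_sigma_additive.

Let step_sigma_finite : sigma_finite setT lebesgue_rV_step.
Proof.
have /sigma_finiteP[F [FT ndF Foo]] : sigma_finite setT leb by exact: sigma_finiteT.
have /sigma_finiteP[G [GT ndG Goo]] := sigma_finiteT mu.
exists (fun k => @rV_uncons n @^-1` (F k `*` G k)).
  rewrite -preimage_bigcup -[LHS](preimage_setT (@rV_uncons n)); congr (_ @^-1` _).
  rewrite -setXTT FT GT predeqE => -[x y]; split.
    move=> [/= [k _ Fkx] [l _ Gly]]; exists (maxn k l) => //; split.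
    - by move: x Fkx; exact/subsetPset/ndF/leq_maxl.
    - by move: y Gly; exact/subsetPset/ndG/leq_maxr.
  by move=> [k _ []/= ? ?]; split; exists k.
move=> k; have [mF Fk] := Foo k; have [mG Gk] := Goo k; split.
  rewrite -[X in measurable X]setTI.
  by apply: measurable_rV_uncons => //; exact: measurableX.
rewrite /lebesgue_rV_step /pushforward (_ : _ @^-1` _ = F k `*` G k).
  by rewrite product_measure1E// lte_mul_pinfty// ge0_fin_numE.
rewrite -comp_preimage (_ : _ \o _ = id) ?preimage_id//.
by apply/funext => p; exact: rV_consK.
Qed.

HB.instance Definition _ := Measure_isSigmaFinite.Build _ _ _
  lebesgue_rV_step step_sigma_finite.

End step.

Fixpoint lebesgue_rV n : {sigma_finite_measure set 'rV[R]_n -> \bar R} :=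
  if n is m.+1 then lebesgue_rV_step (lebesgue_rV m)
  else \d_ (0 : 'rV[R]_0)%R.

Arguments lebesgue_rV : simpl never.

Lemma measurable_rV_box n (A : 'I_n -> set (measurableTypeR R)) :
  (forall i, measurable (A i)) ->
  measurable [set x : 'rV[R]_n | forall i, A i (x ord0 i)].
Proof.
move=> mA; rewrite (_ : mkset _ = \bigcap_(i in [set: 'I_n]) rV_coord i @^-1` A i).
  apply: fin_bigcap_measurable => // i _.
  by rewrite -[X in measurable X]setTI; apply: measurable_rV_coord => //; exact: mA.
by apply/seteqP; split=> x Ax i => [_|]; [exact: Ax|exact: (Ax i I)].
Qed.

Lemma lebesgue_rV_box n (A : 'I_n -> set (measurableTypeR R)) :
  (forall i, measurable (A i)) ->
  lebesgue_rV n [set x | forall i, A i (x ord0 i)] = \prod_(i < n) leb (A i).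
Proof.
elim: n A => [|n IHn] A mA.
  rewrite big_ord0 /= diracE mem_set//=; by case.
rewrite big_ord_recl -IHn//= /lebesgue_rV_step /pushforward -product_measure1E//.
  congr (_ \x _); apply/seteqP; split=> -[a x] /=.
    move=> Ax; split; first by have := Ax ord0; rewrite mxE unlift_none.
    by move=> i; have := Ax (lift ord0 i); rewrite mxE liftK.
  by move=> [Aa Ax] i; rewrite mxE; case: unliftP => [j|] ->//; exact: Ax.
exact: (@measurable_rV_box n (fun i => A (lift ord0 i)) (fun i => mA _)).
Qed.

End lebesgue_rV.

Section euclidean.
Context {R : realType} {n : nat}.
Implicit Types (x : 'rV[R]_n) (A D : set 'rV[R]_n) (f : 'rV[R]_n -> R).

(* The norm `|x| of the library is the sup norm. *)
Definition enorm x : R := Num.sqrt (\sum_(i < n) x ord0 i ^+ 2).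

Definition compactly_contained A D := compact (closure A) /\ closure A `<=` D.

Definition iter_partial (s : seq 'I_n) f : 'rV[R]_n -> R :=
  foldr (fun i g => 'D_(delta_mx ord0 i) g) f s.

Definition smooth f := forall s : seq 'I_n,
  continuous (iter_partial s f) /\
  forall i x, derivable (iter_partial s f) x (delta_mx ord0 i).

Definition Cc_smooth D f :=
  smooth f /\ compactly_contained [set x | f x != 0] D.

(* Near each boundary point, D is the negative side {rho < 0} of a smooth
   function rho vanishing there with nonzero gradient. *)
Definition smooth_boundary D := forall x0, (closure D `\` interior D) x0 ->
  exists U (rho : 'rV[R]_n -> R), [/\ nbhs x0 U, smooth rho, rho x0 = 0,
    exists i, 'D_(delta_mx ord0 i) rho x0 != 0 &
    forall x, U x -> (D x <-> rho x < 0)].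

Definition bounded_smooth_domain D :=
  [/\ D !=set0, open D, connected D, bounded_set D & smooth_boundary D].

End euclidean.

(* Functions defined up to a.e. equality are represented by Borel functions
   on the whole space; the dimension is N = n.+1. *)
Section fractional_spaces.
Context {R : realType} {n : nat}.
Local Notation E := 'rV[R]_n.+1.
Local Notation mu := (@lebesgue_rV R n.+1).
Local Notation mu2 := (mu \x mu)%E.
Implicit Types (s gamma : R) (D : set E) (u v w f : E -> R).

(* On the (null) diagonal the kernel is 0, and so are the quotients by it. *)
Definition frac_kernel s (z : E * E) : R :=
  enorm (z.1 - z.2) `^ (n.+1%:R + 2 * s).

Definition frac_const s : R :=
  (\int[mu]_xi ((1 - cos (xi ord0 ord0)) / enorm xi `^ (n.+1%:R + 2 * s)))^-1.

Definition gagliardo2 s (A : set (E * E)) u : \bar R :=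
  (\int[mu2]_(z in A) (`|u z.1 - u z.2| ^+ 2 / frac_kernel s z)%:E)%E.

Definition gagliardo s u : R := Num.sqrt (fine (gagliardo2 s setT u)).

Definition frac_form s u v : R :=
  \int[mu2]_z ((u z.1 - u z.2) * (v z.1 - v z.2) / frac_kernel s z).

Definition Ws2 s u := u \in Lfun mu 2%:E /\ (gagliardo2 s setT u < +oo)%E.

Definition Ws20 s D u := Ws2 s u /\ \forall x \ae mu, ~ D x -> u x = 0.

(* Functions on D are represented by their extension by 0. *)
Definition Ws2loc s D u :=
  [/\ measurable_fun setT u, forall x, ~ D x -> u x = 0 &
   forall K, measurable K -> compactly_contained K D ->
     (\int[mu]_(x in K) (`|u x| ^+ 2)%:E < +oo)%E /\
     (gagliardo2 s (K `*` K) u < +oo)%E].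

Definition L1loc D f := measurable_fun D f /\
  forall K, measurable K -> compactly_contained K D -> mu.-integrable K (EFin \o f).

Definition Linftyc D f := f \in Lfun mu +oo%E /\
  exists K, [/\ compact K, K `<=` D & \forall x \ae mu, ~ K x -> f x = 0].

(* Functionals on raw functions: by the bound, they only depend on a.e. classes. *)
Definition dual_Ws20 s D (omega : (E -> R) -> R) :=
  (forall (a : R) u v, Ws20 s D u -> Ws20 s D v ->
     omega (fun x => a * u x + v x) = a * omega u + omega v) /\
  exists C : R, forall u, Ws20 s D u -> `|omega u| <= C * gagliardo s u.

Definition dual_L1loc D (omega : (E -> R) -> R) := exists2 w, L1loc D w &
  forall phi, Cc_smooth D phi -> omega phi = \int[mu]_(x in D) (w x * phi x).

Definition le0_boundary s D u := forall eps : R, 0 < eps ->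
  Ws20 s D (fun x => Num.max (u x - eps) 0).

Definition problem_D s gamma D (omega : (E -> R) -> R) u : Prop :=
  [/\ (\forall x \ae mu, D x -> 0 < u x) /\ L1loc D (fun x => u x `^ (- gamma)),
   forall phi, Cc_smooth D phi ->
     frac_const s / 2 * frac_form s u phi -
       \int[mu]_(x in D) (u x `^ (- gamma) * phi x) = omega phi &
   le0_boundary s D u].

Definition problem_V s gamma D (omega : (E -> R) -> R) u : Prop :=
  [/\ (\forall x \ae mu, D x -> 0 < u x) /\ L1loc D (fun x => u x `^ (- gamma)),
   forall v, Ws20 s D (v \- u) -> Linftyc D (v \- u) ->
     (\forall x \ae mu, D x -> 0 <= v x) ->
     frac_const s / 2 * frac_form s u (v \- u) -
       \int[mu]_(x in D) (u x `^ (- gamma) * (v x - u x)) >= omega (v \- u) &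
   le0_boundary s D u].

End fractional_spaces.

Arguments frac_const {R} n s.

(* Main.v *)
(** Mollify: [f_k = rho_k * f], where [rho_k] is a smooth kernel supported in the
    ball of radius [1/k]. Jensen's inequality gives
    [|f_k(x) - f(x)|^2 <= C k^(-2s) \int |f(x) - f(y)|^2 / |x - y|^(N+2s) dy],
    so a finite Gagliardo seminorm makes [f_k] converge to [f] almost everywhere
    without the Lebesgue differentiation theorem; Jensen and Fatou then upgrade
    this to convergence in the Gagliardo seminorm. Near the support of a bounded
    compactly supported [f] the form [(u, f)] is the product of two [L^2]
    functions of [(x, y)], and away from it the kernel is integrable; hence the weak
    equation extends from smooth test functions to bounded compactly supported
    ones, and (D) implies (V), with equality.
    Conversely, (V) is tested with [v = max(0, u + t phi)]: the negative part of
    [u + t phi] contributes to the form with a favourable sign, up to a term which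
    vanishes as [t -> 0]. Applying this to [phi] and [- phi] gives (D). *)
From HB Require Import structures.
Require Import Defs.
From mathcomp Require Import all_boot all_order all_algebra.
From mathcomp Require Import all_classical all_reals all_analysis.
From mathcomp Require Import measurable_realfun ess_sup_inf lra ring.
Set Implicit Arguments.
Unset Strict Implicit.
Unset Printing Implicit Defensive.
Import Order.TTheory GRing.Theory Num.Def Num.Theory.
Import numFieldNormedType.Exports.
Local Open Scope classical_set_scope.
Local Open Scope ring_scope.

(** The local space controls [u] only on compact subsets of the domain, whereas the form integrates
    over the whole space. The gap is closed by the boundary condition: with threshold 1 it puts the
    positive part of u - 1 in L^2, and since the domain is bounded and [u] is positive there, [u] is
    globally integrable, so that its tail can be paired with the integrable part of the kernel. This
    pairing is not controlled by the Gagliardo seminorm of the test function; limits in the form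
    therefore also need a uniform bound, a common compact support and convergence almost everywhere,
    all of which mollification supplies.

    In the converse direction the truncations max(- u / t, phi) converge to phi pointwise and
    boundedly, but their seminorms are bounded only by quantities that grow as t tends to 0. The
    seminorm continuity of [omega] cannot carry this limit, while an integral against a locally
    integrable function can, by dominated convergence. For the form, an upper bound suffices, and
    the sign of the negative part provides it. *)

Section rV_borel.
Context {R : realType} {n : nat}.
Local Notation E := 'rV[R]_n.

(** * Borel sets of R^n, and the sup norm against the Euclidean norm *)

Lemma rV_normP (x : E) (r : R) : 0 <= r ->
  `|x| <= r <-> forall i, `|x ord0 i| <= r.
Proof.
move=> r0; rewrite [`|x|]/normr /= mx_normrE; split=> [/bigmax_leP[_ xr] i|xr].
  exact: (xr (ord0, i)).
by apply/bigmax_leP; split=> // -[i j] _ /=; rewrite (ord1 i).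
Qed.

Lemma coord_le_norm (x : E) i : `|x ord0 i| <= `|x|.
Proof. by move/rV_normP : (lexx `|x|) => /(_ (normr_ge0 _)). Qed.

Lemma measurable_rV_ball (x : E) (e : R) : measurable (ball x e).
Proof.
have [e0|e0] := ltP 0 e; last first.
  rewrite (_ : ball x e = set0)// -subset0 => y [+ _].
  by rewrite ltNge e0.
rewrite (_ : ball x e = [set y | forall i, ball (x ord0 i) e (y ord0 i)]).
  apply: (@measurable_rV_box _ _ (fun i => ball (x ord0 i) e)) => i.
  by apply: open_measurable; exact: ball_open.
apply/seteqP; split => y; first by move=> [_ xy] i; exact: xy.
by move=> xy; split => // i j; rewrite (ord1 i).
Qed.

(** The sigma-algebra is generated by the coordinates, so second countability is needed: an open set
    is the union of the sup-norm balls with rational centre and radius [1/(k+1)] that it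
    contains. *)
Lemma open_measurable_rV (A : set E) : open A -> measurable A.
Proof.
move=> oA.
pose F (p : 'rV[rat]_n * nat) : set E :=
  if `[< ball (map_mx ratr p.1 : E) (p.2.+1%:R^-1) `<=` A >]
  then ball (map_mx ratr p.1 : E) (p.2.+1%:R^-1) else set0.
suff -> : A = \bigcup_p F p.
  apply: countable_bigcupT_measurable => [|p]; [exact: countableP|rewrite /F].
  by case: ifPn => // _; exact: measurable_rV_ball.
apply/seteqP; split => [x Ax|x [p _]]; last first.
  by rewrite /F; case: ifPn => // /asboolP; exact.
have /nbhs_ballP[e /= e0 xeA] : nbhs x A by exact: open_nbhs_nbhs.
(* A rational centre within [1/(k+1)] of [x] has its ball inside the ball of radius [2/(k+1) < e]
   around [x]. *)
have e20 : 0 < e / 2 by rewrite divr_gt0.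
have [k ke] : exists k, k.+1%:R^-1 < e / 2.
  near \oo => k; exists k; near: k; exact: near_infty_natSinv_lt (PosNum e20).
have k0 : 0 < k.+1%:R^-1 :> R by rewrite invr_gt0.
have /choice[q xq] i : exists q : rat, `|x ord0 i - ratr q| < k.+1%:R^-1.
  have : x ord0 i - k.+1%:R^-1 < x ord0 i + k.+1%:R^-1.
    by rewrite ltrD2l gtrN.
  move=> /rat_in_itvoo[q]; rewrite in_itv/= => /andP[q1 q2].
  by exists q; rewrite distrC ltr_distl q1 q2.
have qb : ball (map_mx ratr (\row_i q i) : E) (k.+1%:R^-1) x.
  by split => // i j; rewrite (ord1 i) !mxE /ball/= distrC; exact: xq.
exists (\row_i q i, k) => //; rewrite /F; case: asboolP => //=; case.
apply: subset_trans xeA => y qy.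
apply: (@le_ball _ _ x (k.+1%:R^-1 + k.+1%:R^-1)).
  by rewrite [leRHS]splitr lerD// ltW.
by apply: ball_triangle qy; exact: ball_sym.
Unshelve. all: by end_near. Qed.

Lemma closed_measurable_rV (A : set E) : closed A -> measurable A.
Proof. by move/closed_openC/open_measurable_rV/measurableC; rewrite setCK. Qed.

Lemma continuous_measurable_rV (f : E -> R) :
  continuous f -> measurable_fun setT f.
Proof.
move=> /continuousP cf; apply: (measurability _ (RGenOpens.measurableE R)).
move=> _ [_ [a [b ->] <-]]; rewrite setTI.
by apply: open_measurable_rV; apply: cf; exact: interval_open.
Qed.

Lemma measurable_funB_rV d (T : measurableType d) (f g : T -> E) :
  measurable_fun setT f -> measurable_fun setT g ->
  measurable_fun setT (fun x => f x - g x).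
Proof.
move=> /measurable_fun_rVP mf /measurable_fun_rVP mg.
apply/measurable_fun_rVP => i.
rewrite (_ : _ \o _ = (rV_coord i \o f) \- (rV_coord i \o g)).
  exact: measurable_funB.
by apply/funext => x; rewrite /rV_coord /= !mxE.
Qed.

Lemma measurable_enorm : measurable_fun setT (@enorm R n).
Proof.
apply: measurableT_comp.
  exact: (continuous_measurable_fun (@sqrt_continuous R)).
apply: measurable_sum => i; apply: measurable_funX.
exact: (measurable_rV_coord i).
Qed.

(** The kernel is written with the Euclidean norm, while balls and supports are measured in the sup
    norm; this bound and the next one translate between the two. *)
Lemma norm_le_enorm (x : E) : `|x| <= enorm x.
Proof.
apply/rV_normP; first exact: sqrtr_ge0.
move=> i; rewrite -sqrtr_sqr ler_wsqrtr// (bigD1 i)//= lerDl sumr_ge0// => j _.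
exact: sqr_ge0.
Qed.

Lemma enorm_le_norm (x : E) : enorm x <= Num.sqrt n%:R * `|x|.
Proof.
rewrite -(ger0_norm (normr_ge0 x)) -sqrtr_sqr -sqrtrM ?ler0n// ler_wsqrtr//.
rewrite -[n in n%:R]card_ord -sum1_card natr_sum mulr_suml ler_sum// => i _.
by rewrite mul1r -real_normK ?num_real// lerXn2r ?nnegrE// coord_le_norm.
Qed.

End rV_borel.

(** * Invariance of Lebesgue measure and of integrals under reflections and translations *)

Section invariance.
Context {R : realType}.
Local Open Scope ereal_scope.
Local Notation leb := (@lebesgue_measure R).

Let measurable_reflect (a : R) : measurable_fun [set: measurableTypeR R]
  (fun t : measurableTypeR R => (a - t)%R : measurableTypeR R).
Proof.
exact: (measurable_funB (measurable_cst a) (@measurable_id _ _ setT)).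
Qed.

(** The push-forward by a reflection gives every generating interval its length; the preimage of
    []x, y]] is [[a - y, a - x[], the open and closed ends being exchanged. *)
Lemma lebesgue_measure_reflect (a : R) (A : set (measurableTypeR R)) :
  measurable A -> leb ((fun t => a - t)%R @^-1` A) = leb A.
Proof.
pose nu := measure_function_pushforward__canonical__measure_function_Measure leb (measurable_reflect a).
move=> mA; apply/esym; apply: (lebesgue_measure_unique (mu := nu)) => // _ [[x y] _ <-] /=.
rewrite /pushforward.
rewrite (_ : _ @^-1` _ = `[(a - y)%R, (a - x)%R[%classic); last first.
  apply/seteqP; split => t /=; rewrite !in_itv/=; lra.
rewrite !lebesgue_measure_itv/= !lte_fin.
have -> : ((a - y < a - x) = (x < y))%R by rewrite ltrD2l ltrN2.
by case: ifPn => // _; rewrite -!EFinB; congr (_%:E); lra.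
Qed.

(** Boxes form a generating pi-system on which both measures are given by the product formula.
    Reflections come first because a convolution needs the change of variable [x - y], and two
    reflections compose to a translation. *)
Lemma lebesgue_rV_reflect n (a : 'rV[R]_n.+1) (A : set 'rV[R]_n.+1) :
  measurable A -> lebesgue_rV n.+1 ((fun y => a - y)%R @^-1` A) = lebesgue_rV n.+1 A.
Proof.
have mr : measurable_fun [set: 'rV[R]_n.+1] (fun y : 'rV[R]_n.+1 => a - y)%R.
  exact: (measurable_funB_rV (measurable_cst a) (@measurable_id _ _ setT)).
pose nu := measure_function_pushforward__canonical__measure_function_Measure (@lebesgue_rV R n.+1) mr.
pose box (B : 'I_n.+1 -> set (measurableTypeR R)) :=
  [set x : 'rV[R]_n.+1 | forall i, B i (x ord0 i)].
have boxE B : (forall i, measurable (B i)) ->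
    lebesgue_rV n.+1 (box B) = \prod_(i < n.+1) leb (B i).
  exact: lebesgue_rV_box.
pose G := [set A | exists2 B, (forall i, measurable (B i)) & A = box B].
move=> mA; apply/esym.
apply: (@measure_unique _ R _ G (fun k => box (fun=> `[(- k%:R)%R, k%:R]%classic))
  _ _ _ _ (@lebesgue_rV R n.+1) nu) => //.
- apply/seteqP; split; last first.
    apply: smallest_sub; first exact: sigma_algebra_measurable.
    by move=> _ [B mB ->]; exact: measurable_rV_box.
  apply: smallest_sub; first exact: smallest_sigma_algebra.
  rewrite -bigcup_seq/= => _ [i _ [B mB <-]] /=; apply: sub_sigma_algebra.
  exists (fun j => if j == i then B else setT).
    by move=> j; case: ifP => // _; exact: measurableT.
  rewrite setTI; apply/seteqP; split => [x Bx j|x /(_ i)]; last by rewrite eqxx.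
  by case: eqP => // ->.
- move=> _ _ [B mB ->] [C mC ->]; exists (fun i => B i `&` C i).
    by move=> i; exact: measurableI.
  apply/seteqP; split => [x [Bx Cx] i|x BCx]; first by split; [exact: Bx|exact: Cx].
  by split=> i; case: (BCx i).
- by move=> k; exists (fun=> `[(- k%:R)%R, k%:R]%classic) => // i; exact: measurable_itv.
- rewrite -subTset => x _; exists (Num.bound `|x|) => // i /=.
  rewrite in_itv/= -ler_norml (le_trans (coord_le_norm x i))//.
  by rewrite ltW// archi_boundP.
- move=> _ [B mB ->]; apply: (etrans (boxE B mB)); apply/esym.
  rewrite /nu/= /pushforward.
  rewrite (_ : _ @^-1` _ = box (fun i => (fun t => a ord0 i - t)%R @^-1` B i)).
    apply: (etrans (boxE _ _)).
      move=> i; rewrite -[X in measurable X]setTI.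
      exact: measurable_reflect.
    by apply: eq_bigr => i _; rewrite lebesgue_measure_reflect.
  by apply/seteqP; split => x /= Bx i; move: (Bx i); rewrite !mxE.
- move=> k; rewrite [ltLHS](boxE _ _) => [|i]; last exact: measurable_itv.
  rewrite (eq_bigr (fun=> (k%:R + k%:R)%:E)); last first.
    move=> i _; rewrite lebesgue_measure_itv/= lte_fin.
    case: ifPn => [_|]; first by rewrite -EFinB opprK.
    rewrite -leNgt => kk; congr EFin; have := ler0n R k; lra.
  by rewrite prodEFin ltry.
Qed.

Section integrals.
Variable n : nat.
Local Notation E := 'rV[R]_n.+1.
Local Notation mu := (@lebesgue_rV R n.+1).

Lemma measurable_rV_reflect (a : E) : measurable_fun setT (fun y : E => a - y)%R.
Proof. exact: (measurable_funB_rV (measurable_cst a) (@measurable_id _ _ setT)). Qed.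

Lemma measurable_rV_translate (a : E) : measurable_fun setT (fun y : E => y - a)%R.
Proof. exact: (measurable_funB_rV (@measurable_id _ _ setT) (measurable_cst a)). Qed.

Lemma ge0_integral_reflect (a : E) (f : E -> \bar R) :
  measurable_fun setT f -> (forall y, 0 <= f y) ->
  \int[mu]_y f (a - y)%R = \int[mu]_y f y.
Proof.
move=> mf f0.
have /esym := @ge0_integral_pushforward _ _ _ _ _ _ (measurable_rV_reflect a) mu setT
  f measurableT mf (fun y _ => f0 y).
rewrite preimage_setT => /= ->.
apply: (eq_measure_integral mu (m1 :=
  measure_function_pushforward__canonical__measure_function_Measure mu (measurable_rV_reflect a))).
by move=> A mA _; exact: (lebesgue_rV_reflect a mA).
Qed.

Lemma integral_reflect (a : E) (f : E -> \bar R) :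
  measurable_fun setT f -> \int[mu]_y f (a - y)%R = \int[mu]_y f y.
Proof.
move=> mf; rewrite integralE [RHS]integralE; congr (_ - _).
  rewrite -[RHS](ge0_integral_reflect a (measurable_funepos mf))//.
  by apply: eq_integral => y _; rewrite !funeposE.
rewrite -[RHS](ge0_integral_reflect a (measurable_funeneg mf))//.
by apply: eq_integral => y _; rewrite !funenegE.
Qed.

Lemma ge0_integral_translate (a : E) (f : E -> \bar R) :
  measurable_fun setT f -> (forall y, 0 <= f y) ->
  \int[mu]_y f (y - a)%R = \int[mu]_y f y.
Proof.
move=> mf f0; pose g y := f (0 - y)%R.
have mg : measurable_fun setT g.
  exact: measurableT_comp mf (measurable_rV_reflect _).
transitivity (\int[mu]_y g (a - y)%R).
  by apply: eq_integral => y _; rewrite /g sub0r opprB.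
rewrite (ge0_integral_reflect a mg) => [|y]; last exact: f0.
exact: (ge0_integral_reflect 0 mf f0).
Qed.

Lemma ge0_integral2_translate (a : E) (f : E * E -> \bar R) :
  measurable_fun setT f -> (forall z, 0 <= f z) ->
  \int[mu \x mu]_z f (z.1 - a, z.2 - a)%R = \int[mu \x mu]_z f z.
Proof.
move=> mf f0.
have mt : measurable_fun setT (fun z : E * E => (z.1 - a, z.2 - a)%R).
  apply: measurable_fun_pair.
    exact: measurableT_comp (measurable_rV_translate a) measurable_fst.
  exact: measurableT_comp (measurable_rV_translate a) measurable_snd.
rewrite fubini_tonelli1 => [|//|//].
rewrite fubini_tonelli1 => [|//|//].
rewrite /fubini_F /=.
pose F x := \int[mu]_y f (x, y).
rewrite -[RHS](@ge0_integral_translate a F).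
- apply: eq_integral => x _.
  apply: (@ge0_integral_translate a (fun y => f ((x - a)%R, y))) => //.
  exact: measurableT_comp.
- exact: measurable_fun_fubini_tonelli_F.
- by move=> y; exact: integral_ge0.
- exact: measurableT_comp mf mt.
Qed.

(** By reflection the inner integral over the second variable does not depend on the first. This is
    how terms such as [|u(x)| k(x - y)] are shown to be integrable over pairs. *)
Lemma ge0_integral2_fst_conv (f k : E -> \bar R) :
  measurable_fun setT f -> (forall y, 0 <= f y) ->
  measurable_fun setT k -> (forall y, 0 <= k y) ->
  \int[mu \x mu]_z (f z.1 * k (z.1 - z.2)%R) = \int[mu]_x f x * \int[mu]_x k x.
Proof.
move=> mf f0 mk k0.
have mB : measurable_fun setT (fun z : E * E => z.1 - z.2)%R.
  exact: measurable_funB_rV measurable_fst measurable_snd.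
rewrite fubini_tonelli1 => [||z]; last by rewrite mule_ge0.
- rewrite /fubini_F -ge0_integralZr ?integral_ge0 //.
  apply: eq_integral => x _ /=; rewrite ge0_integralZl//.
    by rewrite integral_reflect.
  exact: measurableT_comp mk (measurable_rV_reflect _).
- apply: emeasurable_funM; first exact: measurableT_comp mf measurable_fst.
  exact: measurableT_comp mk mB.
Qed.

Lemma ge0_integral2_snd_conv (f k : E -> \bar R) :
  measurable_fun setT f -> (forall y, 0 <= f y) ->
  measurable_fun setT k -> (forall y, 0 <= k y) ->
  \int[mu \x mu]_z (f z.2 * k (z.1 - z.2)%R) = \int[mu]_x f x * \int[mu]_x k x.
Proof.
move=> mf f0 mk k0.
have mB : measurable_fun setT (fun z : E * E => z.1 - z.2)%R.
  exact: measurable_funB_rV measurable_fst measurable_snd.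
rewrite fubini_tonelli2 => [||z]; last by rewrite mule_ge0.
- rewrite /fubini_G -ge0_integralZr ?integral_ge0 //.
  apply: eq_integral => x _ /=; rewrite ge0_integralZl//.
    by rewrite ge0_integral_translate.
  exact: measurableT_comp mk (measurable_rV_translate _).
- apply: emeasurable_funM; first exact: measurableT_comp mf measurable_snd.
  exact: measurableT_comp mk mB.
Qed.

Lemma lebesgue_rV_cball (x : E) (r : R) : (0 <= r)%R ->
  mu [set y | `|y - x| <= r]%R = ((r *+ 2) ^+ n.+1)%:E.
Proof.
move=> r0.
pose B (i : 'I_n.+1) : set (measurableTypeR R) :=
  `[(x ord0 i - r)%R, (x ord0 i + r)%R]%classic.
have -> : [set y | `|y - x| <= r]%R = [set y | forall i, B i (y ord0 i)].
  apply/seteqP; split => y /=.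
    move/rV_normP => /(_ r0) yx i; rewrite /B/= in_itv/=.
    by have := yx i; rewrite !mxE ler_distl.
  by move=> By; apply/rV_normP => // i; move: (By i); rewrite /B/= in_itv/= !mxE ler_distl.
rewrite lebesgue_rV_box => [|i]; last exact: measurable_itv.
rewrite (eq_bigr (fun=> (r *+ 2)%:E)); last first.
  move=> i _; rewrite lebesgue_measure_itv/= lte_fin.
  case: ifPn => [_|]; first by rewrite -EFinB; congr EFin; lra.
  by rewrite -leNgt => rr; congr EFin; lra.
by rewrite prodEFin prodr_const card_ord.
Qed.

Lemma measurable_cball_rV (x : E) (r : R) : measurable [set y : E | `|y - x| <= r]%R.
Proof.
have -> : [set y : E | `|y - x| <= r]%R = closed_ball_ (fun y : E => `|y|)%R x r.
  by apply/seteqP; split => y; rewrite /closed_ball_ /= distrC.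
by apply: closed_measurable_rV; exact: closed_closed_ball_.
Qed.

Lemma lebesgue_rV_bounded (A : set E) : bounded_set A -> measurable A -> mu A < +oo.
Proof.
move=> [M1 [_ AM1]] mA; pose M := (M1 + 1)%R.
have AM x : A x -> (`|x| <= M)%R by apply: AM1; rewrite ltrDl.
have M0 : (0 <= Num.max M 0)%R by rewrite le_max lexx orbT.
apply: (@le_lt_trans _ _ (mu [set y | `|y - 0| <= Num.max M 0]%R)).
  apply: le_measure; rewrite ?inE//; first exact: measurable_cball_rV.
  by move=> y Ay /=; rewrite subr0 le_max AM.
by rewrite lebesgue_rV_cball// ltry.
Qed.

Lemma ae_reflect (a : E) (P : E -> Prop) :
  (\forall y \ae mu, P y) -> \forall y \ae mu, P (a - y)%R.
Proof.
move=> [N [mN N0 PN]]; exists ((fun y => a - y)%R @^-1` N); split.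
- by rewrite -[X in measurable X]setTI; exact: measurable_rV_reflect.
- by apply: (etrans (lebesgue_rV_reflect a mN)).
- by move=> y /= Py; exact: PN.
Qed.

Lemma ae_fst (P : E -> Prop) :
  (\forall x \ae mu, P x) -> \forall z \ae (mu \x mu), P z.1.
Proof.
move=> [N [mN N0 PN]]; exists (N `*` setT); split.
- exact: measurableX.
- by rewrite product_measure1E// [X in X * _]N0 mul0e.
- by move=> z /= Pz; split => //; exact: PN.
Qed.

Lemma ae_snd (P : E -> Prop) :
  (\forall x \ae mu, P x) -> \forall z \ae (mu \x mu), P z.2.
Proof.
move=> [N [mN N0 PN]]; exists (setT `*` N); split.
- exact: measurableX.
- by rewrite product_measure1E// [X in _ * X]N0 mule0.
- by move=> z /= Pz; split => //; exact: PN.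
Qed.

End integrals.

End invariance.

(** * Integrability of the kernel away from the diagonal, and of its product with |z|^2 near it *)

Section kernel_integrals.
Context {R : realType} {n : nat}.
Local Notation E := 'rV[R]_n.+1.
Local Notation mu := (@lebesgue_rV R n.+1).

(** A substitute for polar coordinates. The function is dominated by the sum over [k] of [C a^k]
    times the indicator of the ball of radius [r b^k], whose volume is proportional to [b^(k(n+1))];
    the integrals form a geometric series of ratio [a b^(n+1)]. Taking [b > 1] treats infinity,
    [b < 1] the origin. *)
Lemma integral_geometric_layers (g : E -> R) (C a r b : R) :
  measurable_fun setT g -> (forall z, 0 <= g z) ->
  0 <= C -> 0 < a -> 0 <= r -> 0 < b -> a * b ^+ n.+1 < 1 ->
  (forall z, g z = 0 \/ exists k, `|z| <= r * b ^+ k /\ g z <= C * a ^+ k) ->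
  (\int[mu]_z (g z)%:E < +oo)%E.
Proof.
move=> mg g0 C0 a0 r0 b0 ab1 gP.
pose f k (z : E) : \bar R := ((C * a ^+ k) * \1_[set y | `|y - 0| <= r * b ^+ k] z)%:E.
have mf k : measurable_fun setT (f k).
  apply/measurable_EFinP; apply: measurable_funM => //.
  by apply/measurable_indicP; exact: measurable_cball_rV.
have f0 k z : (0 <= f k z)%E.
  by rewrite lee_fin mulr_ge0// mulr_ge0// exprn_ge0// ltW.
have fi k : (\int[mu]_z f k z = (C * (r *+ 2) ^+ n.+1 * (a * b ^+ n.+1) ^+ k)%:E)%E.
  under eq_integral do rewrite /f EFinM.
  rewrite ge0_integralZl//.
  - rewrite integral_indic ?setIT//; last exact: measurable_cball_rV.
    rewrite [X in (_ * X)%E](lebesgue_rV_cball 0); last first.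
      by rewrite mulr_ge0 ?exprn_ge0 ?(ltW b0).
    rewrite -EFinM; congr EFin.
    rewrite -mulrnAl !exprMn exprAC; ring.
  - by apply/measurable_EFinP; apply/measurable_indicP; exact: measurable_cball_rV.
  - by rewrite lee_fin mulr_ge0// exprn_ge0// ltW.
apply: (@le_lt_trans _ _ (\int[mu]_z \big[+%E/0%R]_(0 <= k <oo) f k z)%E).
  apply: ge0_le_integral => //.
  - by move=> z _; rewrite lee_fin.
  - exact/measurable_EFinP.
  - exact: ge0_emeasurable_sum.
  move=> z _; have [->|[k [zk gk]]] := gP z; first exact: nneseries_ge0.
  apply: (@le_trans _ _ (f k z)).
    by rewrite /f indicE mem_set/= ?subr0// mulr1 lee_fin.
  have := @nneseries_lim_ge R (f^~ z) xpredT 0 k.+1 (fun j _ _ => f0 j z).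
  by apply: le_trans; rewrite big_nat_recr//= leeDr// sume_ge0.
rewrite integral_nneseries//.
pose M : R := C * (r *+ 2) ^+ n.+1 / (1 - a * b ^+ n.+1).
apply: (@le_lt_trans _ _ M%:E); last exact: ltry.
apply: lime_le; first by apply: is_cvg_nneseries => k _ _; exact: integral_ge0.
apply: nearW => m; rewrite (eq_bigr _ (fun k _ => fi k)) sumEFin lee_fin.
have := @geometric_le_lim _ m (C * (r *+ 2) ^+ n.+1) (a * b ^+ n.+1).
rewrite /series/=; apply.
- by rewrite mulr_ge0// exprn_ge0// mulrn_wge0.
- by rewrite mulr_gt0// exprn_gt0.
- by rewrite ger0_norm// mulr_ge0 ?exprn_ge0 ?ltW.
Qed.

Variables (s : R).
Hypotheses (s0 : 0 < s) (s1 : s < 1).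
Let p : R := n.+1%:R + 2 * s.
Let p0 : 0 < p. Proof. by rewrite /p addr_gt0// mulr_gt0. Qed.

Lemma measurable_inv_enorm_powR :
  measurable_fun setT (fun z : E => (enorm z `^ p)^-1).
Proof.
under eq_fun do rewrite -powRN.
exact: measurableT_comp (measurable_powR (- p)) (@measurable_enorm R n.+1).
Qed.

Definition far_kernel (d : R) (z : E) : R :=
  if d <= `|z| then (enorm z `^ p)^-1 else 0.

(** The factor [|z| ^+ 2] is what the squared increment of a Lipschitz function contributes near the
    diagonal. *)
Definition near_kernel (z : E) : R :=
  if `|z| <= 1 then `|z| ^+ 2 / enorm z `^ p else 0.

Lemma measurable_norm_rV : measurable_fun setT (fun z : E => `|z|).
Proof. by apply: continuous_measurable_rV; exact: norm_continuous. Qed.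

Lemma measurable_far_kernel d : measurable_fun setT (far_kernel d).
Proof.
apply: measurable_fun_ifT => //.
- by apply: measurable_fun_ler => //; exact: measurable_norm_rV.
- exact: measurable_inv_enorm_powR.
Qed.

Lemma measurable_near_kernel : measurable_fun setT near_kernel.
Proof.
apply: measurable_fun_ifT => //.
- by apply: measurable_fun_ler => //; exact: measurable_norm_rV.
- apply: measurable_funM; first by apply: measurable_funX; exact: measurable_norm_rV.
  exact: measurable_inv_enorm_powR.
Qed.

Lemma far_kernel_ge0 d z : 0 <= far_kernel d z.
Proof. by rewrite /far_kernel; case: ifP => // _; rewrite invr_ge0 powR_ge0. Qed.

Lemma near_kernel_ge0 z : 0 <= near_kernel z.
Proof. by rewrite /near_kernel; case: ifP => // _; rewrite divr_ge0 ?powR_ge0 ?sqr_ge0. Qed.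

Let pow2p : (2:R) `^ p = 2 ^+ n.+1 * 2 `^ (2 * s).
Proof. by rewrite /p powRD ?pnatr_eq0 ?implybT// powR_mulrn. Qed.

Let pow2s_gt1 : 1 < (2:R) `^ (2 * s).
Proof.
have s20 : 0 < 2 * s by rewrite mulr_gt0.
have := @gt0_ltr_powR R (2 * s) s20 1 2.
by rewrite !nnegrE/= powR1 ltr1n; exact.
Qed.

(** Convergence at the origin rests on this bound, hence on [s < 1]; convergence at infinity rests
    on the previous one, hence on [0 < s]. *)
Let pow2s_lt4 : (2:R) `^ (2 * s) < 4.
Proof.
have -> : 4 = (2:R) `^ (2 * s) * 2 `^ (2 * (1 - s)).
  rewrite -powRD ?pnatr_eq0 ?implybT//.
  rewrite (_ : 2 * s + 2 * (1 - s) = 2%:R); last by ring.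
  by rewrite powR_mulrn// expr2 -natrM.
rewrite ltr_pMr ?powR_gt0//.
have s20 : 0 < 2 * (1 - s) by rewrite mulr_gt0// subr_gt0.
have := @gt0_ltr_powR R (2 * (1 - s)) s20 1 2.
by rewrite !nnegrE/= powR1 ltr1n; exact.
Qed.

Let inv_enorm_powR_le (z : E) (c : R) : 0 < c -> c <= `|z| ->
  (enorm z `^ p)^-1 <= (c `^ p)^-1.
Proof.
move=> c0 cz; have ce : c <= enorm z := le_trans cz (norm_le_enorm z).
rewrite lef_pV2 ?posrE ?powR_gt0// ?(lt_le_trans c0)//.
by rewrite ge0_ler_powR ?nnegrE ?(ltW p0) ?(ltW c0)// (le_trans (ltW c0)).
Qed.

Let exprn_powR k : (2 ^+ k) `^ p = (2 `^ p) ^+ k.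
Proof. by rewrite -[in LHS]powR_mulrn// -!powRrM mulrC powRrM powR_mulrn ?powR_ge0. Qed.

(** On the shell [d 2^k <= |z| <= d 2^(k+1)] the kernel is at most [d^-p 2^(-pk)], and the ratio of
    the layers is [2^-p 2^(n+1) = 2^(-2s)]. *)
Lemma integral_far_kernel d : 0 < d -> (\int[mu]_z (far_kernel d z)%:E < +oo)%E.
Proof.
move=> d0.
apply: (@integral_geometric_layers (far_kernel d) (d `^ p)^-1 ((2 `^ p)^-1) (d * 2) 2).
- exact: measurable_far_kernel.
- exact: far_kernel_ge0.
- by rewrite invr_ge0 powR_ge0.
- by rewrite invr_gt0 powR_gt0.
- by rewrite mulr_ge0// ltW.
- by [].
- rewrite pow2p mulrC ltr_pdivrMr ?mulr_gt0 ?powR_gt0// mul1r ltr_pMr ?exprn_gt0//.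
move=> z; rewrite /far_kernel; case: ifPn => dz; [right|by left].
have exk : exists k, `|z| <= d * 2 * 2 ^+ k.
  exists (Num.bound (`|z| / d)); rewrite -mulrA mulrC -ler_pdivrMr// -exprS.
  by rewrite ltW// upper_nthrootP.
(* Minimality gives the lower bound on [|z|]: the point is not in the previous ball, and for [k = 0]
   the cut-off [d <= |z|] serves. *)
case: (ex_minnP exk) => k zk mink; exists k; split=> //.
have dk : d * 2 ^+ k <= `|z|.
  case: k mink {zk} => [|k] mink; first by rewrite expr0 mulr1.
  by rewrite exprS mulrA ltW// ltNge; apply/negP => /mink; rewrite ltnn.
apply: le_trans (inv_enorm_powR_le _ dk) _; first by rewrite mulr_gt0// exprn_gt0.
by rewrite powRM ?(ltW d0) ?exprn_ge0// exprn_powR invfM exprVn.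
Qed.

(** On the shell [2^-(k+1) < |z| <= 2^-k] the integrand is at most
    [4^-k 2^(p(k+1)) = 2^p (2^p/4)^k], and the ratio of the layers is [2^(2s)/4]. *)
Lemma integral_near_kernel : (\int[mu]_z (near_kernel z)%:E < +oo)%E.
Proof.
apply: (@integral_geometric_layers near_kernel (2 `^ p) (2 `^ p / 4) 1 (2^-1)).
- exact: measurable_near_kernel.
- exact: near_kernel_ge0.
- exact: powR_ge0.
- by rewrite divr_gt0 ?powR_gt0.
- by [].
- by [].
- rewrite pow2p exprVn.
  rewrite (_ : _ * _ = 2 `^ (2 * s) / 4); last first.
    have : (2:R) ^+ n.+1 != 0 by rewrite expf_neq0.
    by move: (2 ^+ n.+1) => X X0; field.
  by rewrite ltr_pdivrMr// mul1r.
move=> z; rewrite /near_kernel; case: ifPn => z1; [|by left].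
have [->|z0] := eqVneq z 0; first by left; rewrite normr0 expr0n mul0r.
right.
have exk : exists k, 2^-1 ^+ k.+1 < `|z|.
  exists (Num.bound `|z|^-1); rewrite exprVn invf_plt ?posrE ?exprn_gt0 ?normr_gt0//.
  by rewrite upper_nthrootP.
case: (ex_minnP exk) => k zk mink; exists k.
have kz : `|z| <= 2^-1 ^+ k.
  case: k mink {zk} => [|k] mink; first by rewrite expr0.
  by rewrite leNgt; apply/negP => /mink; rewrite ltnn.
split; first by rewrite mul1r.
have -> : 2 `^ p * (2 `^ p / 4) ^+ k = (2^-1 ^+ k) ^+ 2 * (2 `^ p) ^+ k.+1.
  rewrite exprMn mulrA -exprS mulrC exprAC; congr (_ ^+ k * _).
  by rewrite exprVn expr2 -natrM.
apply: ler_pM; rewrite ?sqr_ge0 ?invr_ge0 ?powR_ge0//.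
  by rewrite lerXn2r ?nnegrE ?exprn_ge0.
apply: le_trans (inv_enorm_powR_le _ (ltW zk)) _; first by rewrite exprn_gt0.
rewrite -exprn_powR -powRN.
by rewrite exprVn -[X in X `^ _]powR_inv1 ?exprn_ge0// -powRrM mulN1r opprK.
Qed.

End kernel_integrals.

(** * A smooth bump on [0, 1], its derivatives, and tensor products of them *)

Section bump.
Context {R : realType}.
Implicit Types (p : {poly R}) (k : nat) (x a : R).

(** With Q = x(1 - x), the bump is exp(-1/Q)/Q on (0, 1) and 0 elsewhere. Its derivatives on (0, 1)
    all have the form p exp(-1/Q) / Q^(m+1) with a polynomial p, so that smoothness reduces to an
    algebraic recursion and one growth estimate. *)
Definition bump_poly : {poly R} := 'X * (1 - 'X).
Local Notation Q := bump_poly.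

(* [m] stands for the exponent [m.+1] of [1 / Q]. *)
Definition bump_term p m x : R :=
  if (0 < x) && (x < 1)
  then p.[x] * Q.[x]^-1 ^+ m.+1 * expR (- Q.[x]^-1) else 0.

(** The numerator of the derivative over the common denominator Q^(m+3): the three terms come from
    differentiating p, the power of 1/Q, and the exponential. *)
Definition bump_term_deriv p m : {poly R} :=
  p^`() * Q ^+ 2 - (m.+1%:R *: p) * Q^`() * Q + p * Q^`().

Lemma bump_polyE x : Q.[x] = x * (1 - x).
Proof. by rewrite /bump_poly !hornerE. Qed.

Lemma bump_poly_gt0 x : 0 < x -> x < 1 -> 0 < Q.[x].
Proof. by move=> x0 x1; rewrite bump_polyE mulr_gt0// subr_gt0. Qed.

(** The exponential absorbs [m + 3] powers of 1/Q, by the term of that degree in its series; only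
    [m + 1] are present, and the two left over give the factor [Q ^+ 2]. *)
Lemma bump_term_bound p m : exists2 C : R, 0 <= C &
  forall x, 0 < x -> x < 1 -> `|bump_term p m x| <= C * Q.[x] ^+ 2.
Proof.
have [B /= B0 pB] : exists2 B : R, 0 <= B & forall x, 0 < x -> x < 1 -> `|p.[x]| <= B.
  exists (\sum_(i < size p) `|p`_i|); first exact: sumr_ge0.
  move=> x x0 x1; rewrite horner_coef (le_trans (ler_norm_sum _ _ _))//.
  apply: ler_sum => i _; rewrite normrM ler_piMr// normrX exprn_ile1//.
  by rewrite ger0_norm ltW.
exists (B * (m.+3)`!%:R); first by rewrite mulr_ge0.
move=> x x0 x1; rewrite /bump_term x0 x1/=.
have q0 := bump_poly_gt0 x0 x1; set q := Q.[x] in q0 *.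
rewrite !normrM -!mulrA; apply: ler_pM => //; first exact: pB.
rewrite !ger0_norm ?expR_ge0 ?exprn_ge0 ?invr_ge0 ?(ltW q0)//.
rewrite expRN ler_pdivrMr ?expR_gt0//.
have q10 : 0 <= q^-1 by rewrite invr_ge0 ltW.
have : q^-1 ^+ m.+3 <= (m.+3)`!%:R * expR q^-1.
  rewrite -ler_pdivrMl ?ltr0n ?fact_gt0// mulrC.
  by apply: le_trans (expR_ge1Dxn m.+2 q10); rewrite lerDr.
move=> /(ler_wpM2r (exprn_ge0 2 (ltW q0))).
have -> : q^-1 ^+ m.+3 = q^-1 ^+ m.+1 * q^-1 ^+ 2 by rewrite -exprD addn2.
by rewrite -mulrA -exprMn mulVf ?gt_eqF// expr1n mulr1 mulrAC.
Qed.

Lemma bump_term_bounded p m : exists2 C : R, 0 <= C & forall x, `|bump_term p m x| <= C.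
Proof.
have [C C0 pC] := bump_term_bound p m; exists C => // x.
have [/andP[x0 x1]|] := boolP ((0 < x) && (x < 1)); last first.
  by rewrite /bump_term => /negbTE ->; rewrite normr0.
rewrite (le_trans (pC _ x0 x1))// ler_piMr// exprn_ile1// bump_polyE; nra.
Qed.

(** For [a] outside (0, 1) and [x] inside, Q at [x] is at most [|x - a|]. The quadratic bound yields
    a zero derivative at every such [a], in particular at the endpoints. *)
Lemma bump_term_quadratic p m : exists2 C : R, 0 <= C & forall a x,
  ~~ ((0 < a) && (a < 1)) -> `|bump_term p m x| <= C * (x - a) ^+ 2.
Proof.
have [C C0 pC] := bump_term_bound p m; exists C => // a x a01.
have [/andP[x0 x1]|] := boolP ((0 < x) && (x < 1)); last first.
  by rewrite /bump_term => /negbTE ->; rewrite normr0 mulr_ge0// sqr_ge0.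
rewrite (le_trans (pC _ x0 x1))// ler_wpM2l// bump_polyE.
move: a01; rewrite negb_and -!leNgt => /orP[a0|a1].
  rewrite lerXn2r ?nnegrE//; nra.
by rewrite -[x - a]opprB sqrrN lerXn2r ?nnegrE//; nra.
Qed.

Lemma is_derive_bump_term p m x :
  is_derive x 1 (bump_term p m) (bump_term (bump_term_deriv p m) m.+2 x).
Proof.
have [/andP[x0 x1]|x01] := boolP ((0 < x) && (x < 1)).
  have q0 := bump_poly_gt0 x0 x1.
  have x01 : \near x, (0 < x) && (x < 1).
    near=> y; apply/andP; split; near: y.
      exact: lt_nbhsr.
    exact: lt_nbhsl.
  apply: (@near_eq_is_derive _ _ _
    (fun x => p.[x] * Q.[x]^-1 ^+ m.+1 * expR (- Q.[x]^-1))).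
    by near=> y; rewrite /bump_term ifT//; near: y.
  have dw : is_derive x (1:R) (fun y => Q.[y]^-1) (- Q.[x] ^- 2 *: Q^`().[x]).
    by apply: is_deriveV; rewrite gt_eqF.
  have dE := is_derive1_comp (is_derive_expR _) (is_deriveN dw).
  have dm : is_derive x (1:R) (fun y => Q.[y]^-1 ^+ m.+1)
      ((m.+1%:R * Q.[x]^-1 ^+ m) *: (- Q.[x] ^- 2 *: Q^`().[x])).
    rewrite (_ : (fun y => _) = (fun y => Q.[y]^-1) ^+ m.+1); first exact: is_deriveX.
    by apply/funext => y; rewrite exprfctE.
  apply: is_derive_eq (is_deriveM (is_deriveM (is_derive_poly p x) dm) dE) _.
  have : Q.[x] != 0 by rewrite gt_eqF.
  rewrite /bump_term x0 x1 andTb /bump_term_deriv; clear; move: Q => B B0.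
  rewrite !(hornerD, hornerN, hornerM, hornerZ, horner_exp) !fctE.
  have sc (a b : R) : a *: (b : R^o) = a * b by [].
  rewrite !sc !exprVn !exprS expr0.
  have : B.[x] ^+ m != 0 by rewrite expf_neq0.
  move: (B.[x]) (B.[x] ^+ m) B0 => c cm c0 cm0.
  by field; rewrite c0 cm0.
(* Outside the open interval, endpoints included, the quadratic bound makes the difference quotient
   at most [C |h|]. *)
have Gx : bump_term p m x = 0 by rewrite /bump_term (negbTE x01).
rewrite [X in is_derive _ _ _ X]/bump_term (negbTE x01).
have [C C0 pC] := bump_term_quadratic p m.
suff h : h^-1 *: (bump_term p m (h *: 1 + x) - bump_term p m x) @[h --> 0^'] --> 0.
  by apply: DeriveDef; [apply/cvg_ex; exists 0|exact: cvg_lim].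
apply: (@cvg_to_0_linear _ _ C 1) => // h /andP[h0 _].
have {}h0 : h != 0 by rewrite -normr_gt0.
rewrite Gx subr0 normrM normfV ler_pdivrMl ?normr_gt0//; apply: (le_trans (pC _ _ x01)).
by rewrite addrK -[_ *: _]/(h * 1) mulr1 -real_normK ?num_real// expr2 mulrCA.
Unshelve. all: by end_near. Qed.

Fixpoint bump_data k : {poly R} * nat :=
  if k is j.+1 then
    (bump_term_deriv (bump_data j).1 (bump_data j).2, (bump_data j).2.+2)
  else (1, 0%N).

Definition bump k x : R := bump_term (bump_data k).1 (bump_data k).2 x.

Lemma is_derive_bump k x : is_derive x 1 (bump k) (bump k.+1 x).
Proof. exact: is_derive_bump_term. Qed.

Lemma bump_bounded k : exists2 C : R, 0 <= C & forall x, `|bump k x| <= C.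
Proof. exact: bump_term_bounded. Qed.

Lemma bump_out k x : ~~ ((0 < x) && (x < 1)) -> bump k x = 0.
Proof. by rewrite /bump /bump_term => /negbTE ->. Qed.

Lemma bump0_ge0 x : 0 <= bump 0 x.
Proof.
rewrite /bump /bump_term/=; case: ifP => // /andP[x0 x1].
by rewrite hornerC mul1r mulr_ge0 ?expR_ge0// exprn_ge0// invr_ge0 ltW// bump_poly_gt0.
Qed.

Lemma bump0_ge : exists2 c : R, 0 < c & forall x, 4^-1 <= x <= 3 / 4 -> c <= bump 0 x.
Proof.
(* On this interval 1/6 <= Q <= 1/4, whence 1/Q >= 4 and exp(-1/Q) >= exp(-6). *)
exists (4 * expR (- 6)); first by rewrite mulr_gt0 ?expR_gt0.
move=> x /andP[x0 x1].
rewrite /bump /bump_term/= ifT; last by apply/andP; split; lra.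
rewrite hornerC mul1r expr1.
have q1 : Q.[x] <= 4^-1 by rewrite bump_polyE; have := sqr_ge0 (x - 2^-1); nra.
have q2 : 6^-1 <= Q.[x] by rewrite bump_polyE; nra.
have q0 : 0 < Q.[x] by apply: lt_le_trans q2; rewrite invr_gt0.
apply: ler_pM; rewrite ?expR_ge0//.
  by rewrite -[leLHS]invrK lef_pV2 ?posrE ?invr_gt0.
by rewrite ler_expR lerN2 -[leRHS]invrK lef_pV2 ?posrE ?invr_gt0.
Qed.

Lemma mean_value (f df : R -> R) : (forall x, is_derive x 1 f (df x)) ->
  forall x y, exists2 c, `|c - x| <= `|y - x| & f y - f x = df c * (y - x).
Proof.
move=> fdf x y.
have cf a b : {within `[a, b], continuous f}.
  apply: continuous_subspaceT => z; apply: differentiable_continuous.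
  by apply/derivable1_diffP; case: (fdf z).
have [xy|yx|->] := ltgtP x y; last first.
- by exists y => //; rewrite !subrr mulr0.
- have [c] := MVT yx (fun z _ => fdf z) (cf y x).
  rewrite in_itv/= => /andP[yc cx] fE; exists c.
    by rewrite !ltr0_norm ?subr_lt0//; lra.
  by rewrite -opprB fE -mulrN opprB.
- have [c] := MVT xy (fun z _ => fdf z) (cf x y).
  rewrite in_itv/= => /andP[xc cy] fE; exists c => //.
  by rewrite !gtr0_norm ?subr_gt0//; lra.
Qed.

Lemma bump_lipschitz k : exists2 C : R, 0 <= C &
  forall x y, `|bump k x - bump k y| <= C * `|x - y|.
Proof.
have [C C0 bC] := bump_bounded k.+1; exists C => // x y.
have [c _ ->] := mean_value (is_derive_bump k) y x.
by rewrite normrM ler_wpM2r.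
Qed.

Lemma bump_taylor k : exists2 C : R, 0 <= C &
  forall x h, `|bump k (x + h) - bump k x - h * bump k.+1 x| <= C * h ^+ 2.
Proof.
have [C C0 bC] := bump_lipschitz k.+1; exists C => // x h.
have [c cx ->] := mean_value (is_derive_bump k) x (x + h).
move: cx; rewrite (addrC x) addrK (mulrC _ h) -mulrBr normrM => cx.
rewrite -real_normK ?num_real// expr2 mulrCA ler_wpM2l//.
by rewrite (le_trans (bC _ _))// ler_wpM2l.
Qed.

Lemma lipschitz_continuous_rV n (f : 'rV[R]_n -> R) (C : R) :
  (forall y z, `|f y - f z| <= C * `|y - z|) -> continuous f.
Proof.
move=> CP x; pose D := Num.max C 0 + 1.
have D0 : 0 < D by rewrite ltr_wpDl// le_max lexx orbT.
have CD : C <= D by rewrite ler_wpDr// le_max lexx.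
apply: (proj2 (@cvgrPdist_lt R _ 'rV[R]_n (nbhs x) _ f (f x))) => e e0.
have := @nbhsx_ballx _ _ x (e / D) (divr_gt0 e0 D0).
apply: filterS => y; rewrite -ball_normE/= => xy.
apply: (le_lt_trans (CP _ _)); apply: (@le_lt_trans _ _ (D * `|x - y|)).
  by rewrite ler_wpM2r.
by rewrite -ltr_pdivlMl// mulrC.
Qed.

(** One factor is exchanged at a time; [1 <= C] lets a single power of [C] bound all the partial
    products. *)
Lemma ler_norm_prodB n (a b : 'I_n -> R) (C : R) : 1 <= C ->
  (forall i, `|a i| <= C) -> (forall i, `|b i| <= C) ->
  `|\prod_(i < n) a i - \prod_(i < n) b i| <= C ^+ n * \sum_(i < n) `|a i - b i|.
Proof.
move=> C1 + +; have C0 : 0 <= C by rewrite (le_trans ler01).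
elim: n a b => [|n IHn] a b aC bC; first by rewrite !big_ord0 subrr normr0 mulr0.
rewrite !big_ord_recl mulrDr.
set A := \prod_(i < n) a _; set B := \prod_(i < n) b _.
have -> : a ord0 * A - b ord0 * B = A * (a ord0 - b ord0) + b ord0 * (A - B) by ring.
rewrite (le_trans (ler_normD _ _))// lerD// normrM.
  rewrite ler_wpM2r// /A normr_prod exprS.
  apply: (@le_trans _ _ (C ^+ n)); last by rewrite ler_peMl// exprn_ge0.
  rewrite -[n in leRHS]card_ord -prodr_const; apply: ler_prod => i _.
  by rewrite normr_ge0/=.
rewrite exprS -mulrA ler_pM//; exact: IHn.
Qed.

Section tensor.
Variable n : nat.
Local Notation E := 'rV[R]_n.
Implicit Types (m : 'I_n -> nat) (z : E) (i : 'I_n) (kappa : R).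

(** [m] is a multi-index: up to a power of [kappa] this is the partial derivative of order [m] of
    the rescaled tensor bump, so the family is closed under differentiation. *)
Definition tensor_bump kappa m z : R := \prod_(i < n) bump (m i) (kappa * z ord0 i).

Definition incr m i : 'I_n -> nat := fun j => (m j + (j == i))%N.

Lemma tensor_bump_bounded m :
  exists2 C : R, 0 <= C & forall kappa z, `|tensor_bump kappa m z| <= C.
Proof.
have /choice[C CP] i : exists C : R, 0 <= C /\ forall x, `|bump (m i) x| <= C.
  by have [C] := bump_bounded (m i); exists C.
exists (\prod_(i < n) C i); first by apply: prodr_ge0 => i _; case: (CP i).
move=> kappa z; rewrite /tensor_bump normr_prod; apply: ler_prod => i _.
by rewrite normr_ge0/=; case: (CP i).
Qed.

Lemma tensor_bump_lipschitz kappa m : exists2 C : R, 0 <= C &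
  forall y z, `|tensor_bump kappa m y - tensor_bump kappa m z| <= C * `|y - z|.
Proof.
have /choice[B BP] i : exists C : R, 0 <= C /\ forall x, `|bump (m i) x| <= C.
  by have [C] := bump_bounded (m i); exists C.
have /choice[L LP] i : exists C : R, 0 <= C /\
    forall x y, `|bump (m i) x - bump (m i) y| <= C * `|x - y|.
  by have [C] := bump_lipschitz (m i); exists C.
have L0 i : 0 <= L i by case: (LP i).
pose C := 1 + \sum_(i < n) B i.
have C1 : 1 <= C by rewrite lerDl sumr_ge0// => i _; case: (BP i).
have BC i x : `|bump (m i) x| <= C.
  apply: (@le_trans _ _ (B i)); first by case: (BP i).
  rewrite /C (bigD1 i)//= addrCA lerDl addr_ge0// sumr_ge0// => j _.
  by case: (BP j).
exists (C ^+ n * \sum_(i < n) (L i * `|kappa|)).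
  apply: mulr_ge0; first by rewrite exprn_ge0// (le_trans ler01).
  by apply: sumr_ge0 => i _; rewrite mulr_ge0.
move=> y z; rewrite /tensor_bump (le_trans (ler_norm_prodB C1 _ _))// -mulrA.
rewrite ler_wpM2l ?exprn_ge0 ?(le_trans ler01)// mulr_suml ler_sum// => i _.
have [_ /(_ (kappa * y ord0 i) (kappa * z ord0 i)) /le_trans] := LP i; apply.
rewrite -mulrBr normrM mulrA ler_wpM2l ?mulr_ge0//.
by have := coord_le_norm (y - z) i; rewrite !mxE.
Qed.

(** The constant is uniform in [z]; this is what allows differentiation under an integral by a
    direct estimate. *)
Lemma tensor_bump_taylor kappa m i : exists2 C : R, 0 <= C & forall z h,
  `|tensor_bump kappa m (z + h *: delta_mx ord0 i) - tensor_bump kappa m z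
     - h * (kappa * tensor_bump kappa (incr m i) z)| <= C * h ^+ 2.
Proof.
have /choice[B BP] j : exists C : R, 0 <= C /\ forall x, `|bump (m j) x| <= C.
  by have [C] := bump_bounded (m j); exists C.
have [T T0 TP] := bump_taylor (m i).
have B0 j : 0 <= B j by case: (BP j).
exists (T * kappa ^+ 2 * \prod_(j < n | j != i) B j).
  by apply: mulr_ge0; [rewrite mulr_ge0 ?sqr_ge0|exact: prodr_ge0].
move=> z h; rewrite /tensor_bump !(bigD1 (P := xpredT) i)//= !mxE !eqxx mulr1.
rewrite (eq_bigr (fun j => bump (m j) (kappa * z ord0 j))); last first.
  by move=> j /negbTE ji; rewrite !mxE ji andbF mulr0 addr0.
rewrite [X in h * (kappa * (_ * X))](eq_bigr (fun j => bump (m j) (kappa * z ord0 j))); last first.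
  by move=> j /negbTE ji; rewrite /incr ji addn0.
rewrite /incr eqxx addn1.
set P := \prod_(j < n | j != i) _.
have PB : `|P| <= \prod_(j < n | j != i) B j.
  rewrite /P normr_prod; apply: ler_prod => j _.
  by rewrite normr_ge0/=; case: (BP j).
rewrite (_ : _ - _ = (bump (m i) (kappa * z ord0 i + kappa * h)
  - bump (m i) (kappa * z ord0 i) - kappa * h * bump (m i).+1 (kappa * z ord0 i)) * P).
  rewrite [leRHS]mulrAC normrM ler_pM//.
  by rewrite (le_trans (TP _ _))// exprMn mulrA.
by rewrite mulrDr; ring.
Qed.

Lemma tensor_bump_out kappa m z : 0 < kappa -> kappa^-1 < `|z| ->
  tensor_bump kappa m z = 0.
Proof.
move=> k0 kz.
have [i zi] : exists i, kappa^-1 < `|z ord0 i|.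
  apply: contrapT => /forallNP zi; move: kz; rewrite ltNge => /negP; apply.
  apply/rV_normP; first by rewrite invr_ge0 ltW.
  by move=> i; rewrite leNgt; apply/negP; exact: zi.
rewrite /tensor_bump (bigD1 i)//= bump_out ?mul0r//.
apply/negP => /andP[]; rewrite pmulr_rgt0// => zi0 zi1.
move: zi; rewrite gtr0_norm// => zi; move: zi1; rewrite ltNge => /negP; apply.
by rewrite -ler_pdivrMl// mulr1 ltW.
Qed.

Lemma continuous_tensor_bump kappa m : continuous (tensor_bump kappa m).
Proof. by have [C _] := tensor_bump_lipschitz kappa m; exact: lipschitz_continuous_rV. Qed.

End tensor.
End bump.

(** * Smoothness of convolutions of an integrable function with the bump *)

Section taylor.
Context {R : realType} {n : nat}.
Local Notation E := 'rV[R]_n.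

Lemma taylor_is_derive (g : E -> R) (x v : E) (c M : R) :
  (forall h, `|g (x + h *: v) - g x - h * c| <= M * h ^+ 2) -> is_derive x v g c.
Proof.
move=> gM.
suff h : h^-1 *: (g (h *: v + x) - g x) @[h --> 0^'] --> c.
  by apply: DeriveDef; [apply/cvg_ex; exists c|exact: cvg_lim].
apply/subr_cvg0; apply: (@cvg_to_0_linear _ _ M 1) => // h /andP[h0 _].
have {}h0 : h != 0 by rewrite -normr_gt0.
rewrite (_ : _ - c = h^-1 * (g (x + h *: v) - g x - h * c)); last first.
  by rewrite addrC [h *: v + x]addrC -[_ *: _]/(_ * _); field.
rewrite normrM normfV ler_pdivrMl ?normr_gt0// (le_trans (gM h))//.
by rewrite -real_normK ?num_real// expr2 mulrCA.
Qed.

(** Smoothness quantifies over all iterated partial derivatives; it is enough to exhibit a class of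
    continuous functions, with all first partials existing, that is stable under them. *)
Lemma smooth_coind (P : (E -> R) -> Prop) (f : E -> R) :
  (forall g, P g -> continuous g /\
     forall i, (forall x, derivable g x (delta_mx ord0 i)) /\
               P ('D_(delta_mx ord0 i) g)) ->
  P f -> smooth f.
Proof.
move=> PP Pf s.
have Ps : P (iter_partial s f).
  by elim: s => //= i s IHs; have [_ /(_ i)[]] := PP _ IHs.
have [cs ds] := PP _ Ps; split=> // i x; exact: (ds i).1.
Qed.

End taylor.

Section bounded_integrable.
Context d (T : measurableType d) {R : realType} (mu : {measure set T -> \bar R}).
Variables (f : T -> R).
Hypothesis (fi : mu.-integrable setT (EFin \o f)).

Lemma integrable_bounded_mul (a : T -> R) (C : R) : measurable_fun setT a ->
  (forall y, `|a y| <= C) -> mu.-integrable setT (EFin \o (fun y => a y * f y)).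
Proof.
move=> ma aC; have mf : measurable_fun setT f.
  by apply/measurable_EFinP; case/integrableP : fi.
apply: (@le_integrable _ _ _ mu _ measurableT _ (fun y => (C%:E * (f y)%:E)%E)).
- by apply/measurable_EFinP; exact: measurable_funM.
- move=> y _ /=; rewrite lee_fin !normrM ler_wpM2r// (le_trans (aC y))//.
  exact: ler_norm.
- exact: integrableZl.
Qed.

Lemma Rintegral_bounded_mul (a : T -> R) (C : R) : measurable_fun setT a ->
  (forall y, `|a y| <= C) ->
  `|\int[mu]_y (a y * f y)| <= C * \int[mu]_y `|f y|.
Proof.
move=> ma aC; have ia := integrable_bounded_mul ma aC.
have nfi : mu.-integrable setT (EFin \o (fun y => `|f y|)).
  exact: (integrable_abse fi).
rewrite (le_trans (le_normr_Rintegral _ ia))// -RintegralZl//.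
apply: le_Rintegral => //; [exact: (integrable_abse ia)|exact: (integrableZl measurableT C nfi)|].
by move=> y _; rewrite normrM ler_wpM2r.
Qed.

End bounded_integrable.

Section convolution.
Context {R : realType} {n : nat}.
Local Notation E := 'rV[R]_n.+1.
Local Notation mu := (@lebesgue_rV R n.+1).
Variables (f : E -> R) (kappa : R).
Hypothesis fi : mu.-integrable setT (EFin \o f).

Definition bump_conv m (x : E) : R := \int[mu]_y (tensor_bump kappa m (x - y) * f y).

Lemma measurable_tensor_bump m : measurable_fun setT (@tensor_bump R n.+1 kappa m).
Proof. by apply: continuous_measurable_rV; exact: continuous_tensor_bump. Qed.

Let mJ m x : measurable_fun setT (fun y : E => tensor_bump kappa m (x - y)).
Proof. exact: measurableT_comp (measurable_tensor_bump m) (measurable_rV_reflect x). Qed.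

Lemma integrable_bump_conv m x :
  mu.-integrable setT (EFin \o (fun y => tensor_bump kappa m (x - y) * f y)).
Proof.
have [C _ /(_ kappa) JC] := @tensor_bump_bounded R n.+1 m.
by apply: (@integrable_bounded_mul _ _ _ _ _ fi _ C).
Qed.

Lemma continuous_bump_conv m : continuous (bump_conv m).
Proof.
have [C _ JC] := @tensor_bump_lipschitz R n.+1 kappa m.
apply: (@lipschitz_continuous_rV _ _ _ (C * \int[mu]_y `|f y|)) => x z.
rewrite /bump_conv -RintegralB//; [|exact: integrable_bump_conv..].
under eq_Rintegral do rewrite -mulrBl.
rewrite mulrAC; apply: Rintegral_bounded_mul => //.
  exact: measurable_funB.
by move=> y; rewrite (le_trans (JC _ _))// opprB addrA subrK.
Qed.

(** The uniform second-order Taylor bound of the kernel, integrated against [|f|], bounds the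
    remainder of the convolution by a constant times [h ^+ 2]; no limit is taken under the
    integral. *)
Lemma is_derive_bump_conv m i x :
  is_derive x (delta_mx ord0 i) (bump_conv m) (kappa * bump_conv (incr m i) x).
Proof.
have [C _ JC] := @tensor_bump_taylor R n.+1 kappa m i.
apply: (@taylor_is_derive _ _ _ _ _ _ (C * \int[mu]_y `|f y|)) => h.
have ii := integrable_bump_conv (incr m i) x.
rewrite mulrA /bump_conv -RintegralZl// -RintegralB//; [|exact: integrable_bump_conv..].
rewrite -RintegralB//; last 2 first.
- have := integrableB measurableT (integrable_bump_conv m (x + h *: delta_mx ord0 i)) (integrable_bump_conv m x).
  by [].
- exact: (integrableZl measurableT _ ii).
rewrite (@eq_Rintegral _ _ _ _ _ (fun y : E => (tensor_bump kappa m (x - y + h *: delta_mx ord0 i)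
   - tensor_bump kappa m (x - y) - h * (kappa * tensor_bump kappa (incr m i) (x - y))) * f y)); last first.
  by move=> y _; rewrite -[x + _ - y]addrAC; ring.
rewrite mulrAC; apply: Rintegral_bounded_mul => //.
apply: measurable_funB.
  apply: measurable_funB => //.
  under eq_fun do rewrite addrAC.
  exact: mJ.
by do 2 apply: measurable_funM => //.
Qed.

Lemma smooth_bump_conv m (c : R) : smooth (fun x => c * bump_conv m x).
Proof.
apply: (@smooth_coind _ _ (fun g => exists c m, g = fun x => c * bump_conv m x)); last first.
  by exists c, m.
move=> _ {c m}[c [m ->]]; split.
  by move=> x; apply: continuousM; [exact: cst_continuous|exact: continuous_bump_conv].
move=> i; have d x : is_derive x (delta_mx ord0 i) (fun x => c * bump_conv m x)
    (c * kappa * bump_conv (incr m i) x).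
  by rewrite -mulrA; apply: is_deriveZ; exact: is_derive_bump_conv.
split; first by move=> x; case: (d x).
exists (c * kappa), (incr m i); apply/funext => x.
by case: (d x).
Qed.

End convolution.

(** * Jensen's inequality for squares, and L^2 convergence from pointwise convergence and norm
    bounds *)

Section abstract_integrals.
Context d (T : measurableType d) {R : realType} (mu : {measure set T -> \bar R}).

Lemma le_integrable_ae (f g : T -> R) : measurable_fun setT f ->
  (\forall x \ae mu, `|f x| <= g x) -> mu.-integrable setT (EFin \o g) ->
  mu.-integrable setT (EFin \o f).
Proof.
move=> mf fg /integrableP[mg gi]; apply/integrableP; split.
  exact/measurable_EFinP.
apply: le_lt_trans gi; apply: ae_ge0_le_integral => //.
- by apply: measurableT_comp => //; exact/measurable_EFinP.
- exact: measurableT_comp.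
by apply: filterS fg => x fgx _ /=; rewrite lee_fin (le_trans fgx)// ler_norm.
Qed.

Lemma integrable_indic_lty (A : set T) : measurable A -> (mu A < +oo)%E ->
  mu.-integrable setT (EFin \o (\1_A : T -> R)).
Proof.
move=> mA Aoo; apply/integrableP; split; first exact/measurable_EFinP.
rewrite (eq_integral (fun x => (\1_A x)%:E)); last first.
  by move=> x _ /=; rewrite ger0_norm.
by rewrite integral_indic// setIT.
Qed.

(** Integrate the tangent inequality [g^2 >= 2 m g - m^2] at the mean [m] against the probability
    density [rho]. When [rho g^2] is not integrable the right-hand side is infinite. *)
Lemma jensen_sqr (rho g : T -> R) :
  measurable_fun setT g -> (forall x, 0 <= rho x) ->
  mu.-integrable setT (EFin \o rho) -> \int[mu]_x rho x = 1 ->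
  mu.-integrable setT (EFin \o (fun x => rho x * g x)) ->
  (((\int[mu]_x (rho x * g x)) ^+ 2)%:E <= \int[mu]_x (rho x * g x ^+ 2)%:E)%E.
Proof.
move=> mg rho0 irho rho1 irg.
have mrho : measurable_fun setT rho by apply/measurable_EFinP; case/integrableP : irho.
have mrg2 : measurable_fun setT (EFin \o (fun x => rho x * g x ^+ 2)).
  by apply/measurable_EFinP; apply: measurable_funM => //; exact: measurable_funX.
have [irg2|] := pselect (mu.-integrable setT (EFin \o (fun x => rho x * g x ^+ 2))); last first.
  move=> nirg2; rewrite [leRHS](_ : _ = +oo%E) ?leey//.
  apply/eqP; rewrite eq_le leey/= leNgt; apply/negP => lty; apply: nirg2.
  apply/integrableP; split => //; move: lty.
  congr (_ < _)%E; apply: eq_integral => x _ /=.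
  by rewrite ger0_norm// mulr_ge0// sqr_ge0.
set m := \int[mu]_x (rho x * g x).
have iL : mu.-integrable setT (EFin \o (fun x => 2 * m * (rho x * g x) - m ^+ 2 * rho x)).
  apply: (@integrableB _ _ _ _ _ measurableT (fun x => ((2 * m)%:E * (rho x * g x)%:E)%E)
     (fun x => ((m ^+ 2)%:E * (rho x)%:E)%E)); exact: integrableZl.
have -> : (m ^+ 2)%:E = (\int[mu]_x (2 * m * (rho x * g x) - m ^+ 2 * rho x)%:E)%E.
  rewrite -[RHS]fineK; last exact: integrable_fin_num.
  congr EFin; rewrite -/(Rintegral _ _ _) RintegralB//; last 2 first.
  - exact: (integrableZl measurableT (2 * m) irg).
  - exact: (integrableZl measurableT (m ^+ 2) irho).
  rewrite RintegralZl// RintegralZl// rho1 -/m; ring.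
apply: le_integral => // x _; rewrite lee_fin.
by have := rho0 x; have := sqr_ge0 (g x - m); move: (rho x) (g x) => r y; nra.
Qed.

Lemma limn_einf_gt (u : (\bar R)^nat) (a : \bar R) :
  (a < limn_einf u)%E -> \forall n \near \oo, (a < u n)%E.
Proof.
rewrite limn_einf_lim (cvg_lim _ (@cvg_einfs_sup _ u))// => /ereal_sup_gt[_ [n _ <-] an].
near=> k; apply: (lt_le_trans an); apply: ereal_inf_lbound; exists k => //=.
by near: k; exact: nbhs_infty_ge.
Unshelve. all: by end_near. Qed.

Lemma measurable_limn_einf (f : (T -> \bar R)^nat) :
  (forall k, measurable_fun setT (f k)) ->
  measurable_fun setT (fun x => limn_einf (f ^~ x)).
Proof.
move=> mf.
rewrite (_ : (fun x => _) = (fun x => - limn_esup (-%E \o (f ^~ x)))%E); last first.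
  by apply/funext => x; rewrite limn_esupN oppeK.
apply: measurableT_comp => //; apply: (measurable_fun_limn_esup (f := fun k x => (- f k x)%E)) => k.
exact: measurableT_comp.
Qed.

(* Fatou's lemma for [(a_k + a)^2 = 2 a_k^2 + 2 a^2 - (a_k - a)^2]. *)
Lemma cvg_L2_of_ae_norm (a_ : nat -> T -> R) (a : T -> R) :
  (forall k, measurable_fun setT (a_ k)) -> measurable_fun setT a ->
  (\forall x \ae mu, a_ ^~ x @ \oo --> a x) ->
  (\int[mu]_x (a x ^+ 2)%:E < +oo)%E ->
  (forall k, \int[mu]_x (a_ k x ^+ 2)%:E <= \int[mu]_x (a x ^+ 2)%:E)%E ->
  (\int[mu]_x ((a_ k x - a x) ^+ 2)%:E)%E @[k --> \oo] --> 0%E.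
Proof.
move=> ma_ ma a_a a2oo a_le.
have int2 (b : T -> R) : measurable_fun setT b -> 
    measurable_fun setT (fun x => (b x ^+ 2)%:E).
  by move=> mb; apply/measurable_EFinP; exact: measurable_funX.
set A := (\int[mu]_x (a x ^+ 2)%:E)%E.
have A0 : (0 <= A)%E by apply: integral_ge0 => x _; rewrite lee_fin sqr_ge0.
have Afin : A \is a fin_num by rewrite ge0_fin_numE.
have split k : (\int[mu]_x ((a_ k x - a x) ^+ 2)%:E + \int[mu]_x ((a_ k x + a x) ^+ 2)%:E
    <= 4%:E * A)%E.
  rewrite -ge0_integralD//; last 4 first.
  - by move=> x _; rewrite lee_fin sqr_ge0.
  - by apply: int2; exact: measurable_funB.
  - by move=> x _; rewrite lee_fin sqr_ge0.
  - by apply: int2; exact: measurable_funD.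
  rewrite (eq_integral (fun x => 2%:E * (a_ k x ^+ 2)%:E + 2%:E * (a x ^+ 2)%:E)%E); last first.
    by move=> x _; rewrite -!EFinM -!EFinD; congr EFin; ring.
  rewrite ge0_integralD//; last 4 first.
  - by move=> x _; rewrite -EFinM lee_fin mulr_ge0// sqr_ge0.
  - by apply: measurable_funeM; exact: int2.
  - by move=> x _; rewrite -EFinM lee_fin mulr_ge0// sqr_ge0.
  - by apply: measurable_funeM; exact: int2.
  rewrite !ge0_integralZl//; [|exact: int2|by move=> x _; rewrite lee_fin sqr_ge0
    |exact: int2|by move=> x _; rewrite lee_fin sqr_ge0].
  rewrite (_ : 4%:E = 2%:E + 2%:E)%E; last by rewrite -EFinD; congr EFin; lra.
  rewrite ge0_muleDl//; apply: leeD => //.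
  by apply: lee_wpmul2l => //; exact: a_le.
have liminf : (4%:E * A <= limn_einf (fun k => \int[mu]_x ((a_ k x + a x) ^+ 2)%:E))%E.
  apply: (le_trans _ (fatou mu measurableT _ _)) => [|k|k x _].
  - rewrite -ge0_integralZl//; [|exact: int2|by move=> x _; rewrite lee_fin sqr_ge0].
    apply: ae_ge0_le_integral => //.
    + by move=> x _; rewrite -EFinM lee_fin mulr_ge0// sqr_ge0.
    + by apply: measurable_funeM; exact: int2.
    + move=> x _; rewrite limn_einf_lim; apply: lime_ge; first exact: is_cvg_einfs.
      apply: nearW => k; apply: le_ereal_inf_tmp => _ [j _ <-].
      by rewrite lee_fin sqr_ge0.
    + by apply: measurable_limn_einf => k; apply: int2; exact: measurable_funD.
    apply: filterS a_a => x ax _.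
    have : ((a_ k x + a x) ^+ 2)%:E @[k --> \oo] --> ((a x + a x) ^+ 2)%:E.
      apply: cvg_EFin; first exact: nearW.
      rewrite /comp /= expr2; under eq_fun do rewrite expr2.
      by apply: cvgM; apply: cvgD => //; exact: cvg_cst.
    by move=> /cvg_limn_einf_sup[-> _]; rewrite -EFinM lee_fin; nra.
  - by apply: int2; exact: measurable_funD.
  - by rewrite lee_fin sqr_ge0.
set D := fun k => (\int[mu]_x ((a_ k x - a x) ^+ 2)%:E)%E.
set S := fun k => (\int[mu]_x ((a_ k x + a x) ^+ 2)%:E)%E in liminf.
have {}split k : (D k + S k <= 4%:E * A)%E := split k.
have D0 k : (0 <= D k)%E by apply: integral_ge0 => x _; rewrite lee_fin sqr_ge0.
have S0 k : (0 <= S k)%E by apply: integral_ge0 => x _; rewrite lee_fin sqr_ge0.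
move: split liminf; rewrite -(fineK Afin) -EFinM; set B := 4 * fine A => split liminf.
have Dfin k : D k \is a fin_num.
  by rewrite ge0_fin_numE// (le_lt_trans _ (ltry B))// (le_trans _ (split k))// leeDl.
have Sfin k : S k \is a fin_num.
  by rewrite ge0_fin_numE// (le_lt_trans _ (ltry B))// (le_trans _ (split k))// leeDr.
apply/fine_cvgP; split; first exact: nearW.
apply/cvgr0Pnorm_le => e e0.
have : ((B - e)%:E < limn_einf S)%E.
  by apply: lt_le_trans liminf; rewrite lte_fin gtrBl.
move=> /limn_einf_gt; apply: filterS => k Sk /=.
rewrite ger0_norm ?fine_ge0//; have := split k; move: Sk.
rewrite -(fineK (Dfin k)) -(fineK (Sfin k)) lte_fin -EFinD lee_fin/=; lra.
Qed.

End abstract_integrals.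

(** * Normalised mollifiers and the mollification of an integrable function *)

Section mollifier.
Context {R : realType} {n : nat}.
Local Notation E := 'rV[R]_n.+1.
Local Notation mu := (@lebesgue_rV R n.+1).

Let J k (z : E) : R := tensor_bump k.+1%:R (fun=> 0%N) z.

Let measurable_J k : measurable_fun setT (J k).
Proof. exact: measurable_tensor_bump. Qed.

Let J_ge0 k z : 0 <= J k z.
Proof. by apply: prodr_ge0 => i _; exact: bump0_ge0. Qed.

Let J_out k z : k.+1%:R^-1 < `|z| -> J k z = 0.
Proof. exact: tensor_bump_out. Qed.

Let integrable_J k : mu.-integrable setT (EFin \o J k).
Proof.
have [C C0 JC] := @tensor_bump_bounded R n.+1 (fun=> 0%N).
pose B : set E := [set z | `|z - 0| <= k.+1%:R^-1].
have iB : mu.-integrable setT (EFin \o \1_B).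
  apply: integrable_indic_lty => //; first exact: measurable_cball_rV.
  by rewrite [ltLHS]lebesgue_rV_cball ?ltry.
apply: (@le_integrable_ae _ _ _ _ _ (fun z => C * \1_B z)) => //.
  apply: aeW => z; rewrite indicE; have [zB|zB] := pselect (B z).
    by rewrite mem_set// mulr1; exact: JC.
  rewrite memNset// mulr0 J_out ?normr0// ltNge; apply/negP.
  by move: zB; rewrite /B/= subr0.
exact: (integrableZl measurableT C iB).
Qed.

Let I k : R := \int[mu]_z J k z.

(** The mass of the bump is not computed by rescaling but bounded below: on the cube of centre
    [1/(2(k+1))] and half-side [1/(4(k+1))] every rescaled coordinate lies in [1/4, 3/4], where the
    bump is bounded away from 0. *)
Let I_ge : exists2 c : R, 0 < c & forall k, c <= I k * k.+1%:R ^+ n.+1.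
Proof.
have [c c0 bc] := @bump0_ge R.
exists (c ^+ n.+1 * 2^-1 ^+ n.+1); first by rewrite mulr_gt0// exprn_gt0.
move=> k; pose r : R := k.+1%:R^-1.
have r0 : 0 < r by rewrite invr_gt0.
pose B : set E := [set z | `|z - const_mx (2^-1 * r)| <= 4^-1 * r].
have mB : measurable B by exact: measurable_cball_rV.
have iB : mu.-integrable setT (EFin \o \1_B).
  apply: integrable_indic_lty => //.
  by rewrite [ltLHS]lebesgue_rV_cball ?ltry// mulr_ge0// ltW.
have JB : c ^+ n.+1 * \int[mu]_z \1_B z <= I k.
  rewrite -RintegralZl// /I; apply: le_Rintegral => //.
    exact: (integrableZl measurableT _ iB).
  move=> z _; rewrite indicE; have [zB|zB] := pselect (B z); last first.
    by rewrite memNset// mulr0.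
  rewrite mem_set// mulr1 -[n.+1 in leLHS]card_ord -prodr_const.
  apply: ler_prod => i _; rewrite (ltW c0)/= bc//.
  have := le_trans (coord_le_norm _ i) zB; rewrite !mxE ler_distl.
  have k0 : 0 < k.+1%:R :> R by [].
  move=> /andP[h1 h2]; apply/andP; split.
    by rewrite -ler_pdivrMl// -/r (le_trans _ h1)//; lra.
  by rewrite -ler_pdivlMl// -/r (le_trans h2)//; lra.
have {}JB := ler_wpM2r (exprn_ge0 n.+1 (ler0n R k.+1)) JB.
apply: le_trans JB; rewrite /Rintegral integral_indic// setIT.
rewrite [X in fine X](lebesgue_rV_cball _ _) ?mulr_ge0 ?(ltW r0)//=.
rewrite -[leRHS]mulrA ler_wpM2l ?exprn_ge0 ?(ltW c0)// -exprMn.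
rewrite (_ : (4^-1 * r) *+ 2 * k.+1%:R = 2^-1)// /r.
have : k.+1%:R != 0 :> R by [].
by move: (k.+1%:R) => kappa k0; field.
Qed.

Let I_gt0 k : 0 < I k.
Proof.
have [c c0 /(_ k) cI] := I_ge.
by have := lt_le_trans c0 cI; rewrite pmulr_lgt0// exprn_gt0.
Qed.

Definition mollifier k (z : E) : R := (I k)^-1 * J k z.

Lemma measurable_mollifier k : measurable_fun setT (mollifier k).
Proof. exact: measurable_funM. Qed.

Lemma mollifier_ge0 k z : 0 <= mollifier k z.
Proof. by rewrite mulr_ge0// invr_ge0 ltW. Qed.

Lemma mollifier_out k z : k.+1%:R^-1 < `|z| -> mollifier k z = 0.
Proof. by rewrite /mollifier => /J_out ->; rewrite mulr0. Qed.

Lemma integrable_mollifier k : mu.-integrable setT (EFin \o mollifier k).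
Proof. exact: (integrableZl measurableT (I k)^-1 (integrable_J k)). Qed.

Lemma Rintegral_mollifier k : \int[mu]_z mollifier k z = 1.
Proof. by rewrite RintegralZl// mulVf// gt_eqF. Qed.

Lemma mollifier_le : exists2 C : R, 0 <= C &
  forall k z, mollifier k z <= C * k.+1%:R ^+ n.+1.
Proof.
have [c c0 cI] := I_ge.
have [C C0 JC] := @tensor_bump_bounded R n.+1 (fun=> 0%N).
exists (C / c); first by rewrite divr_ge0// ltW.
move=> k z; rewrite /mollifier mulrC ler_pdivrMr//.
rewrite (le_trans (le_trans (ler_norm _) (JC k.+1%:R z)))//.
rewrite -!mulrA ler_peMr// ler_pdivlMl// mulr1 mulrC; exact: cI.
Qed.

Lemma integral_mollifier k : (\int[mu]_z (mollifier k z)%:E = 1)%E.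
Proof.
rewrite -[LHS]fineK; first by congr EFin; exact: Rintegral_mollifier.
by apply: integrable_fin_num => //; exact: integrable_mollifier.
Qed.

Section mollify.
Variable f : E -> R.
Hypothesis fi : mu.-integrable setT (EFin \o f).

Definition mollify k (x : E) : R := (I k)^-1 * bump_conv f k.+1%:R (fun=> 0%N) x.

Let mf : measurable_fun setT f.
Proof. by apply/measurable_EFinP; case/integrableP : fi. Qed.

Lemma smooth_mollify k : smooth (mollify k).
Proof. exact: smooth_bump_conv. Qed.

Lemma mollifyE k x : mollify k x = \int[mu]_h (mollifier k h * f (x - h)).
Proof.
rewrite /mollify /bump_conv -RintegralZl//; last exact: integrable_bump_conv.
rewrite /Rintegral -[in RHS](integral_reflect x); last first.
  apply/measurable_EFinP; apply: measurable_funM; first exact: measurable_mollifier.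
  exact: measurableT_comp mf (measurable_rV_reflect x).
congr fine; apply: eq_integral => y _; rewrite subKr mulrA//.
Qed.

Lemma integrable_mollify k x :
  mu.-integrable setT (EFin \o (fun h => mollifier k h * f (x - h))).
Proof.
have [C _ rC] := mollifier_le.
apply: (@integrable_bounded_mul _ E R mu (fun h => f (x - h)) _ (mollifier k) (C * k.+1%:R ^+ n.+1)).
- case/integrableP : fi => mfE ifE; apply/integrableP; split.
    exact: measurableT_comp mfE (measurable_rV_reflect x).
  by rewrite (integral_reflect x (f := fun y => `|(f y)%:E|%E))//; exact: measurableT_comp.
- exact: measurable_mollifier.
- by move=> h; rewrite ger0_norm ?mollifier_ge0.
Qed.

Lemma mollify_bounded (M : R) k x : 0 <= M -> (\forall y \ae mu, `|f y| <= M) ->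
  `|mollify k x| <= M.
Proof.
move=> M0 fM; rewrite mollifyE.
rewrite (le_trans (le_normr_Rintegral _ (integrable_mollify _ _)))//.
have iM : mu.-integrable setT (EFin \o (fun h => M * mollifier k h)).
  exact: (integrableZl measurableT M (integrable_mollifier k)).
have iL : mu.-integrable setT (EFin \o (fun h => `|mollifier k h * f (x - h)|)).
  exact: (integrable_abse (integrable_mollify k x)).
rewrite -[leRHS]mulr1 -(Rintegral_mollifier k) -RintegralZl//; last exact: integrable_mollifier.
apply: fine_le; [exact: integrable_fin_num..|].
apply: ae_ge0_le_integral => //.
- by case/integrableP : iL.
- by move=> h _; rewrite lee_fin mulr_ge0// mollifier_ge0.
- by case/integrableP : iM.
have := ae_reflect x fM; apply: filterS => h fh _.
by rewrite lee_fin normrM mulrC (ger0_norm (mollifier_ge0 k h)) ler_wpM2r// mollifier_ge0.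
Qed.

Lemma mollify_out k x : (\forall y \ae mu, `|y - x| <= k.+1%:R^-1 -> f y = 0) ->
  mollify k x = 0.
Proof.
move=> f0; rewrite mollifyE /Rintegral (ae_eq_integral (cst 0%E)) ?integral0//.
  by case/integrableP : (integrable_mollify k x).
have := ae_reflect x f0; apply: filterS => h fh _ /=.
have [hk|/mollifier_out ->] := leP `|h| k.+1%:R^-1; last by rewrite mul0r.
by rewrite fh ?mulr0// addrC addKr normrN.
Qed.

End mollify.
End mollifier.

(** * The form as an L^2 product of difference quotients; mollification does not increase the
    seminorm *)

Section gagliardo_quotient.
Context {R : realType} {n : nat}.
Local Notation E := 'rV[R]_n.+1.
Local Notation mu := (@lebesgue_rV R n.+1).
Local Notation mu2 := (mu \x mu)%E.
Variable s : R.
Implicit Types (u v f : E -> R).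

(* The kernel is split evenly between the two factors of the form. *)
Definition gquot u (z : E * E) : R :=
  (u z.1 - u z.2) * Num.sqrt (frac_kernel s z)^-1.

Lemma inv_frac_kernel_ge0 (z : E * E) : 0 <= (frac_kernel s z)^-1.
Proof. by rewrite invr_ge0 powR_ge0. Qed.

Lemma gquotM u v z : gquot u z * gquot v z =
  (u z.1 - u z.2) * (v z.1 - v z.2) / frac_kernel s z.
Proof.
rewrite /gquot mulrACA -expr2 sqr_sqrtr//; exact: inv_frac_kernel_ge0.
Qed.

Lemma gquot_sqr u z : gquot u z ^+ 2 = (u z.1 - u z.2) ^+ 2 / frac_kernel s z.
Proof. by rewrite expr2 gquotM -expr2. Qed.

Lemma gagliardo2E A u : gagliardo2 s A u = (\int[mu2]_(z in A) (gquot u z ^+ 2)%:E)%E.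
Proof. by apply: eq_integral => z _; rewrite gquot_sqr real_normK ?num_real. Qed.

Lemma frac_formE u v : frac_form s u v = \int[mu2]_z (gquot u z * gquot v z).
Proof. by apply: eq_Rintegral => z _; rewrite gquotM. Qed.

Lemma measurable_rV_sub : measurable_fun setT (fun z : E * E => z.1 - z.2).
Proof. exact: measurable_funB_rV measurable_fst measurable_snd. Qed.

Lemma measurable_inv_frac_kernel :
  measurable_fun setT (fun z : E * E => (frac_kernel s z)^-1).
Proof. exact: measurableT_comp (measurable_inv_enorm_powR s) measurable_rV_sub. Qed.

Lemma measurable_rV_translate2 (h : E) :
  measurable_fun setT (fun z : E * E => (z.1 - h, z.2 - h)).
Proof.
apply: measurable_fun_pair.
  exact: measurableT_comp (measurable_rV_translate h) measurable_fst.
exact: measurableT_comp (measurable_rV_translate h) measurable_snd.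
Qed.

Lemma measurable_diff u : measurable_fun setT u ->
  measurable_fun setT (fun z : E * E => u z.1 - u z.2).
Proof.
move=> mu_; apply: measurable_funB.
  exact: measurableT_comp mu_ measurable_fst.
exact: measurableT_comp mu_ measurable_snd.
Qed.

Lemma measurable_gquot u : measurable_fun setT u -> measurable_fun setT (gquot u).
Proof.
move=> mu_; apply: measurable_funM; first exact: measurable_diff.
apply: measurableT_comp measurable_inv_frac_kernel.
exact: (continuous_measurable_fun (@sqrt_continuous R)).
Qed.

Section mollify.
Variable f : E -> R.
Hypothesis fi : mu.-integrable setT (EFin \o f).

Let mf : measurable_fun setT f.
Proof. by apply/measurable_EFinP; case/integrableP : fi. Qed.

Lemma measurable_mollify k : measurable_fun setT (mollify f k).
Proof.
apply: continuous_measurable_rV.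
by have [+ _] := smooth_mollify fi k [::]; exact.
Qed.

Lemma mollifyB k x y :
  mollify f k x - mollify f k y = \int[mu]_h (mollifier k h * (f (x - h) - f (y - h))).
Proof.
rewrite !mollifyE// -RintegralB//; [|exact: integrable_mollify..].
by apply: eq_Rintegral => h _; rewrite mulrBr.
Qed.

Lemma mollify_jensen k x y : (((mollify f k x - mollify f k y) ^+ 2)%:E <=
  \int[mu]_h (mollifier k h * (f (x - h) - f (y - h)) ^+ 2)%:E)%E.
Proof.
rewrite mollifyB; apply: jensen_sqr.
- by apply: measurable_funB; exact: measurableT_comp mf (measurable_rV_reflect _).
- exact: mollifier_ge0.
- exact: integrable_mollifier.
- exact: Rintegral_mollifier.
rewrite (_ : _ \o _ = (fun h => (mollifier k h * f (x - h))%:E - (mollifier k h * f (y - h))%:E)%E).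
  by apply: integrableB => //; exact: integrable_mollify.
by apply/funext => h /=; rewrite mulrBr EFinB.
Qed.

Lemma sigma_finite_mu2 : sigma_finite setT mu2.
Proof.
pose B k : set E := [set y | `|y - 0| <= k%:R].
exists (fun k => B k `*` B k).
  apply/esym; rewrite -subTset => -[x y] _.
  exists (maxn (Num.bound `|x|) (Num.bound `|y|)) => //; split; rewrite /B/= subr0.
    by rewrite (le_trans (ltW (archi_boundP (normr_ge0 x))))// ler_nat leq_maxl.
  by rewrite (le_trans (ltW (archi_boundP (normr_ge0 y))))// ler_nat leq_maxr.
move=> k; have mB : measurable (B k) by exact: measurable_cball_rV.
split; first exact: measurableX.
rewrite product_measure1E// [X in (X * _)%E]lebesgue_rV_cball//.
by rewrite [X in (_ * X)%E]lebesgue_rV_cball// -EFinM ltry.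
Qed.

(* The instance of the library for products of subprobability measures hides the
   one for products of sigma-finite measures. *)
Definition mu2_sigma_finite : {sigma_finite_measure set (E * E)%type -> \bar R} :=
  HB.pack_for {sigma_finite_measure set (E * E)%type -> \bar R} (mu \x mu)%E
    (Measure_isSigmaFinite.Build _ _ _ (mu \x mu)%E sigma_finite_mu2).

(** Jensen bounds the integrand by an average over shifts [h]. After Tonelli, each shift contributes
    the seminorm of [f] itself, since the kernel depends only on the difference of the two points,
    and the mollifier has mass one. *)
Lemma gagliardo2_mollify k : (gagliardo2 s setT (mollify f k) <= gagliardo2 s setT f)%E.
Proof.
rewrite !gagliardo2E.
pose F (p : (E * E) * E) : \bar R := (mollifier k p.2 *
  ((f (p.1.1 - p.2) - f (p.1.2 - p.2)) ^+ 2 / frac_kernel s p.1))%:E.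
have F0 p : (0 <= F p)%E.
  rewrite lee_fin mulr_ge0 ?mollifier_ge0// mulr_ge0 ?sqr_ge0//.
  exact: inv_frac_kernel_ge0.
have mF : measurable_fun setT F.
  apply/measurable_EFinP; apply: measurable_funM.
    exact: measurableT_comp (measurable_mollifier k) measurable_snd.
  apply: measurable_funM; last exact: measurableT_comp measurable_inv_frac_kernel measurable_fst.
  apply: measurable_funX; apply: measurable_funB; apply: measurableT_comp mf _.
    apply: measurable_funB_rV measurable_snd.
    exact: measurableT_comp measurable_fst measurable_fst.
  apply: measurable_funB_rV measurable_snd.
  exact: measurableT_comp measurable_snd measurable_fst.
have mG : measurable_fun setT (fun z => (gquot f z ^+ 2)%:E).
  by apply/measurable_EFinP; apply: measurable_funX; exact: measurable_gquot.
apply: (@le_trans _ _ (\int[mu2]_z \int[mu]_h F (z, h))%E).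
  apply: ge0_le_integral => //.
  - by move=> z _; rewrite lee_fin sqr_ge0.
  - apply/measurable_EFinP; apply: measurable_funX; apply: measurable_gquot.
    exact: measurable_mollify.
  - exact: measurable_fun_fubini_tonelli_F.
  move=> z _; rewrite gquot_sqr EFinM.
  apply: (le_trans (lee_wpmul2r _ (mollify_jensen k z.1 z.2))).
    by rewrite lee_fin inv_frac_kernel_ge0.
  rewrite -ge0_integralZr//.
  - rewrite le_eqVlt; apply/orP; left; apply/eqP; apply: eq_integral => h _.
    by rewrite -EFinM /F/= mulrA.
  - apply/measurable_EFinP; apply: measurable_funM; first exact: measurable_mollifier.
    apply: measurable_funX.
    by apply: measurable_funB; exact: measurableT_comp mf (measurable_rV_reflect _).
  - by move=> h _; rewrite lee_fin mulr_ge0 ?mollifier_ge0 ?sqr_ge0.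
  - by rewrite lee_fin inv_frac_kernel_ge0.
have -> : (\int[mu2]_z \int[mu]_h F (z, h) = \int[mu]_h \int[mu2]_z F (z, h))%E.
  exact: (@fubini_tonelli _ _ _ _ R mu2_sigma_finite mu F mF F0).
rewrite (eq_integral (fun h => (mollifier k h)%:E * \int[mu2]_z (gquot f z ^+ 2)%:E)%E); last first.
  move=> h _; pose g z := (gquot f (z.1 - h, z.2 - h) ^+ 2)%:E.
  have mg : measurable_fun setT g := measurableT_comp mG (measurable_rV_translate2 h).
  have g0 z : (0 <= g z)%E by rewrite lee_fin sqr_ge0.
  have gE : (\int[mu2]_z g z = \int[mu2]_z (gquot f z ^+ 2)%:E)%E.
    by apply: (ge0_integral2_translate h mG) => z; rewrite lee_fin sqr_ge0.
  have FE : (\int[mu2]_z F (z, h) = \int[mu2]_z ((mollifier k h)%:E * g z))%E.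
    apply: eq_integral => z _; rewrite /F /g [(_, _).2]/= EFinM gquot_sqr.
    by rewrite /frac_kernel /= opprB addrA subrK.
  rewrite FE -gE; clear FE gE; clearbody g.
  rewrite ge0_integralZl; [by []|exact: measurableT|exact: mg|by move=> z _; exact: g0|].
  by rewrite lee_fin mollifier_ge0.
rewrite ge0_integralZr; [|exact: measurableT| | |]; last 3 first.
- by apply/measurable_EFinP; exact: measurable_mollifier.
- by move=> h _; rewrite lee_fin mollifier_ge0.
- by apply: integral_ge0 => z _; rewrite lee_fin sqr_ge0.
by rewrite integral_mollifier mul1e.
Qed.

End mollify.
End gagliardo_quotient.

(** * Criteria for membership in L^2 and in L^oo *)

Section Lfun_criteria.
Context d (T : measurableType d) {R : realType} (mu : {measure set T -> \bar R}).
Implicit Type f : T -> R.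

Lemma Lfun_measurable p f : f \in Lfun mu p -> measurable_fun setT f.
Proof. by rewrite inE => /andP[]; rewrite !inE. Qed.

Lemma lty_Lfun2 f : measurable_fun setT f -> (\int[mu]_x (f x ^+ 2)%:E < +oo)%E ->
  f \in Lfun mu 2%:E.
Proof.
move=> mf foo; rewrite inE; apply/andP; split; rewrite inE//=.
rewrite /finite_norm unlock /= poweR_lty//.
move: foo; congr (_ < _)%E; apply: eq_integral => x _.
by rewrite /= powR_mulrn// real_normK// num_real.
Qed.

Lemma ae_bounded_Lfun_infty f (M : R) : measurable_fun setT f ->
  (\forall x \ae mu, `|f x| <= M) -> f \in Lfun mu +oo%E.
Proof.
move=> mf fM; rewrite inE; apply/andP; split; rewrite inE//=.
rewrite /finite_norm unlock /=; case: ifPn => _; last by rewrite ltry.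
apply: (@le_lt_trans _ _ M%:E); last exact: ltry.
by apply/ess_supP; apply: filterS fM => x; rewrite /= lee_fin.
Qed.

Lemma Lfun_infty_ae_bounded f : f \in Lfun mu +oo%E ->
  exists2 M : R, 0 <= M & \forall x \ae mu, `|f x| <= M.
Proof.
rewrite inE => /andP[_]; rewrite inE/= /finite_norm unlock/=.
case: ifPn => [mu0 |].
  move=> /(ess_supr_bounded (f := normr \o f))[M fM].
  exists (Num.max M 0); first by rewrite le_max lexx orbT.
  by apply: filterS fM => x /= fxM; rewrite le_max fxM.
(* On a null space the essential supremum is a default value that carries no bound, but every
   property holds almost everywhere. *)
rewrite -leNgt => muT _; exists 0 => //; exists setT; split => //.
by apply/eqP; rewrite eq_le muT measure_ge0.
Qed.

End Lfun_criteria.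

(** * Convergence of mollifications, almost everywhere and in the seminorm *)

Section mollify_convergence.
Context {R : realType} {n : nat}.
Local Notation E := 'rV[R]_n.+1.
Local Notation mu := (@lebesgue_rV R n.+1).
Local Notation mu2 := (mu \x mu)%E.
Variables (s : R) (f : E -> R).
Hypotheses (s0 : 0 < s) (fi : mu.-integrable setT (EFin \o f)).
Hypothesis gf : (gagliardo2 s setT f < +oo)%E.

Let mf : measurable_fun setT f.
Proof. by apply/measurable_EFinP; case/integrableP : fi. Qed.

Let p : R := n.+1%:R + 2 * s.
Let p0 : 0 < p. Proof. by rewrite /p addr_gt0// mulr_gt0. Qed.

Let G x : \bar R := (\int[mu]_y (gquot s f (x, y) ^+ 2)%:E)%E.

Let mgq : measurable_fun setT (fun z => (gquot s f z ^+ 2)%:E).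
Proof. by apply/measurable_EFinP; apply: measurable_funX; exact: measurable_gquot. Qed.

Let G_fin : \forall x \ae mu, G x \is a fin_num.
Proof.
have iG : mu.-integrable setT G.
  have mG : measurable_fun setT G.
    by apply: (measurable_fun_fubini_tonelli_F (m2 := mu) _ mgq) => z; rewrite lee_fin sqr_ge0.
  apply/integrableP; split => //.
  rewrite (eq_integral G); last first.
    by move=> x _; rewrite gee0_abs// integral_ge0// => y _; rewrite lee_fin sqr_ge0.
  have := @fubini_tonelli1 _ _ _ _ R mu mu _ mgq (fun z => sqr_ge0 (gquot s f z)).
  by rewrite -gagliardo2E => /esym GE; rewrite [ltLHS]GE.
by have := integrable_ae measurableT iG; apply: filterS => x; exact.
Qed.

(** On the support of the mollifier [|x - y| <= 1/(k+1)], so its sup bound of order [k^(n+1)] is at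
    most a constant times [k^(-2s)] times the kernel. The factor [Num.sqrt n.+1%:R] comes from the
    change of norm. *)
Let rate : exists2 C : R, 0 <= C & forall k x,
  (((mollify f k x - f x) ^+ 2)%:E <= (C / k.+1%:R `^ (2 * s))%:E * G x)%E.
Proof.
have [C C0 rC] := @mollifier_le R n.
exists (C * Num.sqrt n.+1%:R `^ p); first by rewrite mulr_ge0// powR_ge0.
move=> k x; set c := _ / _.
have k0 : 0 < k.+1%:R :> R by [].
have c0 : 0 <= c by rewrite divr_ge0 ?mulr_ge0 ?powR_ge0.
have diffE : mollify f k x - f x = \int[mu]_h (mollifier k h * (f (x - h) - f x)).
  rewrite mollifyE// -[f x in LHS]mulr1 -(@Rintegral_mollifier R n k) -RintegralZl//; last first.
    exact: integrable_mollifier.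
  rewrite -RintegralB//; last 2 first.
  - exact: integrable_mollify.
  - exact: (integrableZl measurableT (f x) (integrable_mollifier k)).
  by apply: eq_Rintegral => h _; rewrite mulrBr (mulrC (f x)).
rewrite diffE; apply: (le_trans (jensen_sqr _ _ _ _ _)).
- by apply: measurable_funB => //; exact: measurableT_comp mf (measurable_rV_reflect x).
- exact: mollifier_ge0.
- exact: integrable_mollifier.
- exact: Rintegral_mollifier.
- have := integrableB measurableT (integrable_mollify fi k x)
    (integrableZl measurableT (f x) (integrable_mollifier k)).
  by apply: eq_integrable => // h _ /=; rewrite mulrBr (mulrC (f x)).
have mL : measurable_fun setT (fun y : E => (mollifier k (x - y) * (f y - f x) ^+ 2)%:E).
  apply/measurable_EFinP; apply: measurable_funM.
    exact: measurableT_comp (measurable_mollifier k) (measurable_rV_reflect x).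
  by apply: measurable_funX; exact: measurable_funB.
have -> : (\int[mu]_h (mollifier k h * (f (x - h) - f x) ^+ 2)%:E =
    \int[mu]_y (mollifier k (x - y) * (f y - f x) ^+ 2)%:E)%E.
  rewrite -(integral_reflect x mL).
  by apply: eq_integral => y _; rewrite subKr.
rewrite /G -ge0_integralZl//; last 2 first.
- exact: measurableT_comp mgq (pair1_measurable x).
- by move=> y _; rewrite lee_fin sqr_ge0.
apply: ge0_le_integral => //.
- by move=> y _; rewrite lee_fin mulr_ge0 ?mollifier_ge0 ?sqr_ge0.
- apply: measurable_funeM; exact: measurableT_comp mgq (pair1_measurable x).
(* The diagonal is separate because the inverse kernel is 0 there by convention and cannot dominate
   the mollifier; the increment of [f] vanishes instead. *)
move=> y _; have [<-|xy] := eqVneq x y.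
  by rewrite -EFinM lee_fin gquot_sqr/= !subrr expr0n/= mul0r !mulr0.
have xy0 : x - y != 0 by rewrite subr_eq0.
rewrite -EFinM lee_fin gquot_sqr/= -[f y - f x]opprB sqrrN.
rewrite [leRHS]mulrCA [leLHS]mulrC ler_wpM2l ?sqr_ge0//.
have [xyk|/mollifier_out ->] := leP `|x - y| k.+1%:R^-1; last first.
  by rewrite mulr_ge0// inv_frac_kernel_ge0.
rewrite (le_trans (rC _ _))//.
have Kgt0 : 0 < frac_kernel s (x, y).
  by rewrite /frac_kernel/= powR_gt0// (lt_le_trans _ (norm_le_enorm _))// normr_gt0.
rewrite ler_pdivlMr//.
have KB : frac_kernel s (x, y) <= (Num.sqrt n.+1%:R * k.+1%:R^-1) `^ p.
  rewrite /frac_kernel/= ge0_ler_powR ?nnegrE ?sqrtr_ge0 ?(ltW p0) ?mulr_ge0//.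
  by rewrite (le_trans (enorm_le_norm _))// ler_wpM2l.
rewrite (le_trans (ler_wpM2l _ KB)) ?mulr_ge0 ?exprn_ge0//.
have powV : k.+1%:R^-1 `^ p = (k.+1%:R `^ p)^-1 :> R.
  by rewrite -[in LHS]powR_inv1 ?ler0n// -powRrM mulN1r powRN.
have powE : k.+1%:R `^ p = k.+1%:R ^+ n.+1 * k.+1%:R `^ (2 * s) :> R.
  by rewrite /p powRD ?pnatr_eq0 ?implybT// powR_mulrn.
rewrite /c powRM// powV powE invfM.
have : k.+1%:R ^+ n.+1 != 0 :> R by rewrite expf_neq0.
move: (k.+1%:R ^+ n.+1) (k.+1%:R `^ (2 * s))^-1 => a b a0.
by rewrite le_eqVlt; apply/orP; left; apply/eqP; field.
Qed.

Lemma mollify_cvg_ae : \forall x \ae mu, mollify f ^~ x @ \oo --> f x.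
Proof.
have [C C0 fC] := rate.
apply: filterS G_fin => x Gx; apply/cvgrPdist_le => e e0.
set g := fine (G x).
have g0 : 0 <= g by rewrite fine_ge0// integral_ge0// => y _; rewrite lee_fin sqr_ge0.
pose M := C * g / e ^+ 2.
have M0 : 0 <= M by rewrite divr_ge0 ?sqr_ge0 ?mulr_ge0.
near=> k.
have kM : M <= k.+1%:R `^ (2 * s).
  have -> : M = (M `^ (2 * s)^-1) `^ (2 * s).
    by rewrite -powRrM mulVf ?powRr1// gt_eqF// mulr_gt0.
  rewrite ge0_ler_powR ?nnegrE ?powR_ge0 ?mulr_ge0 ?(ltW s0)//.
  have : M `^ (2 * s)^-1 <= k%:R by near: k; exact: nbhs_infty_ger.
  by move=> /le_trans; apply; rewrite ler_nat.
have := fC k x; rewrite -(fineK Gx) -EFinM lee_fin -/g => h.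
rewrite distrC -(ler_pXn2r (n := 2))// ?nnegrE ?(ltW e0)//.
rewrite real_normK ?num_real// (le_trans h)//.
by rewrite mulrAC ler_pdivrMr ?powR_gt0// -ler_pdivrMl ?exprn_gt0// mulrC.
Unshelve. all: by end_near. Qed.

(** The difference quotients converge almost everywhere on pairs and their L^2 norms do not exceed
    that of the limit, so they converge in L^2. *)
Lemma cvg_gagliardo2_mollify :
  gagliardo2 s setT (mollify f k \- f) @[k --> \oo] --> 0%E.
Proof.
have h := @cvg_L2_of_ae_norm _ _ _ mu2 (fun k => gquot s (mollify f k)) (gquot s f).
rewrite (_ : (fun k => _) =
    (fun k => \int[mu2]_z ((gquot s (mollify f k) z - gquot s f z) ^+ 2)%:E)%E); last first.
  apply/funext => k; rewrite gagliardo2E; apply: eq_integral => z _.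
  by rewrite /gquot -mulrBl; congr (((_ * _) ^+ 2)%:E); rewrite /=; ring.
apply: h.
- by move=> k; apply: measurable_gquot; exact: measurable_mollify.
- exact: measurable_gquot.
- apply: filterS2 (ae_fst mollify_cvg_ae) (ae_snd mollify_cvg_ae) => z z1 z2.
  by apply: cvgM; [exact: cvgB|exact: cvg_cst].
- by rewrite -gagliardo2E.
- by move=> k; rewrite -!gagliardo2E; exact: gagliardo2_mollify.
Qed.

End mollify_convergence.

(** * Approximation of bounded compactly supported functions by test functions *)

Section approximation.
Context {R : realType} {n : nat}.
Local Notation E := 'rV[R]_n.+1.
Local Notation mu := (@lebesgue_rV R n.+1).
Local Notation mu2 := (mu \x mu)%E.
Implicit Types (s : R) (K L D : set E) (f : E -> R).

Lemma compact_closed_rV K : compact K -> closed K.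
Proof. by apply: compact_closed; exact: norm_hausdorff. Qed.

Lemma compact_measurable_rV K : compact K -> measurable K.
Proof. by move=> cK; apply: closed_measurable_rV; exact: compact_closed_rV. Qed.

Lemma compact_lty K : compact K -> (mu K < +oo)%E.
Proof.
move=> cK; apply: lebesgue_rV_bounded; first exact: compact_bounded.
exact: compact_measurable_rV.
Qed.

Lemma compact_compactly_contained K D : compact K -> K `<=` D -> compactly_contained K D.
Proof.
by move=> cK KD; rewrite /compactly_contained -(closure_id K).1//; exact: compact_closed_rV.
Qed.

(** This serves twice: to keep the supports of mollifications in one compact subset of [D], and to
    split pairs of points into those in [L] and those at distance at least [d]. *)
Lemma compact_thickening K D : compact K -> open D -> K `<=` D ->
  exists d L, [/\ 0 < d, compact L, L `<=` D &
    forall x y, K y -> `|x - y| <= d -> L x].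
Proof.
move=> cK oD KD.
have [e e0 eD] : exists2 e : R, 0 < e & forall y x, K y -> `|x - y| < e -> D x.
  have cov : \forall e \near 0^'+, K `<=` (fun y => ball y e `<=` D).
    apply: ((compact_near_coveringP K).1 cK R (0^'+) (fun e y => ball y e `<=` D)) => y Ky.
    have /nbhs_ballP[r /= r0 yrD] : nbhs y D by apply: open_nbhs_nbhs; split => //; exact: KD.
    exists (ball y (r / 2), [set e | e < r / 2]) => /=.
      split; first by apply: nbhsx_ballx; exact: divr_gt0.
      by apply: nbhs_right_lt; exact: divr_gt0.
    move=> [z e] /= [yz er] x zx; apply: yrD; rewrite [r]splitr.
    by apply: ball_triangle yz _; apply: le_ball zx; exact: ltW.
  near (0:R)^'+ => e; exists e => //.
  move=> y x Ky xy; have eD : K `<=` (fun y => ball y e `<=` D) by near: e.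
  by apply: (eD y Ky); rewrite -ball_normE/= distrC.
(* A point of the closure of [T] is within [2e/3 < e] of [K], hence still in [D]. *)
pose T : set E := [set x | exists2 y, K y & `|x - y| <= e / 3].
have e30 : 0 < e / 3 by rewrite divr_gt0.
have clT x : closure T x -> exists2 y, K y & `|x - y| < e.
  move=> /(_ _ (nbhsx_ballx x (e / 3) e30))[z [[y Ky zy]]].
  rewrite -ball_normE/= => xz; exists y => //.
  rewrite -[x](subrK z) -addrA (le_lt_trans (ler_normD _ _))//; lra.
exists (e / 3), (closure T); split => //.
- apply: bounded_closed_compact; last exact: closed_closure.
  have [M [Mr MK]] := compact_bounded cK.
  exists (M + 1 + e); split; first exact: num_real.
  move=> r Mer x /clT[y Ky xy] /=; rewrite -[x](subrK y) (le_trans (ler_normD _ _))//.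
  have : `|y| <= M + 1 by apply: MK => //; rewrite ltrDl.
  lra.
- by move=> x /clT[y Ky xy]; exact: eD xy.
- by move=> x y Ky xy; apply: subset_closure; exists y.
Unshelve. all: by end_near. Qed.

Lemma ae_bounded_integrable f K (M : R) : measurable_fun setT f -> compact K ->
  (\forall x \ae mu, `|f x| <= M) -> (\forall x \ae mu, ~ K x -> f x = 0) ->
  mu.-integrable setT (EFin \o f).
Proof.
move=> mf cK fM fK; have mK := compact_measurable_rV cK.
apply: (@le_integrable_ae _ _ _ _ _ (fun x => M * \1_K x)) => //.
  apply: filterS2 fM fK => x xM xK; rewrite indicE.
  have [Kx|Kx] := pselect (K x); first by rewrite mem_set// mulr1.
  by rewrite memNset// mulr0 xK// normr0.
exact: (integrableZl measurableT M (integrable_indic_lty mK (compact_lty cK))).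
Qed.

Lemma ae_bounded_Lfun2 f K (M : R) : measurable_fun setT f -> compact K ->
  (\forall x \ae mu, `|f x| <= M) -> (\forall x \ae mu, ~ K x -> f x = 0) ->
  f \in Lfun mu 2%:E.
Proof.
move=> mf cK fM fK; apply: lty_Lfun2 => //.
have /integrableP[_] : mu.-integrable setT (EFin \o (fun x => f x ^+ 2)).
  apply: (@ae_bounded_integrable _ K (M ^+ 2)) => //.
  - exact: measurable_funX.
  - apply: filterS fM => x xM; rewrite normrX lerXn2r ?nnegrE//.
    exact: le_trans xM.
  - by apply: filterS fK => x xK /xK ->; rewrite expr0n.
by congr (_ < _)%E; apply: eq_integral => x _ /=; rewrite ger0_norm// sqr_ge0.
Qed.

(** Besides seminorm convergence, the bound [M], the compact set [L] and pointwise convergence are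
    recorded, because the far part of the form and the integrals of locally integrable weights pass
    to the limit by dominated convergence. *)
Lemma Ws20_approx s D f : 0 < s -> open D -> Ws20 s D f -> Linftyc D f ->
  exists L M (phi : nat -> E -> R), [/\ compact L /\ L `<=` D,
   (forall k, [/\ Cc_smooth D (phi k), Ws20 s D (phi k),
      (forall x, `|phi k x| <= M) & forall x, ~ L x -> phi k x = 0]),
   \forall x \ae mu, phi ^~ x @ \oo --> f x,
   gagliardo s (phi k \- f) @[k --> \oo] --> 0 &
   (\forall x \ae mu, `|f x| <= M) /\ \forall x \ae mu, ~ L x -> f x = 0].
Proof.
move=> s0 oD [[f2 gf] fD] [finf [K [cK KD fK]]].
have mf := Lfun_measurable f2.
have [M M0 fM] := Lfun_infty_ae_bounded finf.
have fi := ae_bounded_integrable mf cK fM fK.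
have [d [L [d0 cL LD KL]]] := compact_thickening cK oD KD.
(* Shifting the index by [k0] puts every mollification, not only the late ones, inside [L]. *)
have [k0 k0d] : exists k0, k0.+1%:R^-1 < d.
  near \oo => k; exists k; near: k; exact: near_infty_natSinv_lt (PosNum d0).
pose phi k := mollify f (k + k0).
have phiL k x : ~ L x -> phi k x = 0.
  move=> Lx; apply: mollify_out => //.
  apply: filterS fK => y yK xy; apply: yK => Ky; apply: Lx; apply: (KL _ y) => //.
  rewrite distrC (le_trans xy)// (le_trans _ (ltW k0d))// lef_pV2 ?posrE//.
  by rewrite ler_nat ltnS leq_addl.
have phiM k x : `|phi k x| <= M by exact: mollify_bounded.
have fL : \forall x \ae mu, ~ L x -> f x = 0.
  apply: filterS fK => x xK Lx; apply: xK => Kx; apply: Lx.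
  by apply: (KL x x) => //; rewrite subrr normr0 ltW.
exists L, M, phi; split; [by []| | | |by split].
- move=> k; split => //.
  + split; first exact: smooth_mollify.
    have sL : closure [set x | phi k x != 0] `<=` L.
      rewrite [X in _ `<=` X](closure_id L).1; last exact: compact_closed_rV.
      apply: closure_subset => x /=; apply: contraPP => Lx; rewrite phiL// eqxx//.
    split; last exact: subset_trans LD.
    by apply: subclosed_compact sL => //; exact: closed_closure.
  + split; first split.
    * apply: (@ae_bounded_Lfun2 _ L M) => //; [exact: measurable_mollify|exact: aeW|].
      by apply: aeW => x; exact: phiL.
    * by apply: le_lt_trans gf; exact: gagliardo2_mollify.
    by apply: aeW => x Dx; apply: phiL => /LD.
  + exact: phiL.
- have := mollify_cvg_ae s0 fi gf; apply: filterS => x fx.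
  by rewrite /phi (cvg_shiftn k0 (fun k => mollify f k x)).
have /fine_cvgP[_ h] := cvg_gagliardo2_mollify s0 fi gf.
have {}h : fine (gagliardo2 s setT (phi k \- f)) @[k --> \oo] --> 0.
  by rewrite (cvg_shiftn k0 (fun k => fine (gagliardo2 s setT (mollify f k \- f)))).
have := cvg_comp _ _ h (@sqrt_continuous R 0).
by rewrite sqrtr0; exact.
Unshelve. all: by end_near. Qed.

End approximation.

(** * Smooth compactly supported functions belong to the fractional space *)

Section test_functions.
Context {R : realType} {n : nat}.
Local Notation E := 'rV[R]_n.+1.
Local Notation mu := (@lebesgue_rV R n.+1).
Local Notation mu2 := (mu \x mu)%E.
Implicit Types (s : R) (K D : set E) (f phi : E -> R).

Lemma Cc_smooth_support D phi : Cc_smooth D phi ->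
  exists K, [/\ compact K, K `<=` D & forall x, ~ K x -> phi x = 0].
Proof.
move=> [_ [cK KD]]; exists (closure [set x | phi x != 0]); split => // x.
by apply: contra_notP => /eqP px; exact: subset_closure.
Qed.

Lemma compact_support_bounded K f : continuous f -> compact K ->
  (forall x, ~ K x -> f x = 0) -> exists2 M : R, 0 <= M & forall x, `|f x| <= M.
Proof.
move=> cf cK fK.
have /compact_bounded[M [Mr MB]] : compact (f @` K).
  by apply: continuous_compact => //; exact: continuous_subspaceT.
exists (Num.max 0 (M + 1)); first by rewrite le_max lexx.
move=> x; have [Kx|Kx] := pselect (K x); last by rewrite fK// normr0 le_max lexx.
have /= fxM : `|f x| <= M + 1 by apply: MB; [rewrite ltrDl|exists x].
by rewrite le_max fxM orbT.
Qed.

Lemma is_derive_line f (z v : E) t : derivable f (z + t *: v) v ->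
  is_derive t (1:R) (fun t => f (z + t *: v)) ('D_v f (z + t *: v)).
Proof.
move=> dfz.
have E1 : (fun h : R => h^-1 *: (f (z + (h *: 1 + t) *: v) - f (z + t *: v))) =
    (fun h : R => h^-1 *: (f (h *: v + (z + t *: v)) - f (z + t *: v))).
  apply/funext => h; congr (_ *: (f _ - _)).
  by rewrite -[h *: 1]/(h * 1) mulr1 scalerDl addrCA.
apply: DeriveDef; [rewrite /derivable E1|rewrite /derive E1]; by [].
Qed.

Lemma line_lipschitz f (i : 'I_n.+1) (L : R) :
  (forall x, derivable f x (delta_mx ord0 i)) ->
  (forall x, `|'D_(delta_mx ord0 i) f x| <= L) ->
  forall z t, `|f (z + t *: delta_mx ord0 i) - f z| <= L * `|t|.
Proof.
move=> df dL z t.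
have [c _] := mean_value (fun t => is_derive_line (df (z + t *: delta_mx ord0 i))) 0 t.
rewrite scale0r addr0 subr0 => ->.
by rewrite normrM ler_wpM2r.
Qed.

(** Only partial derivatives are given, so the path from [y] to [x] changes one coordinate at a time
    and the mean value theorem is applied along each axis. *)
Lemma partial_bounded_lipschitz f (L : R) : 0 <= L ->
  (forall i x, derivable f x (delta_mx ord0 i)) ->
  (forall i x, `|'D_(delta_mx ord0 i) f x| <= L) ->
  forall x y, `|f x - f y| <= n.+1%:R * L * `|x - y|.
Proof.
move=> L0 df dL x y.
pose mix k : E := \row_j (if (j < k)%N then x ord0 j else y ord0 j).
have step k : (k < n.+1)%N -> `|f (mix k.+1) - f (mix k)| <= L * `|x - y|.
  move=> kn; pose i := Ordinal kn.
  have -> : mix k.+1 = mix k + (x ord0 i - y ord0 i) *: delta_mx ord0 i.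
    apply/rowP => j; rewrite !mxE eqxx/= ltnS leq_eqVlt -(inj_eq val_inj)/=.
    have [jk|ji] := eqVneq (j : nat) k.
      rewrite jk ltnn; have -> : j = i by exact: val_inj.
      by rewrite mulr1 addrC subrK.
    by rewrite mulr0 addr0.
  rewrite (le_trans (line_lipschitz (df i) (dL i) _ _))// ler_wpM2l//.
  by have := coord_le_norm (x - y) i; rewrite !mxE.
have tele k : (k <= n.+1)%N -> `|f (mix k) - f (mix 0)| <= k%:R * (L * `|x - y|).
  elim: k => [_|k IHk kn]; first by rewrite subrr normr0 mul0r.
  rewrite -[f (mix k.+1)](subrK (f (mix k))) -addrA (le_trans (ler_normD _ _))//.
  by rewrite -natr1 mulrDl mul1r [leRHS]addrC lerD// ?step// IHk// ltnW.
have := tele n.+1 (leqnn _).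
have -> : mix n.+1 = x by apply/rowP => j; rewrite mxE ltn_ord.
have -> : mix 0 = y by apply/rowP => j; rewrite mxE.
by rewrite mulrA.
Qed.

Lemma Cc_smooth_lipschitz D phi : Cc_smooth D phi ->
  exists2 C : R, 0 <= C & forall x y, `|phi x - phi y| <= C * `|x - y|.
Proof.
move=> phiD; have [K [cK _ phiK]] := Cc_smooth_support phiD.
have [sphi _] := phiD.
have dphiK i x : ~ K x -> 'D_(delta_mx ord0 i) phi x = 0.
  move=> Kx.
  have nKx : \near x, cst 0 x = phi x.
    have : nbhs x (~` K).
      apply: open_nbhs_nbhs; split => //; by apply: closed_openC; exact: compact_closed_rV.
    by apply: filterS => y /phiK.
  have := near_eq_is_derive nKx (is_derive_cst (0:R) x (delta_mx ord0 i)).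
  by case.
have /choice[L LP] i : exists L, 0 <= L /\ forall x, `|'D_(delta_mx ord0 i) phi x| <= L.
  have [c _] := sphi [:: i].
  by have [L L0 LP] := compact_support_bounded c cK (dphiK i); exists L.
have L0 i : 0 <= L i by case: (LP i).
exists (n.+1%:R * \sum_(i < n.+1) L i); first by rewrite mulr_ge0// sumr_ge0.
apply: partial_bounded_lipschitz; first exact: sumr_ge0.
  by move=> i x; have [_] := sphi [::]; exact.
move=> i x; case: (LP i) => _ /(_ x) /le_trans; apply.
by rewrite (bigD1 i)//= lerDl sumr_ge0.
Qed.

(** The integrand is at most [(1_K(x) + 1_K(y)) h(x - y)], where [h] uses the Lipschitz bound for
    [|x - y| <= 1] and the sup bound beyond; both [h] and the indicator of [K] are integrable. *)
Lemma gagliardo2_lipschitz s K f (C M : R) : 0 < s -> s < 1 ->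
  measurable_fun setT f -> compact K -> (forall x, ~ K x -> f x = 0) ->
  (forall x, `|f x| <= M) -> (forall x y, `|f x - f y| <= C * `|x - y|) ->
  (gagliardo2 s setT f < +oo)%E.
Proof.
move=> s0 s1 mf cK fK fM fC; have mK := compact_measurable_rV cK.
have M0 : 0 <= M := le_trans (normr_ge0 _) (fM 0).
pose h (z : E) : R := C ^+ 2 * near_kernel s z + 4 * M ^+ 2 * far_kernel s 1 z.
have h0 z : (0 <= (h z)%:E)%E.
  rewrite lee_fin; apply: addr_ge0; apply: mulr_ge0; rewrite ?sqr_ge0 ?near_kernel_ge0 ?far_kernel_ge0//.
  by rewrite mulr_ge0 ?sqr_ge0.
have hR z : 0 <= h z by rewrite -lee_fin.
have mh : measurable_fun setT (fun z => (h z)%:E).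
  apply/measurable_EFinP; apply: measurable_funD; apply: measurable_funM => //.
    exact: measurable_near_kernel.
  exact: measurable_far_kernel.
have hoo : (\int[mu]_z (h z)%:E < +oo)%E.
  rewrite (eq_integral (fun z => (C ^+ 2)%:E * (near_kernel s z)%:E +
      (4 * M ^+ 2)%:E * (far_kernel s 1 z)%:E)%E); last first.
    by move=> z _; rewrite -!EFinM -EFinD.
  have nk0 z : (0 <= (near_kernel s z)%:E)%E by rewrite lee_fin near_kernel_ge0.
  have fk0 z : (0 <= (far_kernel s 1 z)%:E)%E by rewrite lee_fin far_kernel_ge0.
  have mn : measurable_fun setT (fun z : E => (near_kernel s z)%:E).
    by apply/measurable_EFinP; exact: measurable_near_kernel.
  have mfar : measurable_fun setT (fun z : E => (far_kernel s 1 z)%:E).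
    by apply/measurable_EFinP; exact: measurable_far_kernel.
  have C20 : (0 <= (C ^+ 2)%:E)%E by rewrite lee_fin sqr_ge0.
  have M20 : (0 <= (4 * M ^+ 2)%:E)%E by rewrite lee_fin mulr_ge0 ?sqr_ge0.
  rewrite ge0_integralD//; last 4 first.
  - by move=> z _; exact: mule_ge0.
  - exact: measurable_funeM.
  - by move=> z _; exact: mule_ge0.
  - exact: measurable_funeM.
  rewrite ge0_integralZl// ge0_integralZl// lte_add_pinfty// lte_mul_pinfty//.
    exact: integral_near_kernel.
  exact: integral_far_kernel.
pose IK x : \bar R := (\1_K x)%:E.
have IK0 x : (0 <= IK x)%E by rewrite lee_fin.
have mIK : measurable_fun setT IK by apply/measurable_EFinP.
have IKE : (\int[mu]_x IK x = mu K)%E by rewrite integral_indic// setIT.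
have Koo := compact_lty cK.
have mh2 : measurable_fun setT (fun z : E * E => (h (z.1 - z.2))%:E).
  exact: measurableT_comp mh measurable_rV_sub.
have mIK1 : measurable_fun setT (fun z : E * E => (IK z.1 * (h (z.1 - z.2))%:E)%E).
  by apply: emeasurable_funM => //; exact: measurableT_comp mIK measurable_fst.
have mIK2 : measurable_fun setT (fun z : E * E => (IK z.2 * (h (z.1 - z.2))%:E)%E).
  by apply: emeasurable_funM => //; exact: measurableT_comp mIK measurable_snd.
apply: (@le_lt_trans _ _ (\int[mu2]_z (IK z.1 * (h (z.1 - z.2))%:E + IK z.2 * (h (z.1 - z.2))%:E))%E).
  rewrite gagliardo2E; apply: ge0_le_integral => //.
  - by move=> z _; rewrite lee_fin sqr_ge0.
  - by apply/measurable_EFinP; apply: measurable_funX; exact: measurable_gquot.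
  - exact: emeasurable_funD.
  move=> [x y] _; rewrite gquot_sqr/= -!EFinM -EFinD lee_fin -mulrDl.
  have [Kxy|] := pselect (K x \/ K y); last first.
    move=> /not_orP[Kx Ky]; rewrite !fK// subrr expr0n/= mul0r.
    by apply: mulr_ge0; [rewrite addr_ge0|exact: hR].
  apply: (@le_trans _ _ (h (x - y))); last first.
    rewrite ler_peMl//.
    rewrite !indicE; case: Kxy => [Kx|Ky]; [rewrite (mem_set Kx)|rewrite (mem_set Ky)].
      by rewrite lerDl.
    by rewrite lerDr.
  rewrite /h /frac_kernel/=.
  set k := (enorm _ `^ _)^-1.
  have k0 : 0 <= k by rewrite invr_ge0 powR_ge0.
  have [xy1|xy1] := leP `|x - y| 1.
    apply: (@le_trans _ _ (C ^+ 2 * near_kernel s (x - y))).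
      rewrite /near_kernel xy1 -/k mulrA ler_wpM2r// -exprMn -[leLHS]real_normK ?num_real//.
      by rewrite lerXn2r ?nnegrE//; exact: le_trans (normr_ge0 _) (fC x y).
    by rewrite lerDl mulr_ge0 ?mulr_ge0 ?sqr_ge0 ?far_kernel_ge0.
  apply: (@le_trans _ _ (4 * M ^+ 2 * far_kernel s 1 (x - y))); last first.
    by rewrite lerDr mulr_ge0 ?sqr_ge0 ?near_kernel_ge0.
  rewrite /far_kernel (ltW xy1) -/k ler_wpM2r//.
  rewrite -[leLHS]real_normK ?num_real// (_ : 4 * M ^+ 2 = (M + M) ^+ 2); last by ring.
  rewrite lerXn2r ?nnegrE ?addr_ge0// (le_trans (ler_normB _ _))//.
  by rewrite lerD.
rewrite ge0_integralD//; last first.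
- by move=> z _; exact: mule_ge0.
- by move=> z _; exact: mule_ge0.
rewrite (ge0_integral2_fst_conv mIK IK0 mh h0) (ge0_integral2_snd_conv mIK IK0 mh h0).
rewrite IKE.
have hKoo : (mu K * \int[mu]_z (h z)%:E < +oo)%E.
  by rewrite lte_mul_pinfty// ge0_fin_numE.
exact: lte_add_pinfty.
Qed.

Lemma Cc_smooth_Ws20 s D phi : 0 < s -> s < 1 -> Cc_smooth D phi -> Ws20 s D phi.
Proof.
move=> s0 s1 phiD; have [K [cK KD phiK]] := Cc_smooth_support phiD.
have cphi : continuous phi by case: phiD => /(_ [::])[].
have mphi : measurable_fun setT phi := continuous_measurable_rV cphi.
have [M M0 phiM] := compact_support_bounded cphi cK phiK.
have [C C0 phiC] := Cc_smooth_lipschitz phiD.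
split; first split.
- apply: (@ae_bounded_Lfun2 _ _ _ K M) => //; exact: aeW.
- exact: (gagliardo2_lipschitz s0 s1 mphi cK phiK phiM phiC).
- by apply: aeW => x Dx; apply: phiK => /KD.
Qed.

End test_functions.

(** * Dominated convergence and estimates of the bilinear form *)

Section dominated.
Context d (T : measurableType d) {R : realType} (mu : {measure set T -> \bar R}).

Lemma Rdominated_convergence (f_ : nat -> T -> R) (f g : T -> R) :
  (forall k, measurable_fun setT (f_ k)) -> measurable_fun setT f ->
  (\forall x \ae mu, f_ ^~ x @ \oo --> f x) ->
  mu.-integrable setT (EFin \o g) ->
  (forall k, \forall x \ae mu, `|f_ k x| <= g x) ->
  \int[mu]_x f_ k x @[k --> \oo] --> \int[mu]_x f x.
Proof.
move=> mf_ mf f_f ig f_g.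
have mf_' k : measurable_fun setT (EFin \o f_ k) by exact/measurable_EFinP.
have mf' : measurable_fun setT (EFin \o f) by exact/measurable_EFinP.
have ff : {ae mu, forall x, setT x -> (EFin \o f_ k) x @[k --> \oo] --> (EFin \o f) x}.
  by apply: filterS f_f => x fx _; apply: cvg_EFin => //; exact: nearW.
have fg : {ae mu, forall x k, setT x -> (`|(EFin \o f_ k) x| <= (EFin \o g) x)%E}.
  by have := ae_foralln f_g; apply: filterS => x fgx k _ /=; rewrite lee_fin.
have [] := dominated_convergence measurableT mf_' mf' ff ig fg.
move=> iF _ h; apply: (fine_cvg (F := \oo)).
rewrite fineK//; exact: integrable_fin_num.
Qed.

End dominated.

Section forms.
Context {R : realType} {n : nat}.
Local Notation E := 'rV[R]_n.+1.
Local Notation mu := (@lebesgue_rV R n.+1).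
Local Notation mu2 := (mu \x mu)%E.
Implicit Types (s : R) (K L D : set E) (f u v w : E -> R).

Section L1loc.
Variables (D : set E) (w : E -> R).
Hypotheses (mD : measurable D) (wD : L1loc D w).

Lemma Rintegral_restrict f :
  \int[mu]_(x in D) (w x * f x) = \int[mu]_x ((w \_ D) x * f x).
Proof.
rewrite Rintegral_mkcond; apply: eq_Rintegral => x _; rewrite !patchE.
by case: ifP => // _; rewrite mul0r.
Qed.

Lemma measurable_L1loc_restrict : measurable_fun setT (w \_ D).
Proof. by apply/(measurable_restrictT _ mD); case: wD. Qed.

Lemma L1loc_integrable_indic L : compact L -> L `<=` D ->
  mu.-integrable setT (EFin \o (fun x => (w \_ D) x * \1_L x)).
Proof.
move=> cL LD; have mL := compact_measurable_rV cL.
have [_ /(_ L mL (compact_compactly_contained cL LD))] := wD.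
move=> /(integrable_mkcond _ mL); apply: eq_integrable => // x _.
rewrite !patchE /= indicE; have [xL|xL] := boolP (x \in L); last by rewrite mulr0.
by rewrite patchE mem_set ?mulr1//; apply: LD; exact: set_mem.
Qed.

Let dominated f L (M : R) : (\forall x \ae mu, `|f x| <= M) ->
  (\forall x \ae mu, ~ L x -> f x = 0) ->
  \forall x \ae mu, `|(w \_ D) x * f x| <= M * `|(w \_ D) x * \1_L x|.
Proof.
move=> fM fL; apply: filterS2 fM fL => x xM xL.
rewrite !normrM indicE; have [Lx|Lx] := pselect (L x).
  by rewrite mem_set// normr1 mulr1 mulrC ler_wpM2r.
by rewrite xL// normr0 !mulr0 ?mulr_ge0// (le_trans _ xM).
Qed.

Lemma L1loc_integrable f L (M : R) : measurable_fun setT f -> compact L -> L `<=` D ->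
  (\forall x \ae mu, `|f x| <= M) -> (\forall x \ae mu, ~ L x -> f x = 0) ->
  mu.-integrable setT (EFin \o (fun x => (w \_ D) x * f x)).
Proof.
move=> mf cL LD fM fL.
apply: le_integrable_ae (dominated fM fL) _.
  by apply: measurable_funM => //; exact: measurable_L1loc_restrict.
exact: (integrableZl measurableT M (integrable_abse (L1loc_integrable_indic cL LD))).
Qed.

Lemma L1loc_cvg (f_ : nat -> E -> R) f L (M : R) :
  (forall k, measurable_fun setT (f_ k)) -> measurable_fun setT f ->
  compact L -> L `<=` D ->
  (forall k, \forall x \ae mu, `|f_ k x| <= M) ->
  (forall k, \forall x \ae mu, ~ L x -> f_ k x = 0) ->
  (\forall x \ae mu, D x -> f_ ^~ x @ \oo --> f x) ->
  \int[mu]_(x in D) (w x * f_ k x) @[k --> \oo] --> \int[mu]_(x in D) (w x * f x).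
Proof.
move=> mf_ mf cL LD fM fL f_f; rewrite Rintegral_restrict.
under eq_fun do rewrite Rintegral_restrict.
apply: (@Rdominated_convergence _ _ _ _ _ _ (fun x => M * `|(w \_ D) x * \1_L x|)).
- by move=> k; apply: measurable_funM => //; exact: measurable_L1loc_restrict.
- by apply: measurable_funM => //; exact: measurable_L1loc_restrict.
- apply: filterS f_f => x xf; rewrite !patchE; case: ifPn => xD.
    by apply: cvgM; [exact: cvg_cst|apply: xf; exact: set_mem].
  by rewrite mul0r; under eq_fun do rewrite mul0r; exact: cvg_cst.
- exact: (integrableZl measurableT M (integrable_abse (L1loc_integrable_indic cL LD))).
- by move=> k; exact: dominated.
Qed.

End L1loc.

(** The boundary condition at threshold 1 makes m = max(u - 1, 0) square integrable, and
    [u <= 1 + m <= 2 + m^2] on the set [D] of finite measure. *)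
Lemma le0_boundary_integrable s D u : open D -> bounded_set D ->
  measurable_fun setT u -> (\forall x \ae mu, D x -> 0 < u x) ->
  (forall x, ~ D x -> u x = 0) -> le0_boundary s D u ->
  mu.-integrable setT (EFin \o u).
Proof.
move=> oD bD mu_ upos uD /(_ 1 ltr01)[[u1 _] _].
have mD := open_measurable_rV oD.
have i1 := integrable_indic_lty mD (lebesgue_rV_bounded bD mD).
have i2 := Lfun2_integrable_sqr u1.
apply: (@le_integrable_ae _ _ _ _ _ (fun x => 2 * \1_D x + (Num.max (u x - 1) 0) ^+ 2)) => //.
  apply: filterS upos => x ux.
  have [Dx|Dx] := pselect (D x); last first.
    by rewrite uD// normr0 addr_ge0 ?mulr_ge0 ?sqr_ge0.
  rewrite gtr0_norm ?ux// indicE mem_set// mulr1.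
  have : u x - 1 <= Num.max (u x - 1) 0 by rewrite le_max lexx.
  move: (Num.max _ _) => m um; have := sqr_ge0 (m - 2^-1); nra.
exact: (integrableD measurableT (integrableZl measurableT 2 i1) i2).
Qed.

Lemma integrable_gquot_sqr s v : measurable_fun setT v -> (gagliardo2 s setT v < +oo)%E ->
  mu2.-integrable setT (EFin \o (fun z => gquot s v z ^+ 2)).
Proof.
move=> mv; rewrite gagliardo2E => voo; apply/integrableP; split.
  by apply/measurable_EFinP; apply: measurable_funX; exact: measurable_gquot.
move: voo; congr (_ < _)%E; apply: eq_integral => z _ /=.
by rewrite ger0_norm// sqr_ge0.
Qed.

Section form.
Variables (s : R) (D : set E) (u : E -> R) (K L : set E) (d : R).
Hypotheses (s0 : 0 < s) (s1 : s < 1) (uloc : Ws2loc s D u).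
Hypothesis iu : mu.-integrable setT (EFin \o u).
Hypotheses (d0 : 0 < d) (cL : compact L) (LD : L `<=` D).
Hypothesis KL : forall x y, K y -> `|x - y| <= d -> L x.

Let mu_ : measurable_fun setT u.
Proof. by apply/measurable_EFinP; case/integrableP : iu. Qed.

Let mL : measurable L. Proof. exact: compact_measurable_rV. Qed.

(** The contribution of [u] to pairs inside [L], integrable because [u] is locally in the fractional
    space. *)
Definition near_form (z : E * E) : R := gquot s u z ^+ 2 * \1_(L `*` L) z.

(** The contribution of [u] to pairs at distance at least [d]; the integrability of [u] alone makes
    it integrable. *)
Definition far_form (z : E * E) : R :=
  (`|u z.1| + `|u z.2|) * far_kernel s d (z.1 - z.2).

Lemma near_form_ge0 z : 0 <= near_form z.
Proof. by rewrite /near_form mulr_ge0// sqr_ge0. Qed.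

Lemma integrable_near_form : mu2.-integrable setT (EFin \o near_form).
Proof.
have mLL : measurable (L `*` L) by exact: measurableX.
have [_ _ /(_ L mL (compact_compactly_contained cL LD))[_]] := uloc.
rewrite gagliardo2E => loo.
have mg : measurable_fun setT (fun z => gquot s u z ^+ 2).
  by apply: measurable_funX; exact: measurable_gquot.
have : mu2.-integrable (L `*` L) (EFin \o (fun z => gquot s u z ^+ 2)).
  apply/integrableP; split.
    by apply/measurable_EFinP; apply: measurable_funTS.
  move: loo; congr (_ < _)%E; apply: eq_integral => z _ /=.
  by rewrite ger0_norm// sqr_ge0.
move=> /(integrable_mkcond _ mLL); apply: eq_integrable => // z _.
rewrite patchE /near_form /= indicE; by case: ifPn => _; rewrite ?mulr1// mulr0.
Qed.

Lemma measurable_far_form : measurable_fun setT far_form.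
Proof.
apply: measurable_funM; last first.
  exact: measurableT_comp (measurable_far_kernel s d) measurable_rV_sub.
apply: measurable_funD; apply: measurableT_comp => //.
  exact: measurableT_comp mu_ measurable_fst.
exact: measurableT_comp mu_ measurable_snd.
Qed.

Lemma far_form_ge0 z : 0 <= far_form z.
Proof. by rewrite mulr_ge0 ?far_kernel_ge0. Qed.

Lemma integrable_far_form : mu2.-integrable setT (EFin \o far_form).
Proof.
apply/integrableP; split; first by apply/measurable_EFinP; exact: measurable_far_form.
pose U (x : E) : \bar R := (`|u x|)%:E; pose k (z : E) : \bar R := (far_kernel s d z)%:E.
have U0 x : (0 <= U x)%E by rewrite lee_fin.
have k0 x : (0 <= k x)%E by rewrite lee_fin far_kernel_ge0.
have mU : measurable_fun setT U by apply/measurable_EFinP; exact: measurableT_comp.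
have mk : measurable_fun setT k by apply/measurable_EFinP; exact: measurable_far_kernel.
have mk2 : measurable_fun setT (fun z : E * E => k (z.1 - z.2)).
  exact: measurableT_comp mk measurable_rV_sub.
rewrite (eq_integral (fun z : E * E => U z.1 * k (z.1 - z.2)%R + U z.2 * k (z.1 - z.2)%R)%E); last first.
  move=> z _; rewrite /= ger0_norm ?far_form_ge0// /far_form mulrDl EFinD !EFinM//.
have m1 : measurable_fun setT (fun z : E * E => (U z.1 * k (z.1 - z.2)%R)%E).
  by apply: emeasurable_funM => //; exact: measurableT_comp mU measurable_fst.
have m2 : measurable_fun setT (fun z : E * E => (U z.2 * k (z.1 - z.2)%R)%E).
  by apply: emeasurable_funM => //; exact: measurableT_comp mU measurable_snd.
rewrite ge0_integralD//; last 2 first.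
- by move=> z _; exact: mule_ge0.
- by move=> z _; exact: mule_ge0.
rewrite (ge0_integral2_fst_conv mU U0 mk k0) (ge0_integral2_snd_conv mU U0 mk k0).
have Uoo : (\int[mu]_x U x < +oo)%E by case/integrableP : iu.
have koo : (\int[mu]_x k x < +oo)%E by exact: integral_far_kernel.
have h : (\int[mu]_x U x * \int[mu]_x k x < +oo)%E.
  by rewrite lte_mul_pinfty// ?integral_ge0// ge0_fin_numE// integral_ge0.
exact: lte_add_pinfty.
Qed.

(** If one point lies in [K] and the other within [d] of it, then both lie in [L]. *)
Lemma far_of_support v z : ~ (L `*` L) z ->
  (~ K z.1 -> v z.1 = 0) -> (~ K z.2 -> v z.2 = 0) ->
  (v z.1 = 0 /\ v z.2 = 0) \/ d <= `|z.1 - z.2|.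
Proof.
move=> zL vK1 vK2; have [dz|zd] := leP d `|z.1 - z.2|; first by right.
left; split; [apply: vK1 => K1|apply: vK2 => K2]; apply: zL; split.
- by apply: (KL K1); rewrite subrr normr0 ltW.
- by apply: (KL K1); rewrite distrC ltW.
- by apply: (KL K2); rewrite ltW.
- by apply: (KL K2); rewrite subrr normr0 ltW.
Qed.

(** Young's inequality on pairs inside [L], the triangle inequality on distant pairs. The weight [e]
    stays free because the integral of [near_form] is a fixed number: only its coefficient can be
    made small. *)
Lemma gquot_mul_le v (e : R) z : 0 < e ->
  (~ K z.1 -> v z.1 = 0) -> (~ K z.2 -> v z.2 = 0) ->
  `|gquot s u z * gquot s v z| <= e * near_form z + e^-1 * gquot s v z ^+ 2 +
    (`|v z.1| + `|v z.2|) * far_form z.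
Proof.
move=> e0 vK1 vK2.
have t20 : 0 <= e^-1 * gquot s v z ^+ 2 by rewrite mulr_ge0 ?invr_ge0 ?sqr_ge0 ?ltW.
have t30 : 0 <= (`|v z.1| + `|v z.2|) * far_form z by rewrite mulr_ge0 ?far_form_ge0.
have [zL|zL] := pselect ((L `*` L) z).
  rewrite /near_form indicE mem_set// mulr1 -[leLHS]addr0 lerD//.
  rewrite normrM -[gquot s u z ^+ 2]real_normK ?num_real// -[gquot s v z ^+ 2]real_normK ?num_real//.
  move: `|_| `|_| (normr_ge0 (gquot s u z)) (normr_ge0 (gquot s v z)) => b a _ _.
  have eb : e * (e^-1 * b ^+ 2) = b ^+ 2 by rewrite mulrA mulfV ?gt_eqF// mul1r.
  rewrite -(ler_pM2l e0) mulrDr. rewrite eb (_ : e * (e * a ^+ 2) = (e * a) ^+ 2); last by ring.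
  rewrite mulrA; move: (e * a) => c.
  have := sqr_ge0 (c - b); have := sqr_ge0 c; have := sqr_ge0 b; nra.
have t10 : 0 <= e * near_form z by rewrite mulr_ge0 ?(ltW e0) ?near_form_ge0.
have [z0|dz] := far_of_support zL vK1 vK2.
  have v0 : gquot s v z = 0 by rewrite /gquot z0.1 z0.2 subrr mul0r.
  by rewrite [X in `|_ * X| <= _]v0 mulr0 normr0 addr_ge0// addr_ge0.
apply: (@le_trans _ _ ((`|v z.1| + `|v z.2|) * far_form z)); last by rewrite lerDr addr_ge0.
rewrite gquotM normrM normrM [X in _ * X <= _]ger0_norm ?inv_frac_kernel_ge0//.
rewrite /far_form /far_kernel dz /frac_kernel mulrA [X in X * _ <= _]mulrC.
rewrite ler_wpM2r ?invr_ge0 ?powR_ge0//.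
by rewrite ler_pM// (le_trans (ler_normB _ _)).
Qed.

Lemma integrable_frac_form v (M : R) : measurable_fun setT v ->
  (\forall x \ae mu, `|v x| <= M) -> (\forall x \ae mu, ~ K x -> v x = 0) ->
  (gagliardo2 s setT v < +oo)%E ->
  mu2.-integrable setT (EFin \o (fun z => gquot s u z * gquot s v z)).
Proof.
move=> mv vM vK gv.
apply: (@le_integrable_ae _ _ _ _ _ (fun z => (1 * near_form z + 1^-1 * gquot s v z ^+ 2) +
  (M + M) * far_form z)).
- by apply: measurable_funM; exact: measurable_gquot.
- apply: filterS2 (filterI (ae_fst vM) (ae_snd vM)) (filterI (ae_fst vK) (ae_snd vK)).
  move=> z [z1 z2] [K1 K2]; apply: (le_trans (gquot_mul_le ltr01 K1 K2)).
  by rewrite lerD2l ler_wpM2r ?far_form_ge0// lerD.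
have i1 := integrableZl measurableT 1 integrable_near_form.
have i2 := integrableZl measurableT 1^-1 (integrable_gquot_sqr mv gv).
have i3 := integrableZl measurableT (M + M) integrable_far_form.
exact: (integrableD measurableT (integrableD measurableT i1 i2) i3).
Qed.

(** The near part is made small by Young's inequality and the seminorms; the far part tends to 0 by
    dominated convergence, which is where the uniform bound and the pointwise limit enter. *)
Lemma cvg_frac_form0 (v_ : nat -> E -> R) (M : R) : (forall k, measurable_fun setT (v_ k)) ->
  (forall k, \forall x \ae mu, `|v_ k x| <= M) ->
  (forall k, \forall x \ae mu, ~ K x -> v_ k x = 0) ->
  (forall k, (gagliardo2 s setT (v_ k) < +oo)%E) ->
  (\forall x \ae mu, v_ ^~ x @ \oo --> 0) ->
  gagliardo s (v_ k) @[k --> \oo] --> 0 ->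
  frac_form s u (v_ k) @[k --> \oo] --> 0.
Proof.
move=> mv vM vK gv v0 gv0.
pose A := \int[mu2]_z near_form z.
have A0 : 0 <= A by apply: Rintegral_ge0 => z _; exact: near_form_ge0.
pose w k (z : E * E) : R := (`|v_ k z.1| + `|v_ k z.2|) * far_form z.
have mw k : measurable_fun setT (w k).
  apply: measurable_funM; last exact: measurable_far_form.
  apply: measurable_funD; apply: measurableT_comp => //.
    exact: measurableT_comp (mv k) measurable_fst.
  exact: measurableT_comp (mv k) measurable_snd.
have wM k : \forall z \ae mu2, `|w k z| <= (M + M) * far_form z.
  apply: filterS2 (ae_fst (vM k)) (ae_snd (vM k)) => z z1 z2.
  have wk0 : 0 <= w k z by rewrite mulr_ge0 ?far_form_ge0// addr_ge0.
  by rewrite (ger0_norm wk0) ler_wpM2r ?far_form_ge0// lerD.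
have iM : mu2.-integrable setT (EFin \o (fun z => (M + M) * far_form z)).
  exact: (integrableZl measurableT (M + M) integrable_far_form).
have iw k : mu2.-integrable setT (EFin \o w k) := le_integrable_ae (mw k) (wM k) iM.
have w0 : \int[mu2]_z w k z @[k --> \oo] --> 0.
  have -> : 0 = \int[mu2]_z (cst 0 z) :> R by rewrite /Rintegral integral0.
  apply: (Rdominated_convergence mw) iM wM => //.
  apply: filterS2 (ae_fst v0) (ae_snd v0) => z z1 z2.
  have : w k z @[k --> \oo] --> ((`|0 : R| + `|0 : R|) * far_form z : R).
    have h1 : (`|v_ k z.1| + `|v_ k z.2|) @[k --> \oo] --> (`|0 : R| + `|0 : R| : R).
      exact: (cvgD (cvg_norm z1) (cvg_norm z2)).
    exact: (cvgM h1 (cvg_cst (far_form z))) .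
  by rewrite normr0 addr0 mul0r.
pose G k := \int[mu2]_z (gquot s (v_ k) z ^+ 2).
have G0 : G k @[k --> \oo] --> 0.
  have GE k : G k = gagliardo s (v_ k) * gagliardo s (v_ k).
    rewrite -expr2 sqr_sqrtr; last first.
      by apply: fine_ge0; rewrite gagliardo2E; apply: integral_ge0 => z _; rewrite lee_fin sqr_ge0.
    by rewrite gagliardo2E.
  by under eq_fun do rewrite GE; rewrite -(mulr0 0); exact: cvgM.
have bound e k : 0 < e ->
    `|frac_form s u (v_ k)| <= e * A + e^-1 * G k + \int[mu2]_z w k z.
  move=> e0.
  have i1 := integrableZl measurableT e integrable_near_form.
  have i2 := integrableZl measurableT e^-1 (integrable_gquot_sqr (mv k) (gv k)).
  have i12 := integrableD measurableT i1 i2.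
  have iT := integrable_frac_form (mv k) (vM k) (vK k) (gv k).
  rewrite frac_formE (le_trans (le_normr_Rintegral _ iT))//.
  rewrite /A /G -RintegralZl//; last exact: integrable_near_form.
  rewrite -RintegralZl//; last exact: (integrable_gquot_sqr (mv k) (gv k)).
  rewrite -RintegralD// -RintegralD//.
  apply: fine_le; [apply: integrable_fin_num => //..|].
  - exact: (integrable_abse iT).
  - exact: (integrableD measurableT i12 (iw k)).
  apply: ae_ge0_le_integral => //.
  - by apply/measurable_EFinP; apply: measurableT_comp => //; apply: measurable_funM; exact: measurable_gquot.
  - move=> z _; rewrite lee_fin; apply: addr_ge0; last by rewrite mulr_ge0 ?far_form_ge0.
    apply: addr_ge0; apply: mulr_ge0; rewrite ?near_form_ge0 ?sqr_ge0 ?invr_ge0 ?(ltW e0)//.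
  - by case/integrableP : (integrableD measurableT i12 (iw k)).
  apply: filterS2 (ae_fst (vK k)) (ae_snd (vK k)) => z K1 K2 _.
  by rewrite lee_fin; exact: gquot_mul_le.
apply/cvgr0Pnorm_le => e e0.
have A10 : 0 < A + 1 by rewrite ltr_wpDl.
(* Each of the three terms of [bound] gets [e / 3]; the [+ 1] keeps the denominator positive when
   [A = 0]. *)
pose e' := e / (3 * (A + 1)).
have e'0 : 0 < e' by rewrite divr_gt0// mulr_gt0.
have e'A : e' * A <= e / 3.
  rewrite /e' invfM mulrA -mulrA ler_piMr ?divr_ge0 ?(ltW e0)//.
  by rewrite mulrC ler_pdivrMr// mul1r lerDl.
have e30 : 0 < e / 3 by rewrite divr_gt0.
have Ge : \forall k \near \oo, `|G k| <= e' * (e / 3).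
  by apply: cvgr0_norm_le G0 _ _; rewrite mulr_gt0.
have We : \forall k \near \oo, `|\int[mu2]_z w k z| <= e / 3.
  exact: cvgr0_norm_le w0 _ _.
near=> k.
have Gk : `|G k| <= e' * (e / 3) by near: k.
have Wk : `|\int[mu2]_z w k z| <= e / 3 by near: k.
have G'k : e'^-1 * G k <= e / 3 by rewrite ler_pdivrMl// (le_trans (ler_norm _)).
have W'k := le_trans (ler_norm _) Wk.
have -> : e = e / 3 + e / 3 + e / 3 by field.
by apply: (le_trans (bound _ k e'0)); rewrite lerD// lerD.
Unshelve. all: by end_near. Qed.

End form.
End forms.

(** * Extension of the weak equation to bounded compactly supported functions *)

Section weak_formulation.
Context {R : realType} {n : nat}.
Local Notation E := 'rV[R]_n.+1.
Local Notation mu := (@lebesgue_rV R n.+1).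
Local Notation mu2 := (mu \x mu)%E.
Implicit Types (s : R) (K L D : set E) (f g u v w phi : E -> R).

Lemma gquotB s f g z : gquot s (f \- g) z = gquot s f z - gquot s g z.
Proof. by rewrite /gquot -mulrBl; congr (_ * _); rewrite /=; ring. Qed.

Lemma gquotZ s (a : R) f z : gquot s (fun x => a * f x) z = a * gquot s f z.
Proof. by rewrite /gquot mulrA -mulrBr. Qed.

Lemma Lfun2_dominated g (h : E -> R) :
  measurable_fun setT g -> mu.-integrable setT (EFin \o h) ->
  (\forall x \ae mu, g x ^+ 2 <= h x) -> g \in Lfun mu 2%:E.
Proof.
move=> mg ih gh; apply: lty_Lfun2 => //.
have : mu.-integrable setT (EFin \o (fun x => g x ^+ 2)).
  apply: le_integrable_ae ih; first exact: measurable_funX.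
  by apply: filterS gh => x; rewrite ger0_norm// sqr_ge0.
case/integrableP => _; congr (_ < _)%E.
by apply: eq_integral => z _ /=; rewrite ger0_norm// sqr_ge0.
Qed.

Lemma gagliardo2_le s g (h : E * E -> R) :
  measurable_fun setT g -> mu2.-integrable setT (EFin \o h) ->
  (\forall z \ae mu2, gquot s g z ^+ 2 <= h z) -> (gagliardo2 s setT g < +oo)%E.
Proof.
move=> mg ih gh.
have : mu2.-integrable setT (EFin \o (fun z => gquot s g z ^+ 2)).
  apply: le_integrable_ae ih.
    by apply: measurable_funX; exact: measurable_gquot.
  by apply: filterS gh => z; rewrite ger0_norm// sqr_ge0.
case/integrableP => _; rewrite gagliardo2E; congr (_ < _)%E.
by apply: eq_integral => z _ /=; rewrite ger0_norm// sqr_ge0.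
Qed.

Lemma Ws20_measurable s D f : Ws20 s D f -> measurable_fun setT f.
Proof. by move=> [[f2 _] _]; exact: Lfun_measurable f2. Qed.

Lemma Ws20B s D f g : Ws20 s D f -> Ws20 s D g -> Ws20 s D (f \- g).
Proof.
move=> fW gW; have mf := Ws20_measurable fW; have mg := Ws20_measurable gW.
case: fW => -[f2 gf] fD; case: gW => -[g2 gg] gD.
split; first split.
- have i1 := integrableZl measurableT 2 (Lfun2_integrable_sqr f2).
  have i2 := integrableZl measurableT 2 (Lfun2_integrable_sqr g2).
  apply: (Lfun2_dominated _ (integrableD measurableT i1 i2)); first exact: measurable_funB.
  apply: aeW => x /=; move: (f x) (g x) => a b; have := sqr_ge0 (a + b); nra.
- have i1 := integrableZl measurableT 2 (integrable_gquot_sqr mf gf).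
  have i2 := integrableZl measurableT 2 (integrable_gquot_sqr mg gg).
  apply: (@gagliardo2_le s (f \- g) _ _ (integrableD measurableT i1 i2)).
    exact: measurable_funB.
  apply: aeW => z; rewrite gquotB.
  move: (gquot s f z) (gquot s g z) => a b; have := sqr_ge0 (a + b); nra.
- by apply: filterS2 fD gD => x fx gx Dx /=; rewrite fx// gx// subrr.
Qed.

Lemma Ws20Z s D (a : R) f : Ws20 s D f -> Ws20 s D (fun x => a * f x).
Proof.
move=> fW; have mf := Ws20_measurable fW; case: fW => -[f2 gf] fD.
split; first split.
- have i1 := integrableZl measurableT (a ^+ 2) (Lfun2_integrable_sqr f2).
  apply: (Lfun2_dominated _ i1); first exact: measurable_funM.
  by apply: aeW => x; rewrite exprMn.
- have i1 := integrableZl measurableT (a ^+ 2) (integrable_gquot_sqr mf gf).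
  apply: (@gagliardo2_le s _ _ _ i1); first exact: measurable_funM.
  by apply: aeW => z; rewrite gquotZ exprMn.
- by apply: filterS fD => x fx Dx /=; rewrite fx// mulr0.
Qed.

Section extension.
Variables (s : R) (D : set E) (u : E -> R) (omega : (E -> R) -> R).
Hypotheses (s0 : 0 < s) (s1 : s < 1) (oD : open D).
Hypotheses (uloc : Ws2loc s D u) (iu : mu.-integrable setT (EFin \o u)).
Hypothesis omegaD : dual_Ws20 s D omega.

Let mD : measurable D. Proof. exact: open_measurable_rV. Qed.

Lemma dual_cvg (phi : nat -> E -> R) f : (forall k, Ws20 s D (phi k)) -> Ws20 s D f ->
  gagliardo s (phi k \- f) @[k --> \oo] --> 0 -> omega (phi k) @[k --> \oo] --> omega f.
Proof.
have [lin [C oC]] := omegaD; move=> phiW fW phif.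
have omegaB k : omega (phi k) - omega f = omega (phi k \- f).
  have := lin 1 _ _ (Ws20B (phiW k) fW) fW; rewrite mul1r.
  rewrite (_ : (fun x => _) = phi k) => [->|]; first by rewrite addrK.
  by apply/funext => x /=; rewrite mul1r subrK.
apply/subr_cvg0; under eq_fun do rewrite omegaB.
have h : C * gagliardo s (phi k \- f) @[k --> \oo] --> 0.
  by rewrite -(mulr0 C); apply: cvgM => //; exact: cvg_cst.
apply/norm_cvg0P.
apply: (squeeze_cvgr _ (cvg_cst 0) h).
by apply: nearW => k; rewrite normr_ge0/=; apply: oC; exact: Ws20B.
Qed.

(** The coefficients are left free for two uses: the equation of problem (D), and, with [a = 0], the
    representation of [omega] by a locally integrable function. *)
Lemma weak_form_extension w (a b : R) : L1loc D w ->
  (forall phi, Cc_smooth D phi ->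
     a * frac_form s u phi + b * \int[mu]_(x in D) (w x * phi x) = omega phi) ->
  forall f, Ws20 s D f -> Linftyc D f ->
     a * frac_form s u f + b * \int[mu]_(x in D) (w x * f x) = omega f.
Proof.
move=> wD eqn f fW finf; have mf := Ws20_measurable fW.
have [K [M [phi [[cK KD] phiP phif gphif [fM fK]]]]] := Ws20_approx s0 oD fW finf.
have phiC k : Cc_smooth D (phi k) by case: (phiP k).
have phiW k : Ws20 s D (phi k) by case: (phiP k).
have phiM k x : `|phi k x| <= M by case: (phiP k).
have phiK k x : ~ K x -> phi k x = 0 by case: (phiP k) => _ _ _; exact.
have mphi k := Ws20_measurable (phiW k).
(* A second thickening: [K] already contains the supports of all the approximations, and the form
   estimates need room around it. *)
have [d [L [d0 cL LD KL]]] := compact_thickening cK oD KD.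
have iff := integrable_frac_form s0 uloc iu d0 cL LD KL mf fM fK fW.1.2.
have v0 : frac_form s u (phi k \- f) @[k --> \oo] --> 0.
  apply: (cvg_frac_form0 s0 uloc iu d0 cL LD KL (M := M + M)) => //.
  - by move=> k; exact: measurable_funB.
  - move=> k; apply: filterS fM => x fx /=.
    by rewrite (le_trans (ler_normB _ _))// lerD.
  - by move=> k; apply: filterS fK => x fx Kx /=; rewrite fx// phiK// subrr.
  - by move=> k; exact: (Ws20B (phiW k) fW).1.2.
  - apply: filterS phif => x fx; rewrite -(subrr (f x)).
    by apply: cvgB => //; exact: cvg_cst.
have T_cvg : frac_form s u (phi k) @[k --> \oo] --> frac_form s u f.
  have TB k : frac_form s u (phi k) - frac_form s u f = frac_form s u (phi k \- f).
    have iphi := integrable_frac_form s0 uloc iu d0 cL LD KL (mphi k)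
      (aeW _ (phiM k)) (aeW _ (phiK k)) (phiW k).1.2.
    rewrite !frac_formE -RintegralB//; apply: eq_Rintegral => z _.
    by rewrite gquotB mulrBr.
  by apply/subr_cvg0; under eq_fun do rewrite TB.
have w_cvg : \int[mu]_(x in D) (w x * phi k x) @[k --> \oo] -->
    \int[mu]_(x in D) (w x * f x).
  apply: (L1loc_cvg mD wD mphi mf cK KD (M := M)).
  - by move=> k; exact: aeW.
  - by move=> k; exact: aeW (phiK k).
  - by apply: filterS phif => x fx _.
have lhs : omega (phi k) @[k --> \oo] -->
    a * frac_form s u f + b * \int[mu]_(x in D) (w x * f x).
  under eq_fun do rewrite -eqn//.
  by apply: cvgD; apply: cvgM => //; exact: cvg_cst.
exact: cvg_unique lhs (dual_cvg phiW fW gphif).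
Qed.

End extension.

End weak_formulation.

(** * Truncated test functions and the equivalence of the two problems *)

Section equivalence.
Context {R : realType} {n : nat}.
Local Notation E := 'rV[R]_n.+1.
Local Notation mu := (@lebesgue_rV R n.+1).
Local Notation mu2 := (mu \x mu)%E.
Implicit Types (K L : set E) (f v w phi : E -> R).

(** This bounds the increments of the truncated test function by those of [u] and [phi], hence its
    seminorm near the support. *)
Lemma maxr_sqr_dist (a b a' b' : R) :
  (Num.max a b - Num.max a' b') ^+ 2 <= (a - a') ^+ 2 + (b - b') ^+ 2.
Proof.
have sq (x y : R) : 0 <= x <= y -> x ^+ 2 <= y ^+ 2.
  by move=> /andP[x0 xy]; rewrite lerXn2r ?nnegrE// (le_trans x0).
have [aa bb] := (sqr_ge0 (a - a'), sqr_ge0 (b - b')).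
have [ab|ba] := leP a b; have [ab'|ba'] := leP a' b'.
- by rewrite lerDr.
- have [h|h] := leP a' b.
    have /sq : 0 <= b - a' <= b - b' by apply/andP; split; lra.
    by lra.
  rewrite -[X in X ^+ 2 <= _]opprB sqrrN -[X in _ <= X ^+ 2 + _]opprB sqrrN.
  have /sq : 0 <= a' - b <= a' - a by apply/andP; split; lra.
  by lra.
- have [h|h] := leP b' a.
    have /sq : 0 <= a - b' <= a - a' by apply/andP; split; lra.
    by lra.
  rewrite -[X in X ^+ 2 <= _]opprB sqrrN -[X in _ <= _ + X ^+ 2]opprB sqrrN.
  have /sq : 0 <= b' - a <= b' - b by apply/andP; split; lra.
  by lra.
- by rewrite lerDl.
Qed.

(** The negative part is a nonincreasing function; this is the favourable sign in the form. *)
Lemma mul_sub_negpart_le0 (x y : R) : (x - y) * (Num.max (- x) 0 - Num.max (- y) 0) <= 0.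
Proof.
have [x0|x0] := leP (- x) 0; have [y0|y0] := leP (- y) 0.
- by rewrite subrr mulr0.
- by rewrite pmulr_rle0; lra.
- by rewrite nmulr_rle0; lra.
- by rewrite (_ : _ * _ = - (x - y) ^+ 2) ?oppr_le0 ?sqr_ge0//; ring.
Qed.

Lemma negpart_dist (x y : R) : `|Num.max (- x) 0 - Num.max (- y) 0| <= `|x - y|.
Proof.
have [x0|x0] := leP (- x) 0; have [y0|y0] := leP (- y) 0.
- by rewrite subrr normr0.
- by rewrite sub0r opprK ltr0_norm -?oppr_gt0// gtr0_norm; lra.
- by rewrite subr0 gtr0_norm// ltr0_norm; lra.
- by rewrite -opprD normrN.
Qed.

Lemma frac_const_ge0 (s : R) : 0 <= frac_const n s.
Proof.
rewrite invr_ge0; apply: Rintegral_ge0 => x _.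
by rewrite divr_ge0 ?powR_ge0// subr_ge0 cos_le1.
Qed.

Lemma smoothZ (a : R) f : smooth f -> smooth (fun x => a * f x).
Proof.
move=> sf; apply: (@smooth_coind _ _ (fun g => exists2 f, smooth f & g = fun x => a * f x));
  last by exists f.
move=> _ {sf f}[f sf ->]; have [cf df] := sf [::]; split.
  by move=> x; apply: continuousM; [exact: cst_continuous|exact: cf].
move=> i; have dfx x : is_derive x (delta_mx ord0 i) (fun x => a * f x)
    (a * 'D_(delta_mx ord0 i) f x).
  by apply: is_deriveZ; apply: DeriveDef => //; exact: df.
split; first by move=> x; case: (dfx x).
exists ('D_(delta_mx ord0 i) f); last by apply/funext => x; case: (dfx x).
(* The last index of the list is differentiated first. *)
by move=> r; have := sf (rcons r i); rewrite /iter_partial foldr_rcons.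
Qed.

Lemma Cc_smoothZ D (a : R) f : Cc_smooth D f -> Cc_smooth D (fun x => a * f x).
Proof.
move=> [sf [cf fD]]; split; first exact: smoothZ.
have sub : closure [set x | a * f x != 0] `<=` closure [set x | f x != 0].
  by apply: closure_subset => x /=; rewrite mulf_eq0 negb_or => /andP[].
split; last exact: subset_trans fD.
by apply: subclosed_compact sub => //; exact: closed_closure.
Qed.

Variables (s gamma : R) (D : set E) (omega : (E -> R) -> R) (u : E -> R).
Hypotheses (s0 : 0 < s) (s1 : s < 1) (oD : open D) (bD : bounded_set D).
Hypotheses (omegaD : dual_Ws20 s D omega) (uloc : Ws2loc s D u).

Let mu_ : measurable_fun setT u. Proof. by case: uloc. Qed.

Let uD x : ~ D x -> u x = 0. Proof. by case: uloc => _ + _; exact. Qed.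

Let mD : measurable D. Proof. exact: open_measurable_rV. Qed.

Lemma problem_D_problem_V : problem_D s gamma D omega u -> problem_V s gamma D omega u.
Proof.
move=> [[upos uL1] eqn bdry]; split => // v vW vinf _.
have iu := le0_boundary_integrable oD bD mu_ upos uD bdry.
rewrite le_eqVlt; apply/orP; left; apply/eqP; apply/esym.
rewrite -(@weak_form_extension _ _ s D u omega s0 oD uloc iu omegaD _
  (frac_const n s / 2) (-1) uL1 _ _ vW vinf); first by rewrite mulN1r.
by move=> phi phiD; rewrite mulN1r; exact: eqn.
Qed.

Lemma dual_L1loc_extension w : L1loc D w -> mu.-integrable setT (EFin \o u) ->
  (forall phi, Cc_smooth D phi -> omega phi = \int[mu]_(x in D) (w x * phi x)) ->
  forall f, Ws20 s D f -> Linftyc D f -> omega f = \int[mu]_(x in D) (w x * f x).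
Proof.
move=> wD iu omegaE f fW finf.
have := @weak_form_extension _ _ s D u omega s0 oD uloc iu omegaD w 0 1 wD _ f fW finf.
rewrite mul0r add0r mul1r => -> // phi phiD.
by rewrite mul0r add0r mul1r omegaE.
Qed.

Lemma scale_forms v K (M : R) : mu.-integrable setT (EFin \o u) ->
  compact K -> K `<=` D -> measurable_fun setT v ->
  (\forall x \ae mu, `|v x| <= M) -> (\forall x \ae mu, ~ K x -> v x = 0) ->
  (gagliardo2 s setT v < +oo)%E -> forall a : R,
  frac_form s u (fun x => a * v x) = a * frac_form s u v /\
  forall w, L1loc D w -> \int[mu]_(x in D) (w x * (a * v x)) =
    a * \int[mu]_(x in D) (w x * v x).
Proof.
move=> iu cK KD mv vM vK gv a; split.
  have [d [L [d0 cL LD KL]]] := compact_thickening cK oD KD.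
  have iuv := integrable_frac_form s0 uloc iu d0 cL LD KL mv vM vK gv.
  rewrite !frac_formE -RintegralZl//; apply: eq_Rintegral => z _.
  by rewrite gquotZ mulrCA.
move=> w wD; have iwv := L1loc_integrable mD wD mv cK KD vM vK.
rewrite !(Rintegral_restrict D w) -RintegralZl//; apply: eq_Rintegral => x _.
by rewrite mulrCA.
Qed.

(* The test functions are [u + t max(- u / t, phi) = max(0, u + t phi)]. *)
Lemma problem_V_le phi : dual_L1loc D omega -> problem_V s gamma D omega u ->
  Cc_smooth D phi ->
  omega phi <= frac_const n s / 2 * frac_form s u phi -
    \int[mu]_(x in D) (u x `^ (- gamma) * phi x).
Proof.
move=> [w wD omegaE] [[upos uL1] ineq bdry] phiD.
have iu := le0_boundary_integrable oD bD mu_ upos uD bdry.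
have u0 : \forall x \ae mu, 0 <= u x.
  apply: filterS upos => x ux; have [Dx|/uD ->//] := pselect (D x).
  exact: ltW (ux Dx).
have phiW := Cc_smooth_Ws20 s0 s1 phiD.
have mphi := Ws20_measurable phiW.
have [K [cK KD phiK]] := Cc_smooth_support phiD.
have [M M0 phiM] : exists2 M : R, 0 <= M & forall x, `|phi x| <= M.
  apply: compact_support_bounded cK phiK.
  by case: phiD => /(_ [::])[].
have [d [L [d0 cL LD KL]]] := compact_thickening cK oD KD.
have iuphi := integrable_frac_form s0 uloc iu d0 cL LD KL mphi (aeW _ phiM) (aeW _ phiK) phiW.1.2.
have iphi2 := integrable_gquot_sqr mphi phiW.1.2.
pose kappa k : R := k.+1%:R.
have kappa0 k : 0 < kappa k by [].
pose theta k x := Num.max (- kappa k * u x) (phi x).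
have mtheta k : measurable_fun setT (theta k).
  by apply: measurable_maxr => //; apply: measurable_funM.
(* As [u >= 0], the obstacle [- kappa k * u] is at most 0, so truncation can only move a negative
   value of [phi] towards 0: neither the sup bound nor the support grows. *)
have thetaM k : \forall x \ae mu, `|theta k x| <= M.
  apply: filterS u0 => x ux; apply: (le_trans _ (phiM x)).
  have : - kappa k * u x <= 0 by rewrite mulNr oppr_le0 mulr_ge0// ltW.
  rewrite /theta; move: (- kappa k * u x) => a a0.
  have [ay|ya] := leP a (phi x); first by [].
  by rewrite !ler0_norm ?lerN2 ?(ltW ya)// (le_trans (ltW ya)).
have thetaK k : \forall x \ae mu, ~ K x -> theta k x = 0.
  apply: filterS u0 => x ux Kx; rewrite /theta phiK// max_r//.
  by rewrite mulNr oppr_le0 mulr_ge0// ltW.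
have itheta k := ae_bounded_integrable (mtheta k) cK (thetaM k) (thetaK k).
(* Near the support the increments of [u] and [phi] dominate, with a factor [kappa k ^+ 2] that is
   not uniform in [k]. For distant pairs [theta k] takes the place of [u] in [far_form], one factor
   of the squared increment being bounded by [M + M]. *)
have gtheta k : (gagliardo2 s setT (theta k) < +oo)%E.
  have i1 := integrableZl measurableT (kappa k ^+ 2) (integrable_near_form uloc iu cL LD).
  have i3 := integrableZl measurableT (M + M) (integrable_far_form s0 (itheta k) d0).
  have i := integrableD measurableT (integrableD measurableT i1 iphi2) i3.
  apply: (gagliardo2_le (mtheta k) i).
  apply: filterS2 (filterI (ae_fst (thetaM k)) (ae_snd (thetaM k)))
    (filterI (ae_fst (thetaK k)) (ae_snd (thetaK k))) => z [z1 z2] [K1 K2].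
  have g0 : 0 <= gquot s phi z ^+ 2 by exact: sqr_ge0.
  have f0 : 0 <= (M + M) * far_form s (theta k) d z by rewrite mulr_ge0 ?addr_ge0 ?far_form_ge0.
  have n0 : 0 <= kappa k ^+ 2 * near_form s u L z by rewrite mulr_ge0 ?sqr_ge0 ?near_form_ge0.
  have [zL|zL] := pselect ((L `*` L) z).
    rewrite [leLHS](_ : _ = (theta k z.1 - theta k z.2) ^+ 2 / frac_kernel s z) ?gquot_sqr//.
    apply: le_trans (_ : (kappa k ^+ 2 * near_form s u L z + gquot s phi z ^+ 2) <= _); last first.
      by rewrite -(gquot_sqr s phi) lerDl.
    rewrite /near_form indicE mem_set// mulr1 !gquot_sqr mulrA -mulrDl.
    rewrite ler_wpM2r ?inv_frac_kernel_ge0// (le_trans (maxr_sqr_dist _ _ _ _))// lerD2r.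
    by rewrite -mulrBr exprMn sqrrN.
  rewrite (le_trans _ (_ : (M + M) * far_form s (theta k) d z <= _))//; last first.
    by rewrite lerDr addr_ge0.
  have [th0|dz] := far_of_support d0 KL zL K1 K2.
    by rewrite gquot_sqr th0.1 th0.2 subrr expr0n/= mul0r.
  rewrite gquot_sqr /far_form /far_kernel dz mulrA ler_wpM2r ?invr_ge0 ?powR_ge0//.
  rewrite -[leLHS]real_normK ?num_real// expr2 ler_pM ?normr_ge0//.
    by rewrite (le_trans (ler_normB _ _))// lerD.
  exact: ler_normB.
have thetaW k : Ws20 s D (theta k).
  split; first by split => //; exact: (ae_bounded_Lfun2 (mtheta k) cK (thetaM k) (thetaK k)).
  by apply: filterS (thetaK k) => x xK Dx; apply: xK => /KD.
have iutheta k := integrable_frac_form s0 uloc iu d0 cL LD KL (mtheta k) (thetaM k) (thetaK k) (gtheta k).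
pose t k : R := (kappa k)^-1.
have t0 k : 0 < t k by rewrite invr_gt0.
(* Test with [v = u + t theta], which is nonnegative because [theta >= - u / t], and divide by
   [t > 0]. *)
have test k : \int[mu]_(x in D) (w x * theta k x) <=
    frac_const n s / 2 * frac_form s u (theta k) -
    \int[mu]_(x in D) (u x `^ (- gamma) * theta k x).
  pose v x := u x + t k * theta k x.
  have vE : v \- u = (fun x => t k * theta k x).
    by apply/funext => x; rewrite /v /= addrC addKr.
  have vW : Ws20 s D (v \- u) by rewrite vE; exact: Ws20Z.
  have vinf : Linftyc D (v \- u).
    rewrite vE; split.
      apply: (@ae_bounded_Lfun_infty _ _ _ _ _ (t k * M)); first exact: measurable_funM.
      by apply: filterS (thetaM k) => x xM; rewrite normrM gtr0_norm// ler_wpM2l// ltW.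
    by exists K; split => //; apply: filterS (thetaK k) => x xK /xK ->; rewrite mulr0.
  have v0 : \forall x \ae mu, D x -> 0 <= v x.
    apply: aeW => x _; rewrite /v.
    have h : - kappa k * u x <= theta k x by rewrite le_max lexx.
    have := ler_wpM2l (ltW (t0 k)) h.
    rewrite mulrA mulrN /t mulVf ?gt_eqF// mulN1r => h1.
    by rewrite addrC -[u x]opprK subr_ge0.
  have := ineq v vW vinf v0.
  rewrite (dual_L1loc_extension wD iu omegaE vW vinf) vE.
  rewrite [X in _ - X](_ : _ = \int[mu]_(x in D) (u x `^ (- gamma) * (t k * theta k x))); last first.
    by apply: eq_Rintegral => x _; congr (_ * _); exact: (congr1 (fun f => f x) vE).
  have [-> wZ] := scale_forms iu cK KD (mtheta k) (thetaM k) (thetaK k) (gtheta k) (t k).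
  by rewrite !wZ// mulrCA -mulrBr ler_pM2l.
(* The correction due to truncation is the negative part of [u + t phi]. *)
pose m k x := t k * (theta k x - phi x).
have mE k x : m k x = Num.max (- (u x + t k * phi x)) 0.
  have -> : - (u x + t k * phi x) = t k * (- kappa k * u x - phi x).
    by rewrite mulrBr mulrA mulrN /t mulVf ?gt_eqF// mulN1r opprD.
  rewrite /m /theta -[X in _ = Num.max _ X](mulr0 (t k)) -maxr_pMr ?(ltW (t0 k))//.
  congr (_ * _); have [h|h] := leP (- kappa k * u x) (phi x).
    by rewrite subrr max_r// subr_le0.
  by rewrite max_l// subr_ge0 ltW.
have mm k : measurable_fun setT (m k).
  by apply: measurable_funM => //; exact: measurable_funB.
have gm k z : gquot s (m k) z = t k * (gquot s (theta k) z - gquot s phi z).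
  by rewrite -gquotB -gquotZ.
have t1 k : t k <= 1 by rewrite invf_le1// ler1n.
pose S k := \int[mu2]_z (gquot s phi z * gquot s (m k) z).
(* The negative part is 1-Lipschitz and [t <= 1], so the increments of [m k] are at most those of
   [u] plus those of [phi]. The bound does not depend on [k], and [u] occurs in it only multiplied
   by [phi], where integrability is known. *)
have dom k z : `|gquot s phi z * gquot s (m k) z| <=
   `|gquot s u z * gquot s phi z| + gquot s phi z ^+ 2.
  have h : `|gquot s (m k) z| <= `|gquot s u z| + `|gquot s phi z|.
    apply: (@le_trans _ _ `|gquot s u z + t k * gquot s phi z|); last first.
      rewrite (le_trans (ler_normD _ _))// lerD2l normrM ler_piMl//.
      by rewrite gtr0_norm.
    rewrite /gquot mulrA -mulrDl !normrM ler_wpM2r// !mE.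
    apply: (le_trans (negpart_dist _ _)); rewrite le_eqVlt; apply/orP; left; apply/eqP.
    by congr `|_|; ring.
  rewrite normrM (le_trans (ler_wpM2l (normr_ge0 _) h))// mulrDr [`|gquot s u z * _|]normrM.
  by rewrite [X in X + _ <= _]mulrC lerD2l -expr2 real_normK ?num_real.
have idom : mu2.-integrable setT (EFin \o (fun z => `|gquot s u z * gquot s phi z| + gquot s phi z ^+ 2)).
  exact: (integrableD measurableT (integrable_abse iuphi) iphi2).
have iS k : mu2.-integrable setT (EFin \o (fun z => gquot s phi z * gquot s (m k) z)).
  apply: le_integrable_ae (aeW _ (dom k)) idom.
  by apply: measurable_funM; exact: measurable_gquot.
have tcvg : t k @[k --> \oo] --> 0 by exact: cvg_harmonic.
have m0 : \forall x \ae mu, m ^~ x @ \oo --> 0.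
  apply: filterS u0 => x ux.
  have h : t k * `|phi x| @[k --> \oo] --> 0.
    by rewrite -(mul0r `|phi x|); apply: cvgM => //; exact: cvg_cst.
  apply: (squeeze_cvgr _ (cvg_cst 0) h); apply: nearW => k.
  rewrite mE le_max lexx orbT/= ge_max mulr_ge0 ?(ltW (t0 k))// andbT.
  have := ler_norm (- (t k * phi x)); rewrite normrN normrM gtr0_norm// => h1.
  by rewrite opprD (le_trans _ h1)// gerDr oppr_le0.
have S0 : S k @[k --> \oo] --> 0.
  have -> : 0 = \int[mu2]_z (cst 0 z) :> R by rewrite /Rintegral integral0.
  apply: (Rdominated_convergence _ _ _ idom) => //.
  - by move=> k; apply: measurable_funM; exact: measurable_gquot.
  - apply: filterS2 (ae_fst m0) (ae_snd m0) => z z1 z2.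
    have h1 : m k z.1 - m k z.2 @[k --> \oo] --> (0 - 0 : R) by exact: cvgB.
    have h2 := cvgM (cvg_cst (gquot s phi z)) (cvgM h1 (cvg_cst (Num.sqrt (frac_kernel s z)^-1))).
    by rewrite subrr mul0r mulr0 in h2; exact: h2.
  - by move=> k; apply: aeW; exact: dom.
(* Pointwise, with quotients A of [u], P of [phi] and T of [theta k], the sign gives (A + tP)(T - P)
   <= 0, that is AT <= AP - P t(T - P), and t(T - P) is the quotient of [m k]. *)
have formle k : frac_form s u (theta k) <= frac_form s u phi - S k.
  rewrite !frac_formE -RintegralB//; apply: le_Rintegral => //.
    exact: (integrableB measurableT iuphi (iS k)).
  move=> z _.
  have h : (gquot s u z + t k * gquot s phi z) * gquot s (m k) z <= 0.
    rewrite (_ : _ * _ = (u z.1 + t k * phi z.1 - (u z.2 + t k * phi z.2)) *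
        (m k z.1 - m k z.2) * (frac_kernel s z)^-1); last first.
      rewrite [LHS]mulrDl -mulrA !gquotM; ring.
    by rewrite mulr_le0_ge0 ?inv_frac_kernel_ge0// !mE mul_sub_negpart_le0.
  move: h; rewrite gm mulrCA pmulr_rle0//.
  move: (gquot s u z) (gquot s phi z) (gquot s (theta k) z) => A P T; lra.
have wcvg := L1loc_cvg mD wD mtheta mphi cK KD thetaM thetaK.
have ucvg := L1loc_cvg mD uL1 mtheta mphi cK KD thetaM thetaK.
(* Where [u x > 0] the sequence is eventually constant: the obstacle falls below [phi x] once [k]
   exceeds [|phi x| / u x]. *)
have theta_phi : \forall x \ae mu, D x -> theta ^~ x @ \oo --> phi x.
  apply: filterS upos => x ux Dx; apply: cvg_near_cst; near=> k.
  rewrite /theta max_r// mulNr lerNl (le_trans (ler_norm _))// normrN.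
  rewrite -ler_pdivrMr ?ux//.
  have : `|phi x| / u x <= k%:R by near: k; exact: nbhs_infty_ger.
  by move=> /le_trans; apply; rewrite ler_nat.
rewrite omegaE//.
have rhs : frac_const n s / 2 * (frac_form s u phi - S k) -
    \int[mu]_(x in D) (u x `^ (- gamma) * theta k x) @[k --> \oo] -->
    frac_const n s / 2 * (frac_form s u phi - 0) -
    \int[mu]_(x in D) (u x `^ (- gamma) * phi x).
  apply: cvgB; last exact: ucvg.
  by apply: cvgM; [exact: cvg_cst|apply: cvgB => //; exact: cvg_cst].
move: rhs; rewrite subr0 => rhs.
apply: (ler_cvg_to (wcvg theta_phi) rhs); apply: nearW => k.
rewrite (le_trans (test k))// lerD2r ler_wpM2l// divr_ge0//; exact: frac_const_ge0.
Unshelve. all: by end_near. Qed.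

Lemma problem_V_problem_D : dual_L1loc D omega -> problem_V s gamma D omega u ->
  problem_D s gamma D omega u.
Proof.
move=> omegaL1 uV; have [[upos uL1] ineq bdry] := uV; split => // phi phiD.
have [w wD omegaE] := omegaL1.
apply/eqP; rewrite eq_le (problem_V_le omegaL1 uV phiD) andbT.
have phiND : Cc_smooth D (fun x => -1 * phi x) := Cc_smoothZ (-1) phiD.
have phiW := Cc_smooth_Ws20 s0 s1 phiD.
have mphi := Ws20_measurable phiW.
have [K [cK KD phiK]] := Cc_smooth_support phiD.
have [M M0 phiM] : exists2 M : R, 0 <= M & forall x, `|phi x| <= M.
  apply: compact_support_bounded cK phiK.
  by case: phiD => /(_ [::])[].
have iu := le0_boundary_integrable oD bD mu_ upos uD bdry.
have [formN wN] := scale_forms iu cK KD mphi (aeW _ phiM) (aeW _ phiK) phiW.1.2 (-1).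
have := problem_V_le omegaL1 uV phiND.
rewrite formN !omegaE// !wN//; lra.
Qed.

End equivalence.

Theorem theorem1p1 (R : realType) (n : nat) (s gamma : R)
    (Omega : set 'rV[R]_n.+1)
    (omega : ('rV[R]_n.+1 -> R) -> R) (u : 'rV[R]_n.+1 -> R) :
  0 < s -> s < 1 -> 2 * s < n.+1%:R ->
  bounded_smooth_domain Omega ->
  0 < gamma ->
  dual_Ws20 s Omega omega ->
  Ws2loc s Omega u ->
  (problem_D s gamma Omega omega u -> problem_V s gamma Omega omega u) /\
  (dual_L1loc Omega omega ->
   (problem_D s gamma Omega omega u <-> problem_V s gamma Omega omega u)).
Proof.
move=> s0 s1 _ [_ oD _ bD _] _ omegaD uloc; split.
  exact: problem_D_problem_V.
by move=> omegaL1; split; [exact: problem_D_problem_V|exact: problem_V_problem_D].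
Qed.
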